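(* Let $n\geq 1$ and let $\Delta=(v_{n+1},\dots,v_N)$ be a tuple of vectors in $\mathbb{Z}^r\setminus\{0\}$ with $\sum_k v_k=0$, where $N=n+\#\Delta\ge 3$. The map $$\mathcal{M}^{\mathrm{lab}}_{0,n,\mathrm{trop}}(\mathbb{R}^r,\Delta)\to Q_N\times\mathbb{R}^r,\qquad C\mapsto(\varphi_N(\psi(C)),\operatorname{ev}_1(C))$$ is an embedding whose image is the tropical fan $\varphi_N(\mathcal{M}_{0,N,\mathrm{trop}})\times\mathbb{R}^r$. So $\mathcal{M}^{\mathrm{lab}}_{0,n,\mathrm{trop}}(\mathbb{R}^r,\Delta)$ can be thought of as a tropical fan of dimension $r+N-3=r+n+\#\Delta-3$, namely as the fan $\mathcal{M}_{0,n+\#\Delta,\mathrm{trop}}\times\mathbb{R}^r$.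
   Context: Abstract curves. A (rational, abstract) tropical curve is a finite connected metric graph $\Gamma$ of genus $0$ (a tree) all of whose vertices have valence at least $3$; its edges are either bounded, with a length $l(E)\in\mathbb{R}_{>0}$, or unbounded (ends), isometric to $[0,\infty)$. $\mathcal{M}_{0,N,\mathrm{trop}}$ is the set of isomorphism classes of tuples $(\Gamma,x_1,\dots,x_N)$ with $\Gamma$ a tropical curve with exactly $N$ ends, and $x_1,\dots,x_N$ its distinct ends (isomorphisms: homeomorphisms mapping the $i$-th end to the $i$-th end and each edge isometrically onto an edge). The fan $\varphi_N(\mathcal{M}_{0,N,\mathrm{trop}})$. $\operatorname{dist}_N:\mathcal{M}_{0,N,\mathrm{trop}}\to\mathbb{R}^{\binom N2}$ sends a curve to the vector of distances between its ends $x_i,x_j$ (sum of lengths of bounded edges on the path between them); $\Phi_N:\mathbb{R}^N\to\mathbb{R}^{\binom N2}$, $a\mapsto(a_i+a_j)_{\{i,j\}}$; $Q_N:=\mathbb{R}^{\binom N2}/\operatorname{Im}\Phi_N$ with projection $q_N$; $\varphi_N:=q_N\circ\operatorname{dist}_N$. By Speyer–Sturmfels $\varphi_N$ is an embedding whose image is a simplicial fan of pure dimension $N-3$ with cones corresponding to combinatorial types (relative interiors of $k$-dimensional cones = curves of one type with $k$ bounded edges). For $I\subset\{1,\dots,N\}$ with $1<|I|<N-1$, $v_I\in Q_N$ is the image of the tree with one bounded edge, of length 1, separating the ends in $I$ from the others; the $v_I$ generate the one-dimensional cones, and $\Lambda_N:=\langle v_I\rangle_{\mathbb{Z}}$ is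 the lattice used in $Q_N$. The weight of a maximal cone $\sigma$ is the index in $\Lambda_\sigma=\Lambda_N\cap\operatorname{span}(\sigma)$ of the sublattice generated by the vectors $v_I$ spanning $\sigma$. With these weights it is a tropical fan. Tropical fans. A fan in $V=\Lambda\otimes\mathbb{R}$ is a finite set of rational polyhedral cones (possibly containing lines) closed under faces, pairwise intersecting in common faces. A pure $m$-dimensional fan $X$ with positive integer weights $\omega_X$ on its $m$-dimensional cones is tropical if $\sum_{\sigma>\tau}\omega_X(\sigma)u_{\sigma/\tau}=0\in V/V_\tau$ for all $(m-1)$-dimensional cones $\tau$; here $V_\tau=\operatorname{span}\tau$, $\Lambda_\tau=V_\tau\cap\Lambda$, and $u_{\sigma/\tau}\in\Lambda_\sigma/\Lambda_\tau\cong\mathbb{Z}$ is the generator on the side of $\sigma$. $\mathbb{R}^r$ denotes the tropical fan with the single cone $\mathbb{R}^r$ of weight $1$ and lattice $\mathbb{Z}^r$. Products of fans consist of products of cones, with product weights and the product lattice. Curves in $\mathbb{R}^r$. $\mathcal{M}^{\mathrm{lab}}_{0,n,\mathrm{trop}}(\mathbb{R}^r,\Delta)$ is the set of isomorphism classes of tuples $C=(\Gamma,x_1,\dots,x_N,h)$ with $\Gamma$ a (rational, abstract) tropical curve with exactly $N$ ends, $x_1,\dots,x_N$ its distinct ends, and $h:\Gamma\to\mathbb{R}^r$ continuous such that: on each edge $E$ starting at a vertex $W$, parametrized by arc length $t$ from $W$, $h(t)=h(W)+t\,v(E,W)$ with $v(E,W)\in\mathbb{Z}^r$ (for an end $x_i$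 this vector is written $v(x_i)$); at each vertex $W$ the directions of the edges (bounded or unbounded) adjacent to $W$ sum to zero, $\sum_{E\ni W}v(E,W)=0$; $v(x_i)=0$ for $i\le n$ and $v(x_i)=v_i$ (the entry of $\Delta$) for $i=n+1,\dots,N$. Isomorphisms are isomorphisms of the abstract curves compatible with the maps $h$. The combinatorial type of $C$ is that of $(\Gamma,x_1,\dots,x_N)$ together with the directions of all edges. This space is a polyhedral complex: curves of a fixed combinatorial type with $k$ bounded edges are parametrized by $\mathbb{R}_{>0}^k\times\mathbb{R}^r$ (lengths of bounded edges, and position $h(W)$ of a root vertex $W$), and these cells are glued by contracting bounded edges as their lengths tend to $0$. $\psi:\mathcal{M}^{\mathrm{lab}}_{0,n,\mathrm{trop}}(\mathbb{R}^r,\Delta)\to\mathcal{M}_{0,N,\mathrm{trop}}$ is the map $(\Gamma,x_1,\dots,x_N,h)\mapsto(\Gamma,x_1,\dots,x_N)$, and $\operatorname{ev}_1(C):=h(x_1)\in\mathbb{R}^r$ (a point, as $x_1$ is contracted by $h$). *)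

(* Defs.v *)
From HB Require Import structures.
From mathcomp Require Import all_boot all_order all_algebra.
From mathcomp Require Import all_classical all_reals all_analysis.
Set Implicit Arguments.
Unset Strict Implicit.
Unset Printing Implicit Defensive.
Import Order.TTheory GRing.Theory Num.Theory.
Import numFieldNormedType.Exports.
Local Open Scope classical_set_scope.
Local Open Scope ring_scope.

Section Fans.
Variables (R : realType) (V : vectType R).
Implicit Types (A L s t : set V).

Definition zspan A : set V :=
  [set x | exists (k : nat) (g : 'I_k -> V) (z : 'I_k -> int),
     (forall i, A (g i)) /\ x = \sum_i g i *~ z i].

Definition is_lattice L : Prop :=
  exists2 b : (\dim {:V}).-tuple V, basis_of fullv b & L = zspan [set` b].

Definition rational_cone L s : Prop :=
  exists (k : nat) (g : 'I_k -> V), (forall i, L (g i)) /\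
    s = [set x | exists2 a : 'I_k -> R,
                   (forall i, 0 <= a i) & x = \sum_i a i *: g i].

(* The linear span of a set: the least subspace containing it. *)
Definition lin A : {vspace V} :=
  xget 0%VS [set U : {vspace V} | A `<=` [set` U] /\
                forall W : {vspace V}, A `<=` [set` W] -> (U <= W)%VS].

Definition cone_dim s : nat := \dim (lin s).

Definition face s t : Prop :=
  exists u : 'Hom(V, R^o),
    (forall x, s x -> 0 <= u x) /\ t = s `&` [set x | u x = 0].

Definition relint s : set V :=
  [set x | s x /\ forall t, face s t -> t x -> t = s].

Definition cone_lattice L s : set V := L `&` [set` lin s].

(* [u] represents the generator u_{s/t} of L_s/L_t lying on the side of s. *)
Definition normal_vector L t s (u : V) : Prop :=
  [/\ cone_lattice L s u,
      forall x, cone_lattice L s x ->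
        exists k : int, cone_lattice L t (x - u *~ k)
    & exists x y, [/\ s x, y \in lin t & u = x + y]].

(* The index of [B] in [A]; its value is 0 if the index is infinite. *)
Definition zindex A B : nat :=
  xget 0%N [set n : nat | exists2 f : 'I_n -> V, (forall i, A (f i)) &
     forall x, A x -> exists! i, B (x - f i)].

(* The weights matter only on the cones of maximal dimension. *)
Record weighted_fan := WeightedFan {
  fan_lattice : set V;
  fan_cones : set (set V);
  fan_weight : set V -> nat
}.

Definition fan_support (X : weighted_fan) : set V :=
  [set x | exists2 s, fan_cones X s & s x].

Definition is_fan (X : weighted_fan) : Prop :=
  [/\ is_lattice (fan_lattice X),
      finite_set (fan_cones X),
      forall s, fan_cones X s -> rational_cone (fan_lattice X) s,
      forall s t, fan_cones X s -> face s t -> fan_cones X t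
    & forall s s', fan_cones X s -> fan_cones X s' ->
        face s (s `&` s') /\ face s' (s `&` s')].

Definition pure_dim (X : weighted_fan) (m : nat) : Prop :=
  (exists s, fan_cones X s) /\
  forall s, fan_cones X s -> (cone_dim s <= m)%N /\
    exists s', [/\ fan_cones X s', cone_dim s' = m & face s' s].

(* The vectors [u s] are determined up to elements of L_t, so the choice of
   representatives is immaterial in the balancing condition. *)
Definition balanced (X : weighted_fan) (m : nat) : Prop :=
  forall t, fan_cones X t -> (cone_dim t).+1 = m ->
    let above := [set s | [/\ fan_cones X s, cone_dim s = m & face s t]] in
    exists2 u : set V -> V,
      (forall s, above s -> normal_vector (fan_lattice X) t s (u s)) &
      \sum_(s \in above) u s *+ fan_weight X s \in lin t.

Definition is_tropical_fan (X : weighted_fan) (m : nat) : Prop :=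
  [/\ is_fan X, pure_dim X m,
      forall s, fan_cones X s -> cone_dim s = m -> (0 < fan_weight X s)%N
    & balanced X m].

End Fans.

Definition prod_fan (R : realType) (V W : vectType R)
    (X : weighted_fan V) (Y : weighted_fan W) : weighted_fan (V * W)%type :=
  WeightedFan
    (fan_lattice X `*` fan_lattice Y)
    [set c | exists s t, [/\ fan_cones X s, fan_cones Y t & c = s `*` t]]
    (fun c => (fan_weight X (fst @` c) * fan_weight Y (snd @` c))%N).

Definition int_vect (R : realType) (r : nat) (z : 'rV[int]_r) : 'rV[R]_r :=
  map_mx intr z.

Definition real_fan (R : realType) (r : nat) : weighted_fan 'rV[R]_r :=
  WeightedFan (range (@int_vect R r)) [set setT] (fun=> 1%N).

(* The quotient V/U is realised on a complement of U; [quot_proj_eq0] and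
   [quot_proj_surj] show that [quot_proj] is a quotient map with kernel U. *)

Section QuotientSpace.
Variables (R : realType) (V : vectType R) (U : {vspace V}).

Definition quotv := subvs_of (U^C)%VS.
HB.instance Definition _ := Vector.copy quotv (subvs_of (U^C)%VS).

(* The usual topology of a finite-dimensional real vector space. *)
Definition quotv_coord (x : quotv) : 'rV[R]_(\dim {:quotv}) :=
  \row_i coord (vbasis {:quotv}) i x.
HB.instance Definition _ :=
  Topological.copy quotv (initial_topology quotv_coord).

Definition quot_proj (x : V) : quotv := vsproj (U^C)%VS (x - projv U x).

Fact quot_proj_is_linear : linear quot_proj.
Proof.
move=> a x y; rewrite /quot_proj -linearP; congr vsproj.
by rewrite linearP scalerBr opprD addrACA.
Qed.
HB.instance Definition _ :=
  GRing.isLinear.Build R V quotv *:%R quot_proj quot_proj_is_linear.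

Lemma quot_projE x : vsval (quot_proj x : subvs_of (U^C)%VS) = x - projv U x.
Proof. by apply: vsprojK; exact: memv_projC. Qed.

Lemma quot_proj_eq0 x : (quot_proj x == 0) = (x \in U).
Proof.
apply/eqP/idP => [q0 | xU].
  have := quot_projE x; rewrite q0 => /esym/eqP; rewrite subr_eq0 => /eqP->.
  exact: memv_proj.
by apply: val_inj; apply: etrans (quot_projE x) _; rewrite projv_id // subrr.
Qed.

Lemma quot_proj_surj y : exists x, quot_proj x = y.
Proof.
exists (vsval y); apply: val_inj; apply: etrans (quot_projE _) _.
have: vsval y \in lker (projv U) by rewrite lker_proj; exact: subvsP.
by rewrite memv_ker => /eqP->; rewrite subr0.
Qed.

End QuotientSpace.

(* The underlying graph of a rational curve with N labelled ends.  Since a tree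
   has no loops or multiple edges, its bounded edges form a symmetric
   irreflexive relation.  Vertices are numbered only to make isomorphism
   classes a small type; see [curve_iso]. *)
Record marked_tree (N : nat) := MarkedTree {
  nvert : nat;
  adj : rel 'I_nvert;
  foot : 'I_N -> 'I_nvert;
  adj_sym : symmetric adj;
  adj_irr : irreflexive adj;
  adj_connected : forall u w, connect adj u w;
  adj_acyclic : forall c, ucycle adj c -> (size c <= 2)%N;
  valence_ge3 : forall u,
    (3 <= #|[pred w | adj u w]| + #|[pred i | foot i == u]|)%N
}.
Arguments foot {N} _ _.
Arguments adj {N} _ _ _.

Notation vert T := 'I_(nvert T).

Section MarkedTree.
Variables (R : realType) (N : nat).
Implicit Types (T : marked_tree N).

Definition bounded_edges T : {set {set vert T}} :=
  [set E | [exists u, [exists w, adj T u w && (E == [set u; w])]]]%SET.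

Definition nbounded T : nat := #|bounded_edges T|.

(* A vector l in R^k, k = [nbounded T], assigns the length l_e to the e-th
   bounded edge [enum_val e]. *)
Definition edge_ends T (e : 'I_(nbounded T)) : {set vert T} := enum_val e.

Definition edge_len T (l : 'rV[R]_(nbounded T)) (u w : vert T) : R :=
  \sum_(e | edge_ends e == [set u; w]%SET) l 0 e.

Definition on_path T (E : {set vert T}) (u w : vert T) : Prop :=
  exists p : seq (vert T),
    [/\ path (adj T) u p, last u p = w, uniq (u :: p)
      & E \in pairmap (fun x y => [set x; y]%SET) u p].

Definition pair_ix := {ij : 'I_N * 'I_N | (ij.1 < ij.2)%N}.
HB.instance Definition _ := Finite.on pair_ix.

Definition pair_space := {ffun pair_ix -> R^o}.

Definition dist_vec T (l : 'rV[R]_(nbounded T)) : pair_space :=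
  [ffun ij : pair_ix => \sum_(e | `[< on_path (edge_ends e)
       (foot T (val ij).1) (foot T (val ij).2) >]) l 0 e].

Definition Phi (a : 'rV[R]_N) : pair_space :=
  [ffun ij : pair_ix => a 0 (val ij).1 + a 0 (val ij).2].

Fact Phi_is_linear : linear Phi.
Proof.
move=> a x y; apply/ffunP => ij; rewrite !ffunE !mxE.
by rewrite scalerDr addrACA.
Qed.
HB.instance Definition _ :=
  GRing.isLinear.Build R 'rV[R]_N pair_space *:%R Phi Phi_is_linear.

Definition QN := quotv (limg (linfun Phi)).
HB.instance Definition _ := Vector.on QN.
HB.instance Definition _ := Topological.on QN.

Definition qN : pair_space -> QN := @quot_proj R pair_space (limg (linfun Phi)).

Record curve := Curve {
  curve_tree :> marked_tree N;
  curve_len : 'rV[R]_(nbounded curve_tree);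
  curve_len_gt0 : forall e, 0 < curve_len 0 e
}.

Definition curve_iso_by (C C' : curve) (f : vert C -> vert C') : Prop :=
  [/\ bijective f,
      forall u w, adj C' (f u) (f w) = adj C u w,
      forall i, foot C' i = f (foot C i)
    & forall u w, adj C u w ->
        edge_len (curve_len C') (f u) (f w) = edge_len (curve_len C) u w].

Definition curve_iso (C C' : curve) : Prop := exists f, @curve_iso_by C C' f.

Lemma curve_iso_by_id C : @curve_iso_by C C id.
Proof. by split=> //; exists id. Qed.

Lemma curve_iso_by_comp C1 C2 C3 f g :
  @curve_iso_by C1 C2 f -> @curve_iso_by C2 C3 g -> @curve_iso_by C1 C3 (g \o f).
Proof.
move=> [fb fa ff fl] [gb ga gf gl]; split => [||i|u w uw] /=.
- exact: bij_comp.
- by move=> u w; rewrite ga fa.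
- by rewrite gf ff.
- by rewrite gl ?fa // fl.
Qed.

Lemma curve_iso_by_inv C1 C2 f g : cancel f g -> cancel g f ->
  @curve_iso_by C1 C2 f -> @curve_iso_by C2 C1 g.
Proof.
move=> fK gK [fb fa ff fl]; split => [|u w|i|u w uw].
- by exists f.
- by rewrite -fa !gK.
- by rewrite ff fK.
- by rewrite -fl ?gK // -fa !gK.
Qed.

HB.instance Definition _ := gen_eqMixin curve.
HB.instance Definition _ := gen_choiceMixin curve.

Definition curve_isob (C C' : curve) : bool := `[< curve_iso C C' >].

Fact curve_isob_refl : reflexive curve_isob.
Proof. by move=> C; apply/asboolP; exists id; exact: curve_iso_by_id. Qed.

Fact curve_isob_sym : symmetric curve_isob.
Proof.
by move=> C C'; apply/asboolP/asboolP => -[f Hf]; have [[g fK gK] _ _ _] := Hf;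
  exists g; apply: curve_iso_by_inv Hf.
Qed.

Fact curve_isob_trans : transitive curve_isob.
Proof.
move=> C2 C1 C3 /asboolP[f Hf] /asboolP[g Hg]; apply/asboolP.
by exists (g \o f); apply: curve_iso_by_comp Hf Hg.
Qed.

Canonical curve_equiv :=
  EquivRel curve_isob curve_isob_refl curve_isob_sym curve_isob_trans.

(* The set M_{0,N,trop} of isomorphism classes. *)
Definition M0 := {eq_quot curve_equiv}%qT.
HB.instance Definition _ := Choice.on M0.
HB.instance Definition _ := EqQuotient.on M0.


Definition curve_class (C : curve) : M0 := (\pi_M0 C)%qT.

Definition phiN (x : M0) : QN := qN (dist_vec (curve_len (repr x))).

Lemma edge_sumE T (l : 'rV[R]_(nbounded T)) (Q : pred {set vert T}) :
  \sum_(e | Q (edge_ends e)) l 0 e =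
  \sum_(E in bounded_edges T | Q E) \sum_(e | edge_ends e == E) l 0 e.
Proof.
rewrite big_enum_val_cond; apply: eq_big => // e _.
by rewrite (big_pred1 e) // => e'; rewrite (inj_eq enum_val_inj).
Qed.

Lemma curve_iso_edges C C' f : @curve_iso_by C C' f ->
  bounded_edges C' = [set f @: (E : {set vert C}) | E in bounded_edges C]%SET.
Proof.
move=> [[g fK gK] fa _ _]; apply/setP => E; rewrite inE.
apply/idP/imsetP => [/existsP[u /existsP[w /andP[uw /eqP->]]] | [D + ->]].
  exists [set g u; g w]%SET; last by rewrite imsetU !imset_set1 !gK.
  by rewrite inE; apply/existsP; exists (g u); apply/existsP; exists (g w);
    rewrite -fa !gK uw eqxx.
rewrite inE => /existsP[u /existsP[w /andP[uw /eqP->]]].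
by apply/existsP; exists (f u); apply/existsP; exists (f w);
  rewrite fa uw imsetU !imset_set1 eqxx.
Qed.

Lemma curve_iso_on_path C C' f : @curve_iso_by C C' f ->
  forall E u w, on_path E u w -> on_path (f @: E)%SET (f u) (f w).
Proof.
move=> [/bij_inj f_inj fa _ _] E u w [p [up pw uq Ep]].
exists (map f p); split.
- by rewrite path_map (eq_path (e' := adj C)) // => x y /=; rewrite fa.
- by rewrite last_map pw.
- by rewrite -map_cons map_inj_uniq.
- elim: p u {up pw uq} Ep => //= x p IH u; rewrite !inE => /orP[/eqP->|/IH->].
    by rewrite imsetU !imset_set1 eqxx.
  by rewrite orbT.
Qed.

Lemma curve_iso_dist C C' : curve_iso C C' ->
  dist_vec (curve_len C') = dist_vec (curve_len C).
Proof.
move=> [f Hf]; have [fb fa ff fl] := Hf; have f_inj := bij_inj fb.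
have [g fK gK] := fb; have Hg := curve_iso_by_inv fK gK Hf.
apply/ffunP => ij; rewrite !ffunE !ff.
rewrite !(edge_sumE _ (fun E => `[< on_path E _ _ >])) (curve_iso_edges Hf).
rewrite big_imset_cond /=; last by move=> ? ? _ _; exact: imset_inj.
apply: eq_big => [E|E /andP[]].
  congr (_ && _); apply/asboolP/asboolP; last exact: curve_iso_on_path.
  move/(curve_iso_on_path Hg); rewrite !fK -imset_comp.
  by rewrite (eq_imset (g := id)) ?imset_id.
rewrite inE => /existsP[u /existsP[w /andP[uw /eqP->]]] _.
by rewrite imsetU !imset_set1 -/(edge_len _ _ _) fl.
Qed.

Lemma phiN_class C : phiN (curve_class C) = qN (dist_vec (curve_len C)).
Proof.
rewrite /phiN; congr qN; apply/esym/curve_iso_dist/asboolP.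
by move/eqmodP: (reprK (curve_class C)) => /=.
Qed.

(* The tree with one bounded edge, of length 1, separating the ends in I from
   the others. *)
Section SplitCurve.
Variables (I : {set 'I_N}) (hI : (1 < #|I| < N.-1)%N).

Let sadj : rel 'I_2 := fun u w => u != w.
Let sfoot (i : 'I_N) : 'I_2 := if i \in I then ord0 else ord_max.

Fact split_sym : symmetric sadj.
Proof. by move=> u w; rewrite /sadj eq_sym. Qed.

Fact split_irr : irreflexive sadj.
Proof. by move=> u; rewrite /sadj eqxx. Qed.

Fact split_connected u w : connect sadj u w.
Proof. by have [->|uw] := eqVneq u w; [exact: connect0 | exact: connect1]. Qed.

Fact split_acyclic c : ucycle sadj c -> (size c <= 2)%N.
Proof. by case/andP=> _ /card_uniqP <-; rewrite -[leqRHS]card_ord max_card. Qed.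

Fact split_valence u :
  (3 <= #|[pred w | sadj u w]| + #|[pred i | sfoot i == u]|)%N.
Proof.
have -> : #|[pred w | sadj u w]| = 1%N.
  have -> : #|[pred w | sadj u w]| = #|predC1 u|.
    by apply: eq_card => w; rewrite !inE eq_sym.
  by rewrite cardC1 card_ord.
rewrite ltnS; case/andP: hI => I1 I2.
have cI : (#|I| + #|~: I| = N)%N by rewrite cardsC card_ord.
have [->|/eqP u0] := eqVneq u ord0.
  rewrite (leq_trans I1) // subset_leq_card //; apply/fintype.subsetP => i iI.
  by rewrite inE /sfoot iI.
have -> : u = ord_max.
  by apply: val_inj; case: u u0 => -[|[|]] //= u2 /eqP; rewrite -val_eqE.
have I3 : (1 < #|~: I|)%N.
  by rewrite -(ltn_add2l #|I|) cI addn1 -ltn_predRL.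
rewrite (leq_trans I3) // subset_leq_card //; apply/fintype.subsetP => i.
by rewrite inE => /negPf iI; rewrite inE /sfoot iI.
Qed.

Definition split_tree : marked_tree N :=
  MarkedTree split_sym split_irr split_connected split_acyclic split_valence.

Fact split_len_gt0 e : 0 < (const_mx 1 : 'rV[R]_(nbounded split_tree)) 0 e.
Proof. by rewrite mxE. Qed.

Definition split_curve : curve := Curve split_len_gt0.

Definition vI : QN := phiN (curve_class split_curve).

End SplitCurve.

Definition LambdaN : set QN := zspan [set v | exists I hI, v = @vI I hI].

(* The cone of a combinatorial type: its relative interior consists of the
   curves of this type, its faces are obtained by letting lengths tend to 0. *)
Definition type_cone (T : marked_tree N) : set QN :=
  [set qN (dist_vec l) | l in [set l : 'rV[R]_(nbounded T) | forall e, 0 <= l 0 e]].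

(* The v_I lying in a cone of the fan are those spanning it. *)
Definition M0_weight (s : set QN) : nat :=
  zindex (cone_lattice LambdaN s)
         (zspan [set v | s v /\ exists I hI, v = @vI I hI]).

Definition M0_fan : weighted_fan QN :=
  WeightedFan LambdaN (range type_cone) M0_weight.

End MarkedTree.

Section Labelled.
Variables (R : realType) (r n d : nat) (Delta : d.-tuple 'rV[int]_r).
Local Notation N := (n + d)%N.

(* v(x_i): the ends are numbered from 0, the first n of them are contracted. *)
Definition end_dir (i : 'I_N) : 'rV[int]_r :=
  if fintype.split i is inr k then tnth Delta k else 0.

(* A combinatorial type: [lt_dir u w] is the vector v(E,u) of the bounded edge
   E = {u,w} starting at u; it is irrelevant if u and w are not adjacent. *)
Record lab_type := LabType {
  lt_tree :> marked_tree N;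
  lt_dir : vert lt_tree -> vert lt_tree -> 'rV[int]_r;
  lt_dir_opp : forall u w, adj lt_tree u w -> lt_dir w u = - lt_dir u w;
  lt_balanced : forall u,
    \sum_(w | adj lt_tree u w) lt_dir u w
      + \sum_(i | foot lt_tree i == u) end_dir i = 0
}.
Arguments lt_dir : clear implicits.

(* The map h is affine on each edge, hence it is recorded by its values on the
   vertices together with the directions. *)
Record lab_curve := LabCurve {
  lc_type :> lab_type;
  lc_len : 'rV[R]_(nbounded lc_type);
  lc_len_gt0 : forall e, 0 < lc_len 0 e;
  lc_pos : vert lc_type -> 'rV[R]_r;
  lc_pos_edge : forall u w, adj lc_type u w ->
    lc_pos w =
      lc_pos u + edge_len lc_len u w *: int_vect R (lt_dir lc_type u w)
}.
Arguments lc_pos : clear implicits.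

Definition forget_map (C : lab_curve) : curve R N := Curve (@lc_len_gt0 C).

(* Compatibility with h need only be required on the vertices: it follows on
   bounded edges by isometry, and on the i-th ends since v(x_i) is fixed. *)
Definition lab_iso_by (C C' : lab_curve) (f : vert C -> vert C') : Prop :=
  @curve_iso_by R N (forget_map C) (forget_map C') f /\
  forall u, lc_pos C' (f u) = lc_pos C u.

Definition lab_isob (C C' : lab_curve) : bool :=
  `[< exists f, @lab_iso_by C C' f >].

Fact lab_isob_refl : reflexive lab_isob.
Proof.
by move=> C; apply/asboolP; exists id; split=> //; exact: curve_iso_by_id.
Qed.

Fact lab_isob_sym : symmetric lab_isob.
Proof.
have sym C C' : lab_isob C C' -> lab_isob C' C.
  move=> /asboolP[f [Hf fp]]; have [[g fK gK] _ _ _] := Hf.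
  apply/asboolP; exists g; split=> [|u]; last by rewrite -fp gK.
  exact: curve_iso_by_inv Hf.
by move=> C C'; apply/idP/idP; exact: sym.
Qed.

Fact lab_isob_trans : transitive lab_isob.
Proof.
move=> C2 C1 C3 /asboolP[f [Hf fp]] /asboolP[g [Hg gp]]; apply/asboolP.
exists (g \o f); split=> [|u] /=; last by rewrite gp fp.
exact: (curve_iso_by_comp Hf Hg).
Qed.

HB.instance Definition _ := gen_eqMixin lab_curve.
HB.instance Definition _ := gen_choiceMixin lab_curve.

Canonical lab_equiv :=
  EquivRel lab_isob lab_isob_refl lab_isob_sym lab_isob_trans.

(* The set M^lab_{0,n,trop}(R^r, Delta) of isomorphism classes. *)
Definition Mlab := {eq_quot lab_equiv}%qT.
HB.instance Definition _ := Choice.on Mlab.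
HB.instance Definition _ := EqQuotient.on Mlab.

Definition lab_class (C : lab_curve) : Mlab := (\pi_Mlab C)%qT.

Lemma lab_classP C C' :
  lab_class C = lab_class C' <-> exists f, @lab_iso_by C C' f.
Proof. by split=> [/eqmodP/asboolP|iso]; [|apply/eqmodP/asboolP]. Qed.

Definition psi (x : Mlab) : M0 R N := curve_class (forget_map (repr x)).

Definition ev (i : 'I_n) (x : Mlab) : 'rV[R]_r :=
  lc_pos (repr x) (foot (repr x) (lshift d i)).

Lemma psi_class C : psi (lab_class C) = curve_class (forget_map C).
Proof.
have /lab_classP[f [Hf _]] := reprK (lab_class C).
by apply/eqmodP/asboolP; exists f.
Qed.

Lemma ev_class i C : ev i (lab_class C) = lc_pos C (foot C (lshift d i)).
Proof.
have /lab_classP[f [[_ _ ff _] fp]] := reprK (lab_class C).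
by rewrite /ev -fp; congr lc_pos; exact: esym (ff _).
Qed.

(* The closed cell of a combinatorial type with k bounded edges and root vertex
   W consists of the pairs (l, p) in R^k * R^r with l >= 0: edge lengths and the
   position of W.  The curve parametrised by (l, p) is obtained by contracting
   the edges of length 0. *)
Section Cell.
Variables (T : lab_type) (W : vert T).

Definition cell_space := ('rV[R]_(nbounded T) * 'rV[R]_r)%type.

Definition closed_cell_dom : set cell_space := [set y : cell_space | forall e, 0 <= y.1 0 e].
Definition open_cell_dom : set cell_space := [set y : cell_space | forall e, 0 < y.1 0 e].

Definition contracts_to (y : cell_space) (C : lab_curve) : Prop :=
  exists f : vert T -> vert C,
  [/\ (forall a, exists u, f u = a) /\
      (forall u w, (f u == f w) =
         connect [rel a b | adj T a b && (edge_len y.1 a b == 0)] u w),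
      forall u w, adj T u w -> edge_len y.1 u w != 0 ->
        [/\ adj C (f u) (f w),
            edge_len (lc_len C) (f u) (f w) = edge_len y.1 u w
          & lt_dir C (f u) (f w) = lt_dir T u w],
      forall a b, adj C a b -> exists u w, [/\ f u = a, f w = b & adj T u w],
      forall i, foot C i = f (foot T i)
    & lc_pos C (f W) = y.2].

Definition cell_image (D : set cell_space) : set Mlab :=
  [set x | exists y C, [/\ D y, contracts_to y C & x = lab_class C]].

Definition closed_cell : set Mlab := cell_image closed_cell_dom.
Definition open_cell : set Mlab := cell_image open_cell_dom.

End Cell.

(* The topology glued from the closed cells: a set is open iff its inverse image
   in each closed cell is relatively open. *)
Definition lab_open (U : set Mlab) : Prop :=
  forall (T : lab_type) (W : vert T),
  exists2 O : set ('rV[R]_(nbounded T) * 'rV[R]_r)%type, open O &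
    forall y C, closed_cell_dom y -> contracts_to W y C ->
      (O y <-> U (lab_class C)).

Fact lab_openT : lab_open setT.
Proof. by move=> T W; exists setT => //; exact: openT. Qed.

Fact lab_openI : setI_closed lab_open.
Proof.
move=> A B oA oB T W; have [G oG AG] := oA T W; have [H oH BH] := oB T W.
exists (G `&` H); first exact: openI.
by move=> y C y0 yC; split=> -[/(AG _ _ y0 yC) ? /(BH _ _ y0 yC) ?].
Qed.

Fact lab_open_bigU (I : Type) (F : I -> set Mlab) :
  (forall i, lab_open (F i)) -> lab_open (\bigcup_i F i).
Proof.
move=> oF T W; pose valid i (G : set ('rV[R]_(nbounded T) * 'rV[R]_r)%type) :=
  open G /\ forall y C, closed_cell_dom y -> contracts_to W y C ->
    (G y <-> F i (lab_class C)).
have exG i : exists G, valid i G by have [G oG FG] := oF i T W; exists G.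
have [G HG] := choice exG.
exists (\bigcup_i G i); first by apply: bigcup_open => i _; case: (HG i).
move=> y C y0 yC; split=> -[i _ Hi]; exists i => //;
  by have [_ /(_ _ _ y0 yC)[? ?]] := HG i; auto.
Qed.

HB.instance Definition _ :=
  isOpenTopological.Build Mlab lab_openT lab_openI lab_open_bigU.

Lemma Mlab_openE (U : set Mlab) : open U = lab_open U.
Proof. by []. Qed.

End Labelled.

Definition embedding (S T : topologicalType) (f : S -> T) : Prop :=
  injective f /\ forall U, open U <-> exists2 O, open O & U = f @^-1` O.

(* Main.v *)
Require Import Defs.
From HB Require Import structures.
From mathcomp Require Import all_boot all_order all_algebra.
From mathcomp Require Import all_classical all_reals all_analysis.
From mathcomp Require Import zify.
Set Implicit Arguments.
Unset Strict Implicit.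
Unset Printing Implicit Defensive.
Import Order.TTheory GRing.Theory Num.Theory.
Import numFieldNormedType.Exports.
Local Open Scope classical_set_scope.
Local Open Scope ring_scope.

(** A map from a rational curve to R^r with prescribed directions of the ends
    carries no more information than the abstract curve and the image of one
    point: summing the balancing condition over the vertices on one side of a
    bounded edge shows that the direction of the edge is the sum of the
    directions of the ends on the side it points to ([lab_dir]), and integrating
    along paths from the foot of x_1 gives the positions of all vertices
    ([lc_posE]).  Conversely, directions and positions defined in this way
    balance because the directions of all ends sum to zero ([lab_tree],
    [tree_curve]).  On the cell of a combinatorial type the coordinates are
    therefore an injective linear function of the lengths and the position of
    the root vertex ([coords_contracts], [cell_lin_ker]), and the statement is
    reduced to the structure of the space of trees.

    Root all trees at the end o = x_1.  A bounded edge is a bridge ([far_edge])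
    and is recorded by the set of ends that it separates from o; these clusters
    are pairwise nested or disjoint, and distinct edges have distinct clusters,
    since every vertex is the meeting point of o and two further ends
    ([vertex_median], [clusters_laminar]).  Every such laminar family comes from
    the tree formed by its inclusions ([laminar_tree]), and contracting the
    edges of a tree outside a chosen set gives the tree of the chosen clusters
    ([squash_contraction]).  This one construction provides the limits of
    curves when lengths tend to zero, and, when nothing is contracted, a normal
    form of every curve ([family_classP]).

    The distance vector of a tree is the sum of the cut vectors of its clusters
    weighted by the lengths ([dist_vecE]).  The Gromov product of i and j at o
    is the length common to the paths from o to i and to j, and the image of
    Phi changes all Gromov products by the same constant, so their differences
    are coordinates on Q_N ([cross_qN], [cross_eq0]).  In these coordinates a
    tree is an ultrametric up to a constant.  Its balls are the clusters, which
    proves injectivity ([depth_ball], [cut_class_determines]); the length of an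
    edge is a difference of two Gromov products, which gives dual functionals
    that are integral on Lambda_N, so the generators of each cone generate all
    of its lattice points and all weights are 1 ([cluster_dual],
    [M0_weight_cluster]); and the two-element clusters with one of them omitted
    form a basis of Lambda_N ([QN_dual_basis]).

    The cones of the fan correspond to laminar families, faces to subfamilies,
    intersections to intersections ([laminar_cone_face], [laminar_coneI]).
    Counting the children of the nodes of the tree of a family shows that
    maximal families have N - 3 members and that in a family with N - 4 members
    exactly one node has three children B1, B2, B3 instead of two.  The three
    larger families arise by adding the union of two of these children
    ([laminar_codim1]), and the sum of the three new generators lies in the
    span of the old ones ([cut_class_merge]); this is the balancing condition.

    For the topology, each of the finitely many closed cells is mapped by an
    injective linear map, which is continuous and closed ([Hom_continuous],
    [Hom_closed_map]), so a set is open in the glued topology exactly when it is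
    the preimage of an open set. *)

(** * Laminar families of sets *)

Section Laminar.
Import mathcomp.boot.fintype mathcomp.boot.finset.
Local Open Scope nat_scope.
Local Open Scope set_scope.

Variables (X : finType) (o : X).
Implicit Types (A B C D : {set X}) (F : {set {set X}}) (P : pred {set X}).

Definition nonroot : {set X} := [set~ o].

Definition compatible A B : bool :=
  [|| A \subset B, B \subset A | A :&: B == set0].

Definition laminar F : bool :=
  [forall A in F, (A \proper nonroot) && (1 < #|A|)] &&
  [forall A in F, forall B in F, compatible A B].

(** The smallest member satisfying [P] when these members have a common point,
    and the root if there are none. *)
Definition least F P : {set X} := nonroot :&: \bigcap_(A in F | P A) A.

Lemma laminarP F :
  reflect [/\ {in F, forall A, A \proper nonroot}, {in F, forall A, 1 < #|A|}
    & {in F &, forall A B, compatible A B}] (laminar F).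
Proof.
apply: (iffP andP) => [[/forall_inP F1 /forall_inP F2]|[F1 F2 F3]].
  split=> [A /F1/andP[]|A /F1/andP[]|A B AF BF] //.
  by move/forall_inP: (F2 A AF); apply.
split; apply/forall_inP => A AF; first by rewrite F1 ?F2.
by apply/forall_inP => B BF; apply: F3.
Qed.

Lemma laminarS F F' : F \subset F' -> laminar F' -> laminar F.
Proof.
move=> /subsetP sF /laminarP[F1 F2 F3]; apply/laminarP.
by split=> [A /sF/F1|A /sF/F2|A B /sF AF /sF BF] //; apply: F3.
Qed.

Lemma compatibleC A B : compatible A B = compatible B A.
Proof. by rewrite /compatible setIC orbCA. Qed.

Lemma compatible_meet A B x :
  compatible A B -> x \in A -> x \in B -> (A \subset B) || (B \subset A).
Proof.
move=> /or3P[->|->|/eqP AB0 xA xB]; rewrite ?orbT //.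
by have := in_set0 x; rewrite -AB0 inE xA xB.
Qed.

Lemma least_sub F P A : A \in F -> P A -> least F P \subset A.
Proof.
move=> AF PA; apply/subsetP => x /setIP[_ /bigcapP]; apply.
by rewrite AF PA.
Qed.

Lemma least_nonroot F P : least F P \subset nonroot.
Proof. exact: subsetIl. Qed.

Lemma least_mem F P x : x \in nonroot -> {in F, forall A, P A -> x \in A} ->
  x \in least F P.
Proof. by move=> xo Px; rewrite inE xo; apply/bigcapP => A /andP[/Px]. Qed.

Lemma eq_least F P P' : {in F, P =1 P'} -> least F P = least F P'.
Proof.
move=> eqP; congr (_ :&: _); apply: eq_bigl => A.
by apply/andP/andP => -[AF]; rewrite ?eqP // -?eqP.
Qed.

(** Members sharing a point form a chain, so their intersection is the
    smallest of them. *)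
Lemma leastP F P x : laminar F -> {in F, forall A, P A -> x \in A} ->
  (least F P = nonroot /\ {in F, forall A, ~~ P A}) \/
  (least F P \in F /\ P (least F P)).
Proof.
move=> /laminarP[F1 F2 F3] Px.
have [/existsP[A0 PA0]|/existsPn noP] := boolP [exists A, (A \in F) && P A].
  right; have [A /andP[AF PA] minA] :=
    @arg_minnP _ A0 (fun A => (A \in F) && P A) (fun A => #|A|) PA0.
  suff -> : least F P = A by [].
  apply/eqP; rewrite eqEsubset least_sub //= subsetI proper_sub ?F1 //=.
  apply/bigcapsP => B PB; have /andP[BF PBB] := PB.
  have /orP[//|BA] := compatible_meet (F3 _ _ AF BF) (Px _ AF PA) (Px _ BF PBB).
  have: B == A by rewrite eqEcard BA minA.
  by move/eqP->.
left; split; last by move=> A AF; have := noP A; rewrite AF.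
rewrite /least big_pred0 ?setIT // => A.
by apply/negP => PA; have := noP A; rewrite PA.
Qed.

Lemma least_in F P x : laminar F -> {in F, forall A, P A -> x \in A} ->
  least F P \in nonroot |: F.
Proof. by move=> lF /(leastP lF)[[-> _]|[]]; rewrite !inE ?eqxx // => ->; rewrite orbT. Qed.

(** A point of [A] and a point outside the largest proper member through the
    first one have [A] as their smallest common cluster. *)
Lemma split_pair F A : laminar F -> A \in nonroot |: F -> 1 < #|nonroot| ->
  exists i j, [/\ i \in A, j \in A, i != j
    & {in F, forall B, i \in B -> j \in B -> A \subset B}].
Proof.
move=> /laminarP[F1 F2 F3] AF ho.
have A1 : 1 < #|A| by case/setU1P: AF => [->|/F2].
have compA B : B \in F -> compatible A B.
  move=> BF; case/setU1P: AF => [->|AF]; last exact: F3.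
  by rewrite /compatible (proper_sub (F1 B BF)) orbT.
have [i iA] : exists i, i \in A by apply/set0Pn; rewrite -card_gt0 ltnW.
pose Q := [pred B : {set X} | [&& B \in F, i \in B & B \proper A]].
have [/existsP[B0 QB0]|/existsPn noQ] := boolP [exists B, Q B].
  have [B /and3P[BF iB /properP[BA [j jA jB]]] maxB] :=
    @arg_maxnP _ B0 Q (fun A => #|A|) QB0.
  exists i, j; split=> // [|C CF iC jC].
    by apply: contraNneq jB => <-.
  have /orP[//|CA] := compatible_meet (compA _ CF) iA iC.
  have [->//|CneA] := eqVneq C A.
  have QC : Q C by rewrite /= CF iC properEneq CneA.
  have /orP[/subsetP CB|BC] := compatible_meet (F3 _ _ CF BF) iC iB.
    by rewrite CB in jB.
  have /eqP BC' : B == C by rewrite eqEcard BC; exact: maxB.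
  by rewrite -BC' (negPf jB) in jC.
have /card_gt0P[j] : 0 < #|A :\ i|.
  by move: A1; rewrite (cardsD1 i) iA.
rewrite !inE => /andP[ji jA]; exists i, j; split=> //; first by rewrite eq_sym.
move=> C CF iC jC; have /orP[//|CA] := compatible_meet (compA _ CF) iA iC.
have [->//|CneA] := eqVneq C A.
by have /negP[] := noQ C; rewrite /= CF iC properEneq CneA.
Qed.

(** The generator attached to [A] is separated from the others by comparing
    two points whose smallest common cluster is [A] with two points whose
    smallest common cluster is the next one above [A]. *)
Lemma dual_pairs F A : laminar F -> A \in F -> exists i j k,
  [/\ i \in nonroot, j \in nonroot, k \in nonroot, (i != j) && (i != k)
    & {in F, forall B,
        ((i \in B) && (j \in B) = ((i \in B) && (k \in B)) + (B == A) :> nat)}].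
Proof.
move=> lF AF; have [F1 F2 F3] := laminarP _ lF.
have ho : 1 < #|nonroot| by rewrite (ltn_trans (F2 A AF)) // proper_card // F1.
have Ao := subsetP (proper_sub (F1 A AF)).
have [i [j [iA jA ij ijB]]] := split_pair lF (setU1r _ AF) ho.
pose P := least F (fun B => A \proper B).
have /properP[AP [k kP kA]] : A \proper P.
  have PiA : {in F, forall B, A \proper B -> i \in B}.
    by move=> B _ /proper_sub/subsetP/(_ _ iA).
  rewrite /P; have [[-> _]|[]//] := leastP lF PiA.
  exact: F1.
have ko : k \in nonroot by apply: (subsetP (least_nonroot _ _)) kP.
exists i, j, k; split=> //; try exact: Ao.
  by rewrite ij; apply: contraNneq kA => <-.
move=> B BF; have [->|BA] := eqVneq B A; first by rewrite iA jA (negPf kA).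
rewrite addn0; apply: (congr1 nat_of_bool); apply/andP/andP => -[iB].
  move=> jB; split=> //; have AB : A \proper B.
    by rewrite properEneq eq_sym BA ijB.
  exact: subsetP (least_sub BF AB) _ kP.
move=> kB; split=> //.
have /orP[/subsetP->//|/subsetP/(_ k kB)] := compatible_meet (F3 _ _ AF BF) iA iB.
by rewrite (negPf kA).
Qed.


Section Depth.
Variable R : realDomainType.
Implicit Types w : {set X} -> R.

(** The height above the root of the branch point of [i] and [j] in the tree
    of [F] with edge lengths [w]. *)
Definition depth F w i j : R := (\sum_(B in F | (i \in B) && (j \in B)) w B)%R.

(** Moving to a point outside the smallest cluster containing [i] and [j] loses
    the positive weight of that cluster; moving inside it loses nothing. *)
Lemma depth_ball F w i j k : laminar F -> {in F, forall B, (0 < w B)%R} ->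
  i \in nonroot -> j \in nonroot -> k \in nonroot ->
  (k \in least F (fun B => (i \in B) && (j \in B))) =
  (depth F w i j <= depth F w i k)%R.
Proof.
move=> lF w0 io jo ko; set L := least _ _; have [F1 F2 F3] := laminarP _ lF.
have iL : i \in L by apply: least_mem => // B _ /andP[].
have jL : j \in L by apply: least_mem => // B _ /andP[].
have [kL|kL] := boolP (k \in L); apply/esym.
  rewrite /depth [leRHS]big_mkcondr [leLHS]big_mkcondr /=.
  apply: ler_sum => B BF; have [/andP[iB jB]|_] := ifPn.
    rewrite iB; have -> : k \in B; last by [].
    by apply: subsetP kL; apply: least_sub; rewrite ?iB.
  by case: ifP => // _; apply/ltW/w0.
have LF : L \in F.
  have /setU1P[LE|//] := @least_in F (fun B => (i \in B) && (j \in B)) i lF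
    (fun B _ iB => proj1 (andP iB)).
  by rewrite -/L in LE; rewrite LE ko in kL.
apply/negbTE; rewrite -ltNge /depth [ltRHS](bigD1 L) /= ?LF ?iL ?jL //.
rewrite -[ltLHS]add0r ltr_leD ?w0 // big_mkcondr [leRHS]big_mkcond [leLHS]big_mkcond /=.
apply: ler_sum => B _.
have [BF|_] := boolP (B \in F) => //=.
have [/andP[iB kB]|_] := boolP (_ && _); last first.
  by case: ifP => // _; apply/ltW/w0.
have BL : B != L by apply: contraNneq kL => <-.
rewrite iB BL andbT /=; have -> // : j \in B.
have /orP[/subsetP->//|/subsetP/(_ k kB)] := compatible_meet (F3 _ _ LF BF) iL iB.
by rewrite (negPf kL).
Qed.

(** The members are balls of the ultrametric defined by the family, and balls
    are unaffected by a constant added to all depths. *)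
Lemma depth_determines_members F F' w w' : laminar F -> laminar F' ->
  {in F, forall B, (0 < w B)%R} -> {in F', forall B, (0 < w' B)%R} ->
  (forall i j k, i \in nonroot -> j \in nonroot -> k \in nonroot ->
     i != j -> i != k ->
     (depth F w i j - depth F w i k = depth F' w' i j - depth F' w' i k)%R) ->
  F \subset F'.
Proof.
move=> lF lF' w0 w0' eqd; apply/subsetP => A AF.
have [F1 F2 F3] := laminarP _ lF; have Ao := subsetP (proper_sub (F1 A AF)).
have ho : 1 < #|nonroot| by rewrite (ltn_trans (F2 A AF)) // proper_card // F1.
have [i [j [iA jA ij ijB]]] := split_pair lF (setU1r _ AF) ho.
have [io jo] := (Ao _ iA, Ao _ jA).
pose Q := fun B : {set X} => (i \in B) && (j \in B).
have LA : least F Q = A.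
  apply/eqP; rewrite eqEsubset least_sub /Q ?iA ?jA //=.
  by rewrite subsetI (proper_sub (F1 A AF)); apply/bigcapsP => B /and3P[]; exact: ijB.
have L'A : least F' Q = A.
  rewrite -LA; apply/setP => k.
  have [ko|ko] := boolP (k \in nonroot); last first.
    by rewrite !inE; move: ko; rewrite !inE => /negPf->.
  have [<-|ik] := eqVneq i k.
    by rewrite !least_mem // => B _ /andP[].
  rewrite (depth_ball lF' w0') // (depth_ball lF w0) //.
  by rewrite -subr_ge0 -[RHS]subr_ge0 -opprB -[in RHS]opprB eqd.
have /setU1P[AE|//] := @least_in F' Q i lF' (fun B _ iB => proj1 (andP iB)).
  by rewrite -/Q L'A in AE; have := F1 A AF; rewrite AE properxx.
by rewrite L'A.
Qed.

Lemma depth_diff F w i j k B0 :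
  {in F, forall B, ((i \in B) && (j \in B) = ((i \in B) && (k \in B)) + (B == B0) :> nat)} ->
  B0 \in F -> (depth F w i j - depth F w i k = w B0)%R.
Proof.
move=> dB B0F; rewrite /depth big_mkcondr [X in (_ - X)%R]big_mkcondr /= -sumrB.
rewrite (bigD1 B0) //= big1 ?addr0 => [|B /andP[BF BB]].
  have := dB B0 B0F; rewrite eqxx.
  by do 2 case: (_ && _) => //; rewrite subr0.
by have := dB B BF; rewrite (negPf BB) addn0; do 2 case: (_ && _) => //; rewrite subrr.
Qed.

Lemma depth_determines F F' w w' : laminar F -> laminar F' ->
  {in F, forall B, (0 < w B)%R} -> {in F', forall B, (0 < w' B)%R} ->
  (forall i j k, i \in nonroot -> j \in nonroot -> k \in nonroot ->
     i != j -> i != k ->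
     (depth F w i j - depth F w i k = depth F' w' i j - depth F' w' i k)%R) ->
  F = F' /\ {in F, w =1 w'}.
Proof.
move=> lF lF' w0 w0' eqd; have FF' : F = F'.
  apply/eqP; rewrite eqEsubset (depth_determines_members lF lF' w0 w0' eqd).
  by apply: (depth_determines_members lF' lF w0' w0) => i j k *; rewrite eqd.
split=> // A AF; have [i [j [k [io jo ko /andP[ij ik] dB]]]] := dual_pairs lF AF.
rewrite -(depth_diff w dB AF) eqd //.
by apply: depth_diff; rewrite -FF'.
Qed.

End Depth.

(** Singletons are included as leaves, so that every internal node has at least
    two children. *)
Definition nodes F : {set {set X}} := F :|: [set [set i] | i in nonroot].

Definition parent F B : {set X} := least F (fun A => B \proper A).

Definition children F A : {set {set X}} := [set B in nodes F | parent F B == A].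

Lemma nodes_gt1 F B : B \in nodes F -> 1 < #|B| -> B \in F.
Proof. by move=> /setUP[//|/imsetP[i _ ->]]; rewrite cards1. Qed.

Lemma singleton_node F i : i \in nonroot -> [set i] \in nodes F.
Proof. by move=> io; rewrite inE imset_f // orbT. Qed.

Section Counting.
Variable F : {set {set X}}.
Hypotheses (lF : laminar F) (hX : 2 < #|X|).

Let F1 : {in F, forall A, A \proper nonroot}.
Proof. by case/laminarP: lF. Qed.
Let F2 : {in F, forall A, 1 < #|A|}.
Proof. by case/laminarP: lF. Qed.
Let F3 : {in F &, forall A B, compatible A B}.
Proof. by case/laminarP: lF. Qed.

Lemma card_nonroot : #|nonroot| = #|X|.-1.
Proof. by rewrite cardsC1. Qed.

Let ho : 1 < #|nonroot|.
Proof. by rewrite card_nonroot; case: #|X| hX => [|[|[]]]. Qed.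

Lemma node_proper B : B \in nodes F -> B \proper nonroot.
Proof.
case/setUP => [/F1//|/imsetP[i io ->]].
by rewrite properEcard sub1set io cards1.
Qed.

Lemma node_neq0 B : B \in nodes F -> exists x, x \in B.
Proof.
case/setUP => [/F2/ltnW/card_gt0P//|/imsetP[i io ->]].
by exists i; rewrite set11.
Qed.

Lemma compatible_set1 i B : compatible [set i] B.
Proof.
rewrite /compatible sub1set; case: (boolP (i \in B)) => //= iB.
apply/orP; right; apply/eqP/setP => x; rewrite !inE.
by case: eqP => // ->; rewrite (negPf iB).
Qed.

Lemma node_compatible : {in nodes F &, forall A B, compatible A B}.
Proof.
move=> A B /setUP[AF|/imsetP[i _ ->] _]; last exact: compatible_set1.
move=> /setUP[BF|/imsetP[i _ ->]]; first exact: F3.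
by rewrite compatibleC compatible_set1.
Qed.

Lemma compatible_root A B : A \in nonroot |: F -> B \in nodes F -> compatible A B.
Proof.
case/setU1P => [->|AF] BF; last by apply: node_compatible => //; rewrite inE AF.
by rewrite /compatible (proper_sub (node_proper BF)) orbT.
Qed.

Lemma parentP B x : B \proper nonroot -> x \in B ->
  parent F B \in nonroot |: F /\ B \proper parent F B.
Proof.
move=> Bo xB.
have xP : {in F, forall A, B \proper A -> x \in A}.
  by move=> A _ /proper_sub/subsetP/(_ x xB).
split; first exact: least_in xP.
by rewrite /parent; have [[-> _]|[]] := leastP lF xP.
Qed.

Lemma parent_sub A B : A \in nonroot |: F -> B \proper A -> parent F B \subset A.
Proof.
by case/setU1P => [-> _|AF BA]; [exact: least_nonroot | exact: least_sub].
Qed.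

Lemma children_cover A x : A \in nonroot |: F -> x \in A ->
  exists2 B, B \in children F A & x \in B.
Proof.
move=> AF xA.
have A1 : 1 < #|A| by case/setU1P: AF => [->|/F2].
have xo : x \in nonroot.
  by case/setU1P: AF xA => [->|/F1/proper_sub/subsetP] //; apply.
pose Q := [pred B : {set X} | [&& B \in nodes F, x \in B & B \proper A]].
have Q0 : Q [set x] by rewrite /= singleton_node // set11 properEcard sub1set xA cards1.
have [B /and3P[BF xB BA] maxB] := @arg_maxnP _ _ Q (fun A => #|A|) Q0.
exists B => //; rewrite inE BF /=; apply/eqP.
have [PF BP] := parentP (node_proper BF) xB.
apply/eqP; rewrite eqEsubset parent_sub //=.
apply/negPn/negP => nAP.
have PA : parent F B \proper A by rewrite properE parent_sub.
have PF' : parent F B \in F.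
  case/setU1P: PF => // PE; rewrite PE in PA.
  have := proper_sub_trans PA (subxx _).
  case/setU1P: AF => [->|/F1 Ao]; first by rewrite properxx.
  by have := proper_trans PA Ao; rewrite properxx.
have /(maxB _) : Q (parent F B).
  by rewrite /= PA inE PF' (subsetP (proper_sub BP)).
by rewrite /= leqNgt proper_card.
Qed.

Lemma childP A B : B \in children F A ->
  [/\ B \in nodes F, B \proper A & forall C, C \in nonroot |: F -> B \proper C -> A \subset C].
Proof.
rewrite inE => /andP[BF /eqP <-]; have [x xB] := node_neq0 BF.
have [_ BP] := parentP (node_proper BF) xB.
by split=> // C; exact: parent_sub.
Qed.

Lemma children_disjoint A B B' x : B \in children F A -> B' \in children F A ->
  x \in B -> x \in B' -> B = B'.
Proof.
wlog BB' : B B' / B \subset B'.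
  move=> W cB cB' xB xB'; have [BF _ _] := childP cB; have [BF' _ _] := childP cB'.
  have /orP[s|s] := compatible_meet (node_compatible BF BF') xB xB'.
    exact: W.
  by apply/esym/W.
move=> cB cB' xB xB'; have [BF BA minB] := childP cB; have [BF' BA' _] := childP cB'.
apply/eqP; apply: contraLR BA' => neB.
have pB : B \proper B' by rewrite properEneq neB.
have B'F : B' \in F.
  apply: nodes_gt1 => //; apply: leq_ltn_trans (proper_card pB).
  by apply/card_gt0P; exists x.
by rewrite properE negb_and minB ?orbT // inE B'F orbT.
Qed.

Lemma children_gt1 A : A \in nonroot |: F -> 1 < #|children F A|.
Proof.
move=> AF.
have [x xA] : exists x, x \in A.
  by case/setU1P: AF => [->|/F2/ltnW/card_gt0P//]; apply/card_gt0P; rewrite ltnW.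
have [B cB xB] := children_cover AF xA; have [_ /properP[_ [y yA yB]] _] := childP cB.
have [B' cB' yB'] := children_cover AF yA.
have BB' : B != B' by apply: contraNneq yB => ->.
have -> : 1 < #|children F A| = (#|[set B; B']| <= #|children F A|) by rewrite cards2 BB'.
by apply/subset_leq_card/subsetP => C /set2P[] ->.
Qed.

Lemma nonroot_notin : nonroot \notin F.
Proof. by apply/negP => /F1; rewrite properxx. Qed.

(** Every node other than the root is a child of exactly one internal node. *)
Lemma sum_children :
  \sum_(A in nonroot |: F) #|children F A| = #|F| + #|X|.-1.
Proof.
have -> : #|F| + #|X|.-1 = #|nodes F|.
  rewrite /nodes cardsU -card_nonroot card_imset; last exact: set1_inj.
  have -> : F :&: [set [set i] | i in nonroot] = set0.
    apply/setP => A; rewrite !inE; apply/negP => /andP[/F2 A1 /imsetP[i _ AE]].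
    by move: A1; rewrite AE cards1.
  by rewrite cards0 subn0.
rewrite -[RHS]sum1_card.
rewrite [RHS](partition_big (parent F) (fun A => A \in nonroot |: F)) /=.
  apply: eq_bigr => A _; rewrite -sum1_card; apply: eq_bigl => B.
  by rewrite inE.
move=> B BF; have [x xB] := node_neq0 BF.
by have [] := parentP (node_proper BF) xB.
Qed.

(** With [#|F| + 1] internal nodes of at least two children each, a family
    falls short of the maximal size by the number of excess children. *)
Lemma sum_children_excess :
  \sum_(A in nonroot |: F) (#|children F A| - 2) + #|F| = #|X| - 3.
Proof.
have E : \sum_(A in nonroot |: F) #|children F A| =
   \sum_(A in nonroot |: F) (#|children F A| - 2) + (#|F|.+1 * 2).
  have -> : #|F|.+1 * 2 = \sum_(A in nonroot |: F) 2.
    by rewrite sum_nat_const cardsU1 nonroot_notin.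
  rewrite -big_split /=; apply: eq_bigr => A AF.
  by rewrite subnK // children_gt1.
move: E; rewrite sum_children; move: (\sum_(A in _) _) => s.
by move: hX; case: #|X| => [|[|[|m]]] // _; lia.
Qed.

Lemma laminar_card : #|F| <= #|X| - 3.
Proof. by rewrite -sum_children_excess leq_addl. Qed.

(** A member that meets the union of two siblings lies inside one of them or
    contains their parent; a third sibling makes the union a new set. *)
Lemma laminar_merge A B1 B2 : A \in nonroot |: F -> 2 < #|children F A| ->
  B1 \in children F A -> B2 \in children F A -> B1 != B2 ->
  B1 :|: B2 \notin F /\ laminar ((B1 :|: B2) |: F).
Proof.
move=> AF chA c1 c2 B12.
have [N1 P1 min1] := childP c1; have [N2 P2 min2] := childP c2.
have [B3 c3 /norP[B31 B32]] : exists2 B3, B3 \in children F A & ~~ ((B3 == B1) || (B3 == B2)).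
  have: ~~ (children F A \subset [set B1; B2]).
    apply: contraL chA => /subset_leq_card; rewrite cards2 B12 -leqNgt.
    by [].
  by case/subsetPn => B3 c3; rewrite !inE; exists B3.
have [N3 P3 _] := childP c3.
have [x1 x1B] := node_neq0 N1; have [x2 x2B] := node_neq0 N2.
have [x3 x3B] := node_neq0 N3.
have DA : B1 :|: B2 \proper A.
  apply/properP; split; first by rewrite subUset !proper_sub.
  exists x3; first exact: subsetP (proper_sub P3) _ x3B.
  apply/negP => /setUP[] h.
    by rewrite (children_disjoint c3 c1 x3B h) eqxx in B31.
  by rewrite (children_disjoint c3 c2 x3B h) eqxx in B32.
have Ao : A \subset nonroot by case/setU1P: AF => [->|/F1/proper_sub].
have x1B2 : x1 \notin B2.
  by apply: contra B12 => h; rewrite (children_disjoint c1 c2 x1B h).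
have x2B1 : x2 \notin B1.
  by apply: contra B12 => h; rewrite (children_disjoint c1 c2 h x2B).
have B1D : B1 \proper B1 :|: B2.
  by apply/properP; split; [exact: subsetUl|exists x2; rewrite // inE x2B orbT].
have DF : B1 :|: B2 \notin F.
  apply/negP => DF; have := min1 _ (setU1r _ DF) B1D.
  by rewrite -[_ \subset _]negbK; move: DA; rewrite properE => /andP[_ ->].
have D1 : 1 < #|B1 :|: B2|.
  apply: leq_ltn_trans (proper_card B1D); apply/card_gt0P; by exists x1.
have compD C : C \in F -> compatible (B1 :|: B2) C.
  move=> CF; have CN : C \in nodes F by rewrite inE CF.
  have /or3P[AC|CA|/eqP AC] := compatible_root AF CN.
  - by rewrite /compatible (subset_trans (proper_sub DA) AC).
  - have [->|CneA] := eqVneq C A; first by rewrite /compatible (proper_sub DA).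
    have aux B : B \in children F A -> (C \subset B) || (B :&: C == set0).
      move=> cB; have [BN _ minB] := childP cB.
      have /or3P[BC|->|->] := node_compatible BN CN; rewrite ?orbT //.
      have [->|BneC] := eqVneq B C; first by rewrite subxx.
      have := minB _ (setU1r _ CF); rewrite properEneq BneC => /(_ BC) AC.
      by rewrite eqEsubset CA AC in CneA.
    have /orP[C1|/eqP C1] := aux _ c1.
      by rewrite /compatible (subset_trans C1 (subsetUl _ _)) orbT.
    have /orP[C2|/eqP C2] := aux _ c2.
      by rewrite /compatible (subset_trans C2 (subsetUr _ _)) orbT.
    by rewrite /compatible setIUl C1 C2 setU0 eqxx !orbT.
  - apply/or3P/Or33; rewrite -subset0 -AC; apply: setSI.
    exact: proper_sub.
split=> //; apply/laminarP; split.
- by move=> C /setU1P[->|/F1//]; exact: proper_sub_trans DA Ao.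
- by move=> C /setU1P[->//|/F2].
- move=> C C' /setU1P[->|CF] /setU1P[->|CF'].
  + by rewrite /compatible subxx.
  + exact: compD.
  + by rewrite compatibleC; exact: compD.
  + exact: F3.
Qed.

End Counting.

(** As long as a family is too small some node has three children, two of which
    can be merged. *)
Lemma laminar_complete F : 2 < #|X| -> laminar F ->
  exists F', [/\ F \subset F', laminar F' & #|F'| = #|X| - 3].
Proof.
move=> hX; have [m] := ubnP (#|X| - 3 - #|F|); elim: m F => // m IH F Fm lF.
have := laminar_card lF hX; rewrite leq_eqVlt => /orP[/eqP FE|ltF].
  by exists F.
have [/exists_inP[A AF chA]|/exists_inPn noA] :=
    boolP [exists A in nonroot |: F, 2 < #|children F A|].
  have /card_gt1P[B1 [B2 [c1 c2 B12]]] := ltnW chA.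
  have [DF lD] := laminar_merge lF hX AF chA c1 c2 B12.
  have [||F' [sF lF' cF']] := IH ((B1 :|: B2) |: F) => //.
    rewrite cardsU1 DF; move: Fm ltF; lia.
  by exists F'; split=> //; apply: subset_trans sF; exact: subsetUr.
have := sum_children_excess lF hX; rewrite big1 => [|A /noA].
  by move=> E; move: ltF; rewrite -E add0n ltnn.
by rewrite -leqNgt -subn_eq0 => /eqP.
Qed.

(** A further compatible set is a union of children of the smallest cluster
    that contains it: at least two of them, as it is not itself a node, and not
    all of them. *)
Lemma merge_of_children F D : 2 < #|X| -> laminar F -> D \notin F ->
  laminar (D |: F) -> exists A, [/\ A \in nonroot |: F, D \subset A,
    2 < #|children F A|
    & #|children F A| = 3 -> exists B B', [/\ B \in children F A,
        B' \in children F A, B != B' & D = B :|: B']].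
Proof.
move=> hX lF DF /laminarP[D1 D2 D3].
have DD : D \in D |: F by rewrite setU11.
have {}D1 := D1 _ DD; have {}D2 := D2 _ DD.
have {}D3 B : B \in nodes F -> compatible D B.
  case/setUP => [BF|/imsetP[i _ ->]]; first by rewrite D3 // inE BF orbT.
  by rewrite compatibleC compatible_set1.
have DN : D \notin nodes F.
  by apply: contra DF => /nodes_gt1; apply.
have /card_gt0P[x xD] := ltnW D2.
have [AF DA] := parentP lF D1 xD.
move: (parent F D) AF DA (fun C => @parent_sub F C D) => A AF DA minA.
have [/subsetP sDA [z zA zD]] := properP DA.
have dich B y : B \in children F A -> y \in B -> y \in D -> B \subset D.
  move=> cB yB yD; have [BN BA _] := childP lF hX cB.
  have /orP[DB|//] := compatible_meet (D3 _ BN) yD yB.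
  have DB' : D \proper B.
    by rewrite properEneq DB andbT; apply: contraNneq DN => ->.
  have BF : B \in F by apply: nodes_gt1 => //; apply: ltn_trans (proper_card DB').
  have := minA _ (setU1r _ BF) DB'.
  by move: BA; rewrite properE => /andP[_ /negPf->].
have [B cB xB] := children_cover lF hX AF (sDA _ xD).
have BD := dich _ _ cB xB xD.
have [y yD yB] : exists2 y, y \in D & y \notin B.
  apply/subsetPn; apply: contra DN => DB.
  have -> : D = B by apply/eqP; rewrite eqEsubset DB.
  by have [] := childP lF hX cB.
have [B' cB' yB'] := children_cover lF hX AF (sDA _ yD).
have BD' := dich _ _ cB' yB' yD.
have [B'' cB'' zB''] := children_cover lF hX AF zA.
have BB' : B != B' by apply: contraNneq yB => ->.
have B12 : B'' \notin [set B; B'].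
  by apply: contraNN zD => /set2P[] E; [apply: (subsetP BD)|apply: (subsetP BD')]; rewrite -E.
have sch : B'' |: [set B; B'] \subset children F A.
  by apply/subsetP => C /setU1P[->//|/set2P[]->].
have c3 : #|B'' |: [set B; B']| = 3 by rewrite cardsU1 B12 cards2 BB'.
exists A; split=> //; first exact: proper_sub.
  by rewrite -c3 subset_leq_card.
move=> ch3; exists B, B'; split=> //.
have chE : B'' |: [set B; B'] = children F A by apply/eqP; rewrite eqEcard sch ch3 c3.
apply/eqP; rewrite eqEsubset subUset BD BD' !andbT; apply/subsetP => t tD.
have [C cC tC] := children_cover lF hX AF (sDA _ tD).
move: (cC); rewrite -chE => /setU1P[CE|/set2P[] <-]; rewrite ?inE ?tC ?orbT //.
by rewrite CE in cC tC; rewrite (subsetP (dich _ _ cC tC tD)) in zD.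
Qed.

(** One short of a maximal family, exactly one node has three children instead
    of two, and the family is completed by merging two of them. *)
Lemma laminar_codim1 F : 2 < #|X| -> laminar F -> #|F|.+1 = #|X| - 3 ->
  exists A B1 B2 B3, [/\ A \in nonroot |: F, children F A = [set B1; B2; B3],
    [&& B1 != B2, B1 != B3 & B2 != B3]
    & forall D, (D \notin F /\ laminar (D |: F)) <->
        D \in [set B1 :|: B2; B1 :|: B3; B2 :|: B3]].
Proof.
move=> hX lF cF; have := sum_children_excess lF hX.
rewrite -cF => /eqP; rewrite -[X in _ == X]add1n eqn_add2r => /eqP ex1.
have [A AF chA] : exists2 A, A \in nonroot |: F & 2 < #|children F A|.
  apply/exists_inP; apply: contra_eqT ex1 => /exists_inPn noA.
  rewrite big1 // => A /noA; by rewrite -leqNgt -subn_eq0 => /eqP.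
have [ch3 oth] : #|children F A| = 3 /\
    forall A', A' \in nonroot |: F -> 2 < #|children F A'| -> A' = A.
  move: ex1; rewrite (bigD1 A) //= => ex1; split.
    by move: #|children F A| (\sum_(_ in _ | _) _) ex1 chA => c s; clear; lia.
  move=> A' A'F chA'; apply/eqP; apply: contra_eqT ex1 => A'A.
  rewrite (bigD1 A') /=; last by rewrite A'F.
  by move: #|children F A| #|children F A'| (\sum_(_ | _) _) chA chA' => c c' s; clear; lia.
have /card_gt2P[B1 [B2 [B3 [[c1 c2 c3] [b12 b23 b31]]]]] := chA.
have b13 : B1 != B3 by rewrite eq_sym.
have chE : children F A = [set B1; B2; B3].
  apply/esym/eqP; rewrite eqEcard ch3 [X in #|pred_of_set X|]setUC cardsU1 cards2 !inE b12 negb_or b31 (eq_sym B3) b23 /= andbT.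
  by apply/subsetP => C /setUP[/set2P[]|/set1P] ->.
exists A, B1, B2, B3; split=> //; first by rewrite b12 b13 b23.
move=> D; split=> [[DF lD]|].
  have [A' [A'F _ chA' ]] := merge_of_children hX lF DF lD.
  have E := oth _ A'F chA'; subst A' => /(_ ch3) [B [B' [+ + BB' ->]]].
  rewrite chE !inE -!orbA => /or3P[] /eqP BE /or3P[] /eqP B'E; move: BB';
    rewrite BE B'E ?(setUC B2 B1) ?(setUC B3 B1) ?(setUC B3 B2) !eqxx ?orbT //.
by rewrite !inE -orbA => /or3P[] /eqP ->; apply: laminar_merge chA _ _ _.
Qed.

(** Two points in the same child lie together in two of the three unions, and
    two points in different children in exactly one. *)
Lemma merge_pairs F A B1 B2 B3 i j : 2 < #|X| -> laminar F ->
  A \in nonroot |: F -> children F A = [set B1; B2; B3] ->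
  [&& B1 != B2, B1 != B3 & B2 != B3] -> i != j ->
  ((i \in B1 :|: B2) && (j \in B1 :|: B2) + ((i \in B1 :|: B3) && (j \in B1 :|: B3))
    + ((i \in B2 :|: B3) && (j \in B2 :|: B3)) =
  ((i \in A) && (j \in A)) + ((i \in B1) && (j \in B1)) +
    ((i \in B2) && (j \in B2)) + ((i \in B3) && (j \in B3)))%N.
Proof.
move=> hX lF AF chE /and3P[b12 b13 b23] ij.
have [c1 c2 c3] : [/\ B1 \in children F A, B2 \in children F A & B3 \in children F A].
  by rewrite chE !inE !eqxx ?orbT.
have AE x : (x \in A) = [|| x \in B1, x \in B2 | x \in B3].
  apply/idP/or3P => [xA|].
    have [C + xC] := children_cover lF hX AF xA.
    by rewrite chE !inE -orbA => /or3P[] /eqP CE; rewrite CE in xC; [exact: Or31|exact: Or32|exact: Or33].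
  have sub C : C \in children F A -> x \in C -> x \in A.
    by move=> cC; have [_ /proper_sub/subsetP s _] := childP lF hX cC; exact: s.
  by case; exact: sub.
have dis C C' : C \in children F A -> C' \in children F A -> C != C' ->
    forall x, ~~ ((x \in C) && (x \in C')).
  move=> cC cC' CC' x; apply: contra CC' => /andP[xC xC'].
  by rewrite (children_disjoint lF hX cC cC' xC xC').
have d12 := dis _ _ c1 c2 b12; have d13 := dis _ _ c1 c3 b13; have d23 := dis _ _ c2 c3 b23.
move: (d12 i) (d12 j) (d13 i) (d13 j) (d23 i) (d23 j); rewrite !AE !inE.
do 6 case: (_ \in _); by [].
Qed.

End Laminar.

(** * Cuts of a marked tree *)

Lemma connect_ind (V : finType) (e : rel V) (P : V -> Prop) x y :
  (forall a b, e a b -> P a -> P b) -> connect e x y -> P x -> P y.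
Proof.
move=> Pe /connectP[p ep ->]; elim: p x ep => //= z p IH x /andP[xz ep] Px.
by apply: IH => //; apply: Pe xz Px.
Qed.

Fact cut_key : unit. Proof. exact: tt. Qed.

Section Cuts.
Import mathcomp.boot.fintype mathcomp.boot.finset.
Local Open Scope nat_scope.
Local Open Scope set_scope.

Variables (N : nat) (T : marked_tree N) (o : 'I_N).
Local Notation root := (foot T o).
Implicit Types (u v w x y : vert T) (E D : {set vert T}).

Lemma set2P_eq (V : finType) (a b c d : V) :
  [set a; b] = [set c; d] -> (a = c /\ b = d) \/ (a = d /\ b = c).
Proof.
move=> e; have cE : c \in [set a; b] by rewrite e set21.
have dE : d \in [set a; b] by rewrite e set22.
have /set2P[ac|ad] : a \in [set c; d] by rewrite -e set21.
  left; split=> //; have /set2P[bc|//] : b \in [set c; d] by rewrite -e set22.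
  by case/set2P: dE => ->; rewrite ?ac ?bc.
right; split=> //; have /set2P[//|bd] : b \in [set c; d] by rewrite -e set22.
by case/set2P: cE => ->; rewrite ?ad ?bd.
Qed.

Lemma edgeP E :
  reflect (exists u w, adj T u w /\ E = [set u; w]) (E \in bounded_edges T).
Proof.
rewrite inE; apply: (iffP existsP) => [[u /existsP[w /andP[uw /eqP->]]]|[u [w [uw ->]]]].
  by exists u, w.
by exists u; apply/existsP; exists w; rewrite uw eqxx.
Qed.

Lemma edge_mem u w : adj T u w -> [set u; w] \in bounded_edges T.
Proof. by move=> uw; apply/edgeP; exists u, w. Qed.

Definition avoid E : rel (vert T) := [rel u w | adj T u w && ([set u; w] != E)].

Definition far E : {set vert T} :=
  locked_with cut_key [set u | ~~ connect (avoid E) root u].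

Lemma in_far E u : (u \in far E) = ~~ connect (avoid E) root u.
Proof. by rewrite /far locked_withE inE. Qed.

Lemma avoid_sym E : symmetric (avoid E).
Proof. by move=> u w; rewrite /avoid /= adj_sym setUC. Qed.

Lemma connect_avoid_sym E : connect_sym (avoid E).
Proof. exact/sym_connect_sym/avoid_sym. Qed.

Lemma root_far E : root \notin far E.
Proof. by rewrite in_far negbK connect0. Qed.

Lemma far_avoid E u w : avoid E u w -> (u \in far E) = (w \in far E).
Proof.
move=> uw; rewrite !in_far; congr negb; apply: same_connect_r.
  exact: connect_avoid_sym.
exact: connect1.
Qed.

Lemma far_other E u w : adj T u w -> [set u; w] != E ->
  (u \in far E) = (w \in far E).
Proof. by move=> uw uwE; apply: far_avoid; rewrite /avoid /= uw. Qed.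

(** A bounded edge is a bridge: a path avoiding it between its vertices would
    close up to a cycle, and every vertex is connected to one of the two. *)
Lemma far_edge u w : adj T u w ->
  (u \in far [set u; w]) = (w \notin far [set u; w]).
Proof.
set E := [set u; w] => uw.
have uw' : ~~ connect (avoid E) u w.
  apply/negP => /connectP[p up lp].
  move: lp; case/shortenP: up => q qp uq _ lq {p}.
  have qa : path (adj T) u q.
    by apply: sub_path qp => a b /andP[].
  have /adj_acyclic : ucycle (adj T) (u :: q).
    by apply/andP; split=> //; rewrite /= rcons_path qa -lq adj_sym.
  case: q qp lq {uq qa} => [|x [|y q]] //= => [_ /esym wu _|].
    by move: uw; rewrite wu adj_irr.
  by rewrite !andbT => /andP[_ xE] wx _; rewrite -wx eqxx in xE.
have or_uw : connect (avoid E) u root || connect (avoid E) w root.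
  pose P x := is_true (connect (avoid E) u x || connect (avoid E) w x).
  apply: (connect_ind (P := P) _ (adj_connected u root)); rewrite /P ?connect0 //.
  move=> a b ab /=; have [abE|abE] := eqVneq [set a; b] E.
    by have [[_ ->]|[_ ->]] := set2P_eq abE; rewrite connect0 ?orbT.
  have ab1 : connect (avoid E) a b by apply: connect1; rewrite /avoid /= ab.
  by case/orP => h; rewrite (connect_trans h ab1) ?orbT.
rewrite !in_far negbK; apply/idP/idP => [nu|rw].
  by move: or_uw; rewrite !(connect_avoid_sym _ _ root) (negPf nu).
apply: contra uw' => ru; apply: connect_trans rw.
by rewrite connect_avoid_sym.
Qed.

Lemma far_edge_neq E u w : adj T u w -> E = [set u; w] -> (u \in far E) != (w \in far E).
Proof. by move=> uw ->; rewrite far_edge //; case: (w \in _). Qed.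

Lemma edge_cases E : E \in bounded_edges T ->
  exists u w, [/\ adj T u w, E = [set u; w], u \in far E & w \notin far E].
Proof.
case/edgeP => u [w [uw EE]]; have := far_edge uw; rewrite -EE.
have [uE /esym wE|uE /esym/negbT] := boolP (u \in far E); first by exists u, w.
by rewrite negbK; exists w, u; rewrite adj_sym setUC.
Qed.

Lemma pairmap_mem u p E y :
  E \in pairmap (fun x y => [set x; y]) u p -> y \in E -> y \in u :: p.
Proof.
elim: p u => //= x p IH u; rewrite inE => /orP[/eqP->|/IH h yE].
  by rewrite !inE => /orP[]->; rewrite ?orbT.
by rewrite inE h // orbT.
Qed.

Lemma far_path E u p : path (adj T) u p ->
  E \notin pairmap (fun x y => [set x; y]) u p ->
  (u \in far E) = (last u p \in far E).
Proof.
elim: p u => //= x p IH u /andP[ux xp]; rewrite inE negb_or => /andP[Eux Ep].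
rewrite (@far_other E _ _ ux); first exact: IH.
by rewrite eq_sym.
Qed.

(** A path without repetition crosses each of its edges once. *)
Lemma far_upath E u p : path (adj T) u p -> uniq (u :: p) ->
  E \in pairmap (fun x y => [set x; y]) u p ->
  (u \in far E) != (last u p \in far E).
Proof.
elim: p u => //= x p IH u /andP[ux xp] /andP[uxp uq]; rewrite inE.
have [EE _|EE] := eqVneq E [set u; x].
  rewrite -(@far_path E x p) //; first exact: far_edge_neq.
  by apply: contra uxp => /pairmap_mem; apply; rewrite EE set21.
move=> Ep; rewrite (@far_other E _ _ ux); first exact: IH.
by rewrite eq_sym.
Qed.

Lemma upathP u v : exists p, [/\ path (adj T) u p, last u p = v & uniq (u :: p)].
Proof.
have /connectP[p up ->] := adj_connected u v.
by case/shortenP: up => q qp uq _; exists q.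
Qed.

Lemma on_pathE E u v : on_path E u v <-> ((u \in far E) != (v \in far E)).
Proof.
split=> [[p [up <- uq Ep]]|uv]; first exact: far_upath.
have [p [up pv uq]] := upathP u v; exists p; split=> //.
by apply: contraNT uv => Ep; rewrite -pv (far_path up Ep).
Qed.

Lemma connect_of_far (Q : pred {set vert T}) u v :
  (forall E, E \in bounded_edges T -> Q E -> (u \in far E) = (v \in far E)) ->
  connect [rel a b | adj T a b && ~~ Q [set a; b]] u v.
Proof.
move=> uv; have [p [up pv uq]] := upathP u v.
have pQ : all (fun E => (E \in bounded_edges T) ==> ~~ Q E)
    (pairmap (fun x y => [set x; y]) u p).
  apply/allP => E Ep; apply/implyP => ET; apply/negP => /(uv _ ET) uvE.
  by have := far_upath up uq Ep; rewrite pv uvE eqxx.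
apply/connectP; exists p => //; elim: p u up pQ {uv pv uq} => //= x p IH u.
move=> /andP[ux xp] /andP[]; rewrite edge_mem //= => Qux /IH-> //.
by rewrite ux Qux.
Qed.

Lemma tree_ind (P : vert T -> Prop) :
  P root -> (forall a b, adj T a b -> P a -> P b) -> forall v, P v.
Proof. by move=> P0 Pe v; apply: connect_ind Pe (adj_connected root v) P0. Qed.

(** Along paths from the root, membership in [P] and in [far E] change at the
    same steps. *)
Lemma far_char (P : {set vert T}) E : E \in bounded_edges T -> root \notin P ->
  (forall u w, adj T u w -> E = [set u; w] -> (u \in P) != (w \in P)) ->
  (forall u w, adj T u w -> [set u; w] != E -> (u \in P) = (w \in P)) ->
  far E = P.
Proof.
move=> ET rP PE PN; apply/setP; apply: tree_ind.
  by rewrite (negPf rP) (negPf (root_far E)).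
move=> a b ab aP; have [abE|abE] := eqVneq [set a; b] E.
  have := PE _ _ ab (esym abE); have := far_edge_neq ab (esym abE); rewrite aP.
  by do 3 case: (_ \in _).
by rewrite -(far_other ab abE) aP; exact: PN.
Qed.

(** Vertices on the side of [E] that does not contain [E'] are connected within
    that side, hence without crossing [E']. *)
Lemma far_same_side E E' a b x y : E \in bounded_edges T ->
  adj T a b -> E' = [set a; b] -> E' != E ->
  (x \in far E) = (y \in far E) -> (x \in far E) != (a \in far E) ->
  (x \in far E') = (y \in far E').
Proof.
move=> ET ab E'E EE' xy xa.
have ba : (b \in far E) = (a \in far E).
  by apply/esym/far_other; rewrite // -E'E.
have : (y \in far E) = (x \in far E) /\ (y \in far E') = (x \in far E'); last by case.
have: connect [rel c d | adj T c d && ~~ (pred1 E) [set c; d]] x y.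
  by apply: connect_of_far => D _ /eqP->.
pose P z := (z \in far E) = (x \in far E) /\ (z \in far E') = (x \in far E').
move=> /(connect_ind (P := P)); apply=> // c d /= /andP[cd cdE] [cx cx']; rewrite /P.
rewrite -(far_other cd cdE) -(far_other (E := E') cd) //.
apply: contraNneq xa; rewrite E'E -cx => /set2P_eq[[-> _]|[-> _]] //.
by rewrite ba.
Qed.

(** If [E'] lies beyond [E], the root side of [E] is on one side of [E'], so
    [far E'] is inside [far E]; otherwise [far E] is on one side of [E']. *)
Lemma far_compatible E E' : E \in bounded_edges T -> E' \in bounded_edges T ->
  compatible (far E) (far E').
Proof.
move=> ET E'T; have [->|EE'] := eqVneq E' E; first by rewrite /compatible subxx.
have [a [b [ab E'E aE' bE']]] := edge_cases E'T.
have ss := @far_same_side E E' a b _ _ ET ab E'E EE'.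
have [aE|aE] := boolP (a \in far E).
  apply/or3P/Or32/subsetP => x; apply: contraTT => xE.
  by rewrite (ss _ root) ?root_far ?(negPf (root_far E)) ?(negPf xE) ?aE.
have [/existsP[x /andP[xE xE']]|/existsPn no] := boolP [exists x, (x \in far E) && (x \in far E')].
  apply/or3P/Or31/subsetP => y yE.
  by rewrite -(ss x) ?xE ?yE ?(negPf aE).
by apply/or3P/Or33/eqP/setP => x; rewrite in_setI in_set0; apply/negbTE/no.
Qed.

Lemma parent_edge_uniq u w w' : adj T u w -> adj T u w' -> w != w' ->
  u \in far [set u; w] -> u \notin far [set u; w'].
Proof.
move=> uw uw' ww' uE; apply/negP => uE'.
have EE' : [set u; w] != [set u; w'].
  apply: contraNneq ww' => /set2P_eq[[_ ->]//|[<- ->]//].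
have wE : w \notin far [set u; w] by rewrite -far_edge.
have w'E' : w' \notin far [set u; w'] by rewrite -far_edge.
have wE' : w \in far [set u; w'] by rewrite -(far_other uw EE').
have w'E : w' \in far [set u; w] by rewrite -(far_other uw') // eq_sym.
have /orP[] := compatible_meet (far_compatible (edge_mem uw) (edge_mem uw')) uE uE'.
  by move/subsetP/(_ _ w'E); rewrite (negPf w'E').
by move/subsetP/(_ _ wE'); rewrite (negPf wE).
Qed.

Lemma child_far_disjoint u w w' : adj T u w -> adj T u w' -> w != w' ->
  w \in far [set u; w] -> w' \in far [set u; w'] ->
  far [set u; w] :&: far [set u; w'] = set0.
Proof.
wlog: w w' / ~~ (far [set u; w'] \subset far [set u; w]) => [W|/negPf s'].
  move=> uw uw' ww' wE w'E'.
  have [|s1] := boolP (far [set u; w'] \subset far [set u; w]); last by apply: W.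
  have [s2|s2] := boolP (far [set u; w] \subset far [set u; w']); last first.
    by rewrite setIC => _; apply: W; rewrite // eq_sym.
  move: wE; have := subsetP s2 w; move=> h /[dup] wE /h wE'.
  have EE' : [set u; w] != [set u; w'].
    apply: contraNneq ww' => /set2P_eq[[_ ->]//|[<- ->]//].
  by move: (far_edge uw'); rewrite (far_other uw EE') wE' w'E'.
move=> uw uw' ww' wE w'E'.
have EE' : [set u; w] != [set u; w'].
  apply: contraNneq ww' => /set2P_eq[[_ ->]//|[<- ->]//].
have /or3P[/subsetP/(_ _ wE) wE'||/eqP//] := far_compatible (edge_mem uw) (edge_mem uw').
  by move: (far_edge uw'); rewrite (far_other uw EE') wE' w'E'.
by rewrite s'.
Qed.

(** Beyond every bounded edge there is an end: walk away from the root until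
    a vertex carries one. *)
Lemma far_end E : E \in bounded_edges T -> exists i, foot T i \in far E.
Proof.
have [m] := ubnP #|far E|; elim: m E => // m IH E Em /[dup] ET /edge_cases[u [w [uw EE uE wE]]].
have [/existsP[i /eqP iu]|/existsPn noi] := boolP [exists i, foot T i == u].
  by exists i; rewrite iu.
have := valence_ge3 u; rewrite (eq_card0 (A := [pred i | foot T i == u])) => [|i]; last first.
  exact/negbTE/noi.
rewrite addn0 => deg; have [x ux xw] : exists2 x, adj T u x & x != w.
  apply/exists_inP; apply: contraTT deg => /exists_inPn h.
  have /subset_leq_card s : [pred x | adj T u x] \subset pred1 w.
    by apply/subsetP => x; rewrite !inE => /h; rewrite negbK.
  by rewrite -leqNgt (leq_trans s) // card1.
have uE' : u \notin far [set u; x].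
  by apply: (@parent_edge_uniq u w x) => //; rewrite -?EE // eq_sym.
have xE' : x \in far [set u; x].
  by have := far_edge ux; rewrite (negPf uE') => /esym/negbT; rewrite negbK.
have xE : x \in far E.
  rewrite -(far_other ux) // EE; apply: contraNneq xw => /set2P_eq[[_ ->]//|[_ xu]].
  by rewrite xu adj_irr in ux.
have sE : far [set u; x] \subset far E.
  have /orP[//|/subsetP/(_ _ uE)] :=
    compatible_meet (far_compatible (edge_mem ux) ET) xE' xE.
  by rewrite (negPf uE').
have [||i iE'] := IH [set u; x]; rewrite ?edge_mem //.
  apply: leq_trans (Em : _ <= m); apply: proper_card; apply/properP; split=> //.
  by exists u.
by exists i; apply: subsetP sE _ iE'.
Qed.

(** A vertex is the meeting point of [o] and two further ends: having valence at
    least three, it has two branches that do not lead to [o], and each of them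
    contains an end. *)
Lemma vertex_median u : exists j k, [/\ j != o, k != o, j != k
  & forall E, E \in bounded_edges T ->
     (u \in far E -> foot T j \in far E /\ foot T k \in far E) /\
     (u \notin far E -> ~~ ((foot T j \in far E) && (foot T k \in far E)))].
Proof.
(* [j] lies in a branch with vertex set [S], which is empty if [j] is attached
   to [u] itself. *)
pose branch j (S : {set vert T}) := [/\ j != o, foot T j \in u |: S,
  forall E, E \in bounded_edges T -> u \in far E -> foot T j \in far E
  & forall E, E \in bounded_edges T -> u \notin far E -> foot T j \in far E -> far E \subset S].
suff [j [k [S [S' [jk SS' [jo jS jE jE'] [ko kS kE kE']]]]]] :
    exists j k S S', [/\ j != k, S :&: S' = set0, branch j S & branch k S'].
  exists j, k; split=> // E ET; split=> [uE|uE]; first by split; [apply: jE | apply: kE].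
  apply/negP => /andP[jF kF].
  have : foot T j \in S :&: S'.
    by rewrite inE (subsetP (jE' E ET uE jF)) ?(subsetP (kE' E ET uE kF)).
  by rewrite SS' inE.
pose Ds := [set x | adj T u x & x \in far [set u; x]].
pose Is := [set i | (foot T i == u) && (i != o)].
have brI i : i \in Is -> branch i set0.
  rewrite inE => /andP[/eqP iu io]; rewrite /branch iu; split=> // [|E _ /negPf->//].
  by rewrite setU0 set11.
have brD x : x \in Ds -> exists j, branch j (far [set u; x]) /\ foot T j \in far [set u; x].
  rewrite inE => /andP[ux xE]; have [j jE] := far_end (edge_mem ux).
  have uE : u \notin far [set u; x] by rewrite (far_edge ux) negbK.
  have uxE E : E \in bounded_edges T -> E != [set u; x] -> (u \in far E) = (x \in far E).
    by move=> ET EE; apply: far_other; rewrite // eq_sym.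
  exists j; split=> //; split=> [||E ET uF|E ET uF jF].
  - by apply: contraTneq jE => ->; exact: root_far.
  - by rewrite inE jE orbT.
  - have EE : E != [set u; x] by apply: contraNneq uE => <-.
    have xF : x \in far E by rewrite -uxE.
    have /orP[/subsetP/(_ _ jE)//|/subsetP/(_ _ uF)] :=
      compatible_meet (far_compatible (edge_mem ux) ET) xE xF.
    by rewrite (negPf uE).
  - have [->//|EE] := eqVneq E [set u; x].
    have /orP[/subsetP/(_ _ xE)|//] :=
      compatible_meet (far_compatible (edge_mem ux) ET) jE jF.
    by rewrite -uxE // (negPf uF).
have child w : adj T u w -> u \notin far [set u; w] -> w \in Ds.
  by move=> uw uE; rewrite inE uw /=; move: uE; rewrite far_edge ?negbK.
have c2 : 2 <= #|Ds| + #|Is|.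
  have dD : #|[pred w | adj T u w]| <= #|Ds| + (u != root).
    have [/existsP[w0 /andP[uw0 w0E]]|/existsPn no] :=
        boolP [exists w, adj T u w && (u \in far [set u; w])].
      have -> : u != root by apply: contraTneq w0E => ->; exact: root_far.
      rewrite -[nat_of_bool true](cards1 w0) addnC; apply: leq_trans (leq_card_setU [set w0] Ds).
      apply/subset_leq_card/subsetP => w; rewrite inE => uw; rewrite in_setU1.
      have [//|ww0] := eqVneq w w0; apply: child => //=.
      by apply: parent_edge_uniq uw0 uw _ w0E; rewrite eq_sym.
    apply: leq_trans (leq_addr _ _); apply/subset_leq_card/subsetP => w uw.
    by apply: child => //; have := no w; rewrite [adj T u w]uw.
  have iI : #|[pred i | foot T i == u]| <= #|Is| + (u == root).
    have [ur|ur] := eqVneq u root.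
      rewrite -[nat_of_bool true](cards1 o) addnC; apply: leq_trans (leq_card_setU [set o] Is).
      apply/subset_leq_card/subsetP => i; rewrite inE => iu.
      by rewrite /Is in_setU1 inE iu; case: eqP.
    rewrite addn0; apply/subset_leq_card/subsetP => i; rewrite inE => iu.
    by rewrite /Is inE iu /=; apply: contraNneq ur => <-; rewrite eq_sym.
  have := leq_trans (valence_ge3 u) (leq_add dD iI).
  by case: (u == root); lia.
have [/card_gt1P[x [y [xD yD xy]]]|D1] := ltnP 1 #|Ds|.
  have [j [bj jE]] := brD x xD; have [k [bk kE]] := brD y yD.
  have dis : far [set u; x] :&: far [set u; y] = set0.
    move: xD yD; rewrite !inE => /andP[ux xE] /andP[uy yE].
    exact: child_far_disjoint.
  exists j, k, (far [set u; x]), (far [set u; y]); split=> //.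
  apply/eqP => jk; have := in_set0 (foot T j).
  by rewrite -dis inE jE jk kE.
have [/card_gt0P[x xD]|D0] := ltnP 0 #|Ds|.
  have /card_gt0P[i iI] : 0 < #|Is| by lia.
  have [j [bj jE]] := brD x xD.
  exists j, i, (far [set u; x]), set0; split; [|exact: setI0|exact: bj|exact: brI].
  apply: contraTneq jE => ->; move: iI xD; rewrite !inE => /andP[/eqP-> _] /andP[ux].
  by rewrite (far_edge ux) negbK.
have /card_gt1P[i [j [iI jI ij]]] : 1 < #|Is| by lia.
by exists i, j, set0, set0; split=> //; rewrite ?setI0 //; exact: brI.
Qed.

Definition far_ends E : {set 'I_N} := [set i | foot T i \in far E].

(** A vertex beyond [E] but not beyond [E'] has an end in one of its branches
    that is beyond [E] and not beyond [E']. *)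
Lemma far_ends_sub E E' : E \in bounded_edges T -> E' \in bounded_edges T ->
  (far_ends E \subset far_ends E') = (far E \subset far E').
Proof.
move=> ET E'T; apply/idP/idP => [/subsetP s|/subsetP s]; apply/subsetP; last first.
  by move=> i; rewrite !inE; apply: s.
move=> u uE; apply/negPn/negP => uE'; have [j [k [_ _ _ m]]] := vertex_median u.
have [/(_ uE)[jE kE] _] := m E ET; have [_ /(_ uE')] := m E' E'T.
by have := s j; have := s k; rewrite !inE jE kE => -> // ->.
Qed.

Lemma far_inj E E' : E \in bounded_edges T -> E' \in bounded_edges T ->
  far E = far E' -> E = E'.
Proof.
move=> ET E'T EE'; apply/eqP; case/edge_cases: ET => u [w [uw EE uE wE]].
apply: contraNT wE => nEE'; rewrite EE' -(far_other (E := E') uw) -?EE' //.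
by rewrite -EE.
Qed.

Lemma far_ends_inj : {in bounded_edges T &, injective far_ends}.
Proof.
move=> E E' ET E'T EE'; apply: far_inj => //; apply/eqP.
by rewrite eqEsubset -!far_ends_sub // EE' subxx.
Qed.

Definition clusters : {set {set 'I_N}} := far_ends @: bounded_edges T.

Lemma clusters_laminar : laminar o clusters.
Proof.
apply/laminarP; split=> [_ /imsetP[E ET ->]|_ /imsetP[E ET ->]|].
- have [u [w [uw EE uE wE]]] := edge_cases ET.
  have [j [k [jo ko jk /(_ E ET)[_ /(_ wE)]]]] := vertex_median w.
  have so : far_ends E \subset nonroot o.
    by apply/subsetP => i; rewrite !inE; apply: contraTneq => ->; exact: root_far.
  rewrite negb_and => /orP[jE|kE]; apply/properP; split=> //.
    by exists j; rewrite ?inE // in jE *.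
  by exists k; rewrite ?inE // in kE *.
- have [u [w [uw EE uE wE]]] := edge_cases ET.
  have [j [k [jo ko jk /(_ E ET)[/(_ uE)[jE kE] _]]]] := vertex_median u.
  by apply/card_gt1P; exists j, k; rewrite !inE in jE kE *.
- move=> _ _ /imsetP[E ET ->] /imsetP[E' E'T ->].
  have /or3P[s|s|/eqP s] := far_compatible ET E'T.
  + by rewrite /compatible far_ends_sub // s.
  + by rewrite /compatible (far_ends_sub E'T ET) s orbT.
  + apply/or3P/Or33/eqP/setP => i; rewrite !in_setI in_set0.
    have := in_set0 (foot T i); rewrite -s in_setI => <-.
    by congr (_ && _); rewrite inE.
Qed.

(** Exactly one of the edges at [u] leads towards a given end, unless that end
    is attached to [u]. *)
Lemma unique_direction u v :
  \sum_(w | adj T u w) ((v \in far [set u; w]) == (w \in far [set u; w])) + (v == u) = 1.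
Proof.
have sideE w : adj T u w ->
    ((v \in far [set u; w]) == (w \in far [set u; w])) =
    ((u \in far [set u; w]) != (v \in far [set u; w])).
  by move=> uw; rewrite (far_edge uw); do 2 case: (_ \in _).
have [vu|vu] := eqVneq v u.
  by rewrite big1 // => w uw; rewrite sideE // vu eqxx.
have [[|x p] /= [up pv uq]] := upathP u v; first by rewrite pv eqxx in vu.
have /andP[ux xp] := up; have /andP[uxp _] := uq.
rewrite addn0 (bigD1 x) //= big1 ?addn0.
  by rewrite sideE // -pv (far_upath (p := x :: p)) //= inE eqxx.
move=> w /andP[uw wx]; rewrite sideE //.
rewrite (far_path (p := x :: p) up) /= ?pv ?eqxx // inE negb_or; apply/andP; split.
  by apply: contraNneq wx => /set2P_eq[[_ ->]//|[xu _]]; rewrite -xu adj_irr in ux.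
by apply: contra uxp => /pairmap_mem; apply; rewrite set21.
Qed.

End Cuts.

(** * The tree of a laminar family *)

Section Realization.
Import mathcomp.boot.fintype mathcomp.boot.finset.
Local Open Scope nat_scope.
Local Open Scope set_scope.

Variables (N : nat) (o : 'I_N) (F : {set {set 'I_N}}).
Hypotheses (hN : 2 < N) (lF : laminar o F).

Local Notation top := (nonroot o).
Local Notation V := (top |: F).

Implicit Types A B : {set 'I_N}.

Let hX : 2 < #|'I_N|. Proof. by rewrite card_ord. Qed.

Let F1 : {in F, forall A, A \proper top}.
Proof. by case/laminarP: lF. Qed.
Let F2 : {in F, forall A, 1 < #|A|}.
Proof. by case/laminarP: lF. Qed.
Let F3 : {in F &, forall A B, compatible A B}.
Proof. by case/laminarP: lF. Qed.

Definition node (a : 'I_#|V|) : {set 'I_N} := enum_val a.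

Lemma top_in : top \in V. Proof. exact: setU11. Qed.

Definition node_of (A : {set 'I_N}) : 'I_#|V| := enum_rank_in top_in A.

Lemma node_ofK A : A \in V -> node (node_of A) = A.
Proof. exact: enum_rankK_in. Qed.

Lemma node_in a : node a \in V. Proof. exact: enum_valP. Qed.

Lemma node_inj : injective node. Proof. exact: enum_val_inj. Qed.

Local Notation par := (parent o F).

Definition cover_adj : rel 'I_#|V| := fun a b =>
  ((node a != top) && (node b == par (node a))) ||
  ((node b != top) && (node a == par (node b))).

Definition cover_foot (i : 'I_N) : 'I_#|V| := node_of (least o F (fun A => i \in A)).

Lemma node_foot i : node (cover_foot i) = least o F (fun A => i \in A).
Proof. by rewrite node_ofK //; apply: least_in lF _ => A _; exact. Qed.

Lemma node_foot_sub i A : A \in F -> (node (cover_foot i) \subset A) = (i \in A).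
Proof.
move=> AF; rewrite node_foot; apply/idP/idP => [/subsetP s|iA]; last exact: least_sub.
have [io|io] := boolP (i \in top); first by apply: s; apply: least_mem.
have := F1 AF; rewrite properE => /andP[_]; case/negP.
apply/subsetP => x xt; apply: s; apply: least_mem => // B BF iB.
by have := subsetP (proper_sub (F1 BF)) _ iB; rewrite (negPf io).
Qed.

Lemma node_root : node (cover_foot o) = top.
Proof.
rewrite node_foot /least big_pred0 ?setIT // => A; apply/negP => /andP[AF oA].
by have := subsetP (proper_sub (F1 AF)) _ oA; rewrite !inE eqxx.
Qed.

Lemma tree_node_neq0 a : exists x, x \in node a.
Proof.
case/setU1P: (node_in a) => [->|/F2/ltnW/card_gt0P//].
by apply/card_gt0P; rewrite card_nonroot card_ord; move: hN; lia.
Qed.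

Lemma node_top a : node a != top -> node a \in F.
Proof. by case/setU1P: (node_in a) => [->|//]; rewrite eqxx. Qed.

Lemma node_par a : node a != top -> par (node a) \in V /\ node a \proper par (node a).
Proof.
move=> /node_top aF; have [x xa] := tree_node_neq0 a.
by apply: parentP xa => //; apply: F1.
Qed.

Lemma cover_sym : symmetric cover_adj.
Proof. by move=> a b; rewrite /cover_adj orbC. Qed.

Lemma cover_irr : irreflexive cover_adj.
Proof.
move=> a; rewrite /cover_adj orbb; apply/negP => /andP[/node_par[_] + /eqP aE].
by rewrite -aE properxx.
Qed.

Lemma coverP a b : cover_adj a b ->
  (node a != top /\ node b = par (node a)) \/ (node b != top /\ node a = par (node b)).
Proof. by case/orP => /andP[? /eqP]; auto. Qed.

Lemma cover_parent a : node a != top -> cover_adj a (node_of (par (node a))).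
Proof. by move=> at'; rewrite /cover_adj at' node_ofK ?eqxx //; case: (node_par at'). Qed.

Lemma cover_to_root a : connect cover_adj a (cover_foot o).
Proof.
have [m] := ubnP (N - #|node a|); elim: m a => // m IH a am.
have [at'|at'] := eqVneq (node a) top.
  by rewrite (node_inj (etrans at' (esym node_root))) connect0.
have [pV ap] := node_par at'; apply: connect_trans (connect1 (cover_parent at')) _.
apply: IH; rewrite node_ofK //; have := proper_card ap.
have := subset_leq_card (subsetT (par (node a))); rewrite cardsT card_ord.
by move: am; move: #|node a| #|par (node a)| => x y; clear; lia.
Qed.

Lemma cover_connected a b : connect cover_adj a b.
Proof.
apply: connect_trans (cover_to_root a) _.
by rewrite (sym_connect_sym cover_sym) cover_to_root.
Qed.

(** Both neighbours on a cycle of a vertex with smallest cluster would be its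
    parent. *)
Lemma cover_acyclic c : ucycle cover_adj c -> size c <= 2.
Proof.
case: c => // a0 c0; set c := a0 :: c0 => cyc.
have [a ac mina] := @arg_minnP _ a0 (mem c) (fun a => #|node a|) (mem_head _ _).
have up b : b \in c -> cover_adj a b -> node b = par (node a).
  move=> bc /coverP[[_ //]|[bt aE]]; have [_ /proper_card] := node_par bt.
  by rewrite -aE ltnNge; move: (mina b bc) => /= ->.
have /andP[cy uq] := cyc; have [i s cE] := rot_to ac.
have: cycle cover_adj (a :: s) by rewrite -cE rot_cycle.
have: uniq (a :: s) by rewrite -cE rot_uniq.
have mems b : b \in s -> b \in c by move=> bs; rewrite -(mem_rot i) cE inE bs orbT.
rewrite -(size_rot i) cE; case: s {cE} mems => [|b [|b' s]] //= mems.
rewrite !inE !negb_or -!andbA => /and5P[_ _ _ bb' /andP[bs _]].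
rewrite rcons_path /= => /and4P[ab _ _ ya].
have b_ : b \in c by apply: mems; rewrite inE eqxx.
have y_ : last b' s \in c by apply: mems; rewrite inE mem_last orbT.
rewrite cover_sym in ya.
have /node_inj yb := etrans (up _ y_ ya) (esym (up _ b_ ab)).
have := mem_last b' s; rewrite yb inE (negPf bb') /=.
by rewrite (negPf bs).
Qed.

(** The neighbours of a node are its parent and its children; the leaves among
    the children are ends instead, and the root carries [o] in place of a
    parent. *)
Lemma cover_valence a :
  3 <= #|[pred b | cover_adj a b]| + #|[pred i | cover_foot i == a]|.
Proof.
pose Ds := [set b | (node b != top) && (node a == par (node b))].
pose Is := [set i | (cover_foot i == a) && (i != o)].
have ch : #|children o F (node a)| <= #|Ds| + #|Is|.
  rewrite -(card_imset (mem Ds) node_inj) -(card_imset (mem Is) (@set1_inj _)).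
  apply: leq_trans (leq_card_setU _ _); apply/subset_leq_card/subsetP => B.
  rewrite !inE => /andP[/orP[BF|/imsetP[i io BE]] /eqP Bp]; apply/orP; [left|right].
    apply/imsetP; exists (node_of B); last by rewrite node_ofK // inE BF orbT.
    rewrite inE node_ofK ?inE ?BF ?orbT // Bp eqxx andbT.
    by apply: contraTneq (F1 BF) => ->; rewrite properxx.
  apply/imsetP; exists i; rewrite // inE; apply/andP; split; last by rewrite !inE in io.
  apply/eqP/node_inj; rewrite node_foot -Bp BE; apply: eq_least => A AF.
  by rewrite properEcard sub1set cards1 F2 // andbT.
have dD : #|Ds| + (node a != top) <= #|[pred b | cover_adj a b]|.
  have [at'|at'] := eqVneq (node a) top.
    by rewrite addn0; apply/subset_leq_card/subsetP => b; rewrite !inE /cover_adj orbC => ->.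
  have [pV ap] := node_par at'.
  have pD : node_of (par (node a)) \notin Ds.
    rewrite inE node_ofK // negb_and negbK orbC -implyNb negbK; apply/implyP => /eqP aE.
    have [//|pt] := eqVneq (par (node a)) top.
    have := node_par (a := node_of (par (node a))); rewrite node_ofK // => /(_ pt)[_].
    by rewrite -aE => /(proper_trans ap); rewrite properxx.
  have := cardsU1 (node_of (par (node a))) Ds; rewrite pD addnC => <-.
  apply/subset_leq_card/subsetP => b /setU1P[->|]; first by rewrite inE cover_parent.
  by rewrite !inE /cover_adj orbC => ->.
have iI : #|Is| + (node a == top) <= #|[pred i | cover_foot i == a]|.
  have [at'|at'] := eqVneq (node a) top.
    have oI : o \notin Is by rewrite inE eqxx andbF.
    have := cardsU1 o Is; rewrite oI addnC => <-.
    apply/subset_leq_card/subsetP => b /setU1P[->|]; last by rewrite !inE => /andP[].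
    by rewrite inE; apply/eqP/node_inj; rewrite node_root at'.
  by rewrite addn0; apply/subset_leq_card/subsetP => b; rewrite !inE => /andP[].
apply: leq_trans (leq_add dD iI); rewrite addnACA.
have -> : (node a != top) + (node a == top) = 1 by case: eqP.
by rewrite addn1 ltnS (leq_trans _ ch) // children_gt1 // node_in.
Qed.

Definition laminar_tree : marked_tree N :=
  MarkedTree cover_sym cover_irr cover_connected cover_acyclic cover_valence.

Lemma laminar_tree_far (a : vert laminar_tree) b : node a != top -> node b = par (node a) ->
  far o [set a; b] = [set c : vert laminar_tree | node c \subset node a].
Proof.
move=> at' bE; have ab : adj laminar_tree a b.
  by rewrite /= /cover_adj at' bE eqxx.
have [_ ap] := node_par at'.
apply: far_char => [|||].
- exact: edge_mem.
- rewrite inE /= node_root; apply: contra at' => s.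
  by have /setU1P[->//|/F1/proper_sub s'] := node_in a; rewrite eqEsubset s' s.
- move=> u w uw /set2P_eq[[<- <-]|[<- <-]]; rewrite !inE subxx bE;
  by move: ap; rewrite properE => /andP[_ /negPf->].
- have aux u w : node u != top -> node w = par (node u) -> [set u; w] != [set a; b] ->
      (u \in [set c : vert laminar_tree | node c \subset node a]) = (w \in [set c : vert laminar_tree | node c \subset node a]).
    move=> ut wE uwE; rewrite !inE; have [_ up] := node_par ut.
    apply/idP/idP => [s|]; last by rewrite wE; apply/subset_trans/proper_sub.
    have [ua|ua] := eqVneq (node u) (node a).
      have uaE := node_inj ua; have wb : w = b by apply: node_inj; rewrite wE bE ua.
      by rewrite uaE wb eqxx in uwE.
    by rewrite wE; apply: parent_sub; rewrite ?node_in // properEneq ua.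
  move=> u w /coverP[[ut wE]|[wt uE]] uwE; first exact: aux.
  by apply/esym/aux => //; rewrite [X in X != _]setUC.
Qed.

Lemma laminar_tree_far_ends (a : vert laminar_tree) b : node a != top ->
  node b = par (node a) -> far_ends o [set a; b] = node a.
Proof.
move=> at' bE; apply/setP => i.
by rewrite inE laminar_tree_far // inE node_foot_sub // node_top.
Qed.

Lemma laminar_tree_clusters : clusters laminar_tree o = F.
Proof.
apply/setP => A; apply/imsetP/idP => [[E /edgeP[u [w [uw ->]]] ->]|AF].
  by case/coverP: uw => [[ut wE]|[wt uE]]; last rewrite [[set u; w]]setUC;
    rewrite laminar_tree_far_ends // node_top.
have AV : A \in V by rewrite inE AF orbT.
have At : A != top by apply: contraTneq (F1 AF) => ->; rewrite properxx.
pose a : vert laminar_tree := node_of A.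
have at' : node a != top by rewrite node_ofK.
exists [set a; node_of (par (node a))]; first by apply/edge_mem/cover_parent.
rewrite laminar_tree_far_ends ?node_ofK //.
by have [] := node_par at'; rewrite node_ofK.
Qed.

End Realization.

(** * Contraction of edges *)

(** The tree [T'] arises from [T] by contracting the bounded edges not in
    [keep]. *)
Definition contraction N (T T' : marked_tree N) (keep : pred {set vert T})
    (f : vert T -> vert T') : Prop :=
  [/\ forall a, exists u, f u = a,
      forall u w, (f u == f w) =
        connect [rel a b | adj T a b && ~~ keep [set a; b]%SET] u w,
      forall u w, adj T u w -> keep [set u; w]%SET -> adj T' (f u) (f w),
      forall a b, adj T' a b -> exists u w, [/\ f u = a, f w = b & adj T u w]
    & forall i, foot T' i = f (foot T i)].

Section Squash.
Import mathcomp.boot.fintype mathcomp.boot.finset.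
Local Open Scope nat_scope.
Local Open Scope set_scope.

Variables (N : nat) (T : marked_tree N) (o : 'I_N) (keep : pred {set vert T}).
Hypothesis hN : 2 < N.
Implicit Types (u w : vert T) (E : {set vert T}).

Definition kept_clusters : {set {set 'I_N}} :=
  [set far_ends o E | E in [set E in bounded_edges T | keep E]].
Local Notation F := kept_clusters.

Lemma kept_clustersP A :
  reflect (exists E, [/\ E \in bounded_edges T, keep E & A = far_ends o E]) (A \in F).
Proof.
apply: (iffP imsetP) => [[E]|[E [ET kE ->]]].
  by rewrite inE => /andP[ET kE ->]; exists E.
by exists E; rewrite // inE ET.
Qed.

Lemma kept_laminar : laminar o F.
Proof.
apply: laminarS (clusters_laminar T o); apply/subsetP => _ /kept_clustersP[E [ET _ ->]].
exact: imset_f.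
Qed.

Local Notation TF := (laminar_tree hN kept_laminar).

Definition beyond u : pred {set 'I_N} := fun A =>
  [exists E in bounded_edges T, (far_ends o E == A) && (u \in far o E)].

Lemma beyondE u E : E \in bounded_edges T -> beyond u (far_ends o E) = (u \in far o E).
Proof.
move=> ET; apply/existsP/idP => [[D /and3P[DT /eqP DE uD]]|uE]; last first.
  by exists E; rewrite ET eqxx.
by rewrite -(far_ends_inj DT ET DE).
Qed.

(** The vertex of the contracted tree is the smallest kept cluster beyond whose
    edge [u] lies. *)
Definition squash u : vert TF := node_of o F (least o F (beyond u)).

Lemma node_squash u : node (squash u) = least o F (beyond u).
Proof.
rewrite node_ofK //; have [j [k [_ _ _ m]]] := vertex_median o u.
apply: (@least_in _ _ _ _ j kept_laminar) => _ /kept_clustersP[E [ET _ ->]].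
by rewrite beyondE // inE => /(proj1 (m E ET))[].
Qed.

(** Otherwise one of the two ends meeting [o] at [u] would be in the cluster of
    [squash u] but not beyond [E]. *)
Lemma squash_sub u E : E \in bounded_edges T -> keep E ->
  (node (squash u) \subset far_ends o E) = (u \in far o E).
Proof.
move=> ET kE; have EF : far_ends o E \in F by apply/kept_clustersP; exists E.
apply/idP/idP => [/subsetP s|uE]; last first.
  by rewrite node_squash least_sub // beyondE.
apply/negPn/negP => uE; have [j [k [jo ko _ m]]] := vertex_median o u.
have mem i : i != o ->
    (forall E, E \in bounded_edges T -> u \in far o E -> foot T i \in far o E) ->
    foot T i \in far o E.
  move=> io h; have := s i; rewrite inE; apply; rewrite node_squash.
  apply: least_mem; first by rewrite !inE.
  move=> _ /kept_clustersP[D [DT _ ->]].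
  by rewrite beyondE // inE; apply: h.
have /negP[] := proj2 (m E ET) uE; apply/andP; split; apply: mem => // D DT uD;
  by have [] := proj1 (m D DT) uD.
Qed.

Lemma far_sub_of_step u w E E' : adj T u w -> E = [set u; w] ->
  u \in far o E -> w \notin far o E -> E' \in bounded_edges T -> u \in far o E' ->
  far o E \subset far o E'.
Proof.
move=> uw EE uE wE E'T uE'; have ET : E \in bounded_edges T by rewrite EE edge_mem.
have [->//|EE'] := eqVneq E E'.
have /orP[//|/subsetP s] := compatible_meet (far_compatible o ET E'T) uE uE'.
have := s w; rewrite -(@far_other _ _ o E' _ _ uw) -?EE // => /(_ uE').
by rewrite (negPf wE).
Qed.

Lemma squash_far u w E : adj T u w -> E = [set u; w] -> keep E ->
  u \in far o E -> w \notin far o E ->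
  node (squash u) = far_ends o E /\ node (squash w) = parent o F (far_ends o E).
Proof.
move=> uw EE kE uE wE; have ET : E \in bounded_edges T by rewrite EE edge_mem.
have EF : far_ends o E \in F by apply/kept_clustersP; exists E.
have [F1 _ _] := laminarP _ _ kept_laminar.
have step E' := @far_sub_of_step u w E E' uw EE uE wE.
split.
  apply/eqP; rewrite eqEsubset squash_sub // uE node_squash subsetI.
  rewrite (proper_sub (F1 _ EF)); apply/bigcapsP => _ /andP[/kept_clustersP[E' [E'T _ ->]]].
  by rewrite beyondE // => uE'; rewrite far_ends_sub // step.
rewrite node_squash; apply: eq_least => _ /kept_clustersP[E' [E'T _ ->]].
rewrite beyondE // properE !far_ends_sub //.
have [->|EE'] := eqVneq E' E; first by rewrite (negPf wE) subxx.
have uwE' : (u \in far o E') = (w \in far o E') by apply: far_other; rewrite // -EE eq_sym.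
apply/idP/andP => [wE'|[/subsetP s _]]; last by rewrite -uwE' s.
split; first by rewrite step // uwE'.
by apply/subsetPn; exists w.
Qed.

Lemma squash_contraction : contraction keep squash.
Proof.
have [F1 _ _] := laminarP _ _ kept_laminar.
have adjE u w : adj T u w -> keep [set u; w] -> u \in far o [set u; w] ->
    adj TF (squash u) (squash w).
  move=> uw kE uE; have wE : w \notin far o [set u; w] by rewrite -far_edge.
  have [nu nw] := squash_far uw erefl kE uE wE.
  apply/orP; left; rewrite nw -nu eqxx andbT nu.
  have /F1 : far_ends o [set u; w] \in F.
    by apply/kept_clustersP; exists [set u; w]; rewrite edge_mem.
  by apply: contraTneq => ->; rewrite properxx.
split.
- move=> a; case/setU1P: (node_in a) => [at'|/kept_clustersP[E [ET kE aE]]].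
    exists (foot T o); apply: node_inj; rewrite at' node_squash /least big_pred0 ?setIT //.
    move=> A; apply/negP => /andP[/kept_clustersP[E [ET _ ->]]].
    by rewrite beyondE // (negPf (root_far _ _)).
  have [u [w [uw EE uE wE]]] := edge_cases o ET; exists u; apply: node_inj.
  by have [->] := squash_far uw EE kE uE wE.
- move=> u w; apply/eqP/idP => [uw|uw].
    by apply: (@connect_of_far _ _ o) => E ET kE; rewrite -!squash_sub // uw.
  apply: node_inj; rewrite !node_squash; apply: eq_least => _ /kept_clustersP[E [ET kE ->]].
  rewrite !beyondE //.
  have : (fun x => (x \in far o E) = (u \in far o E)) w; last by [].
  apply: (connect_ind (P := fun x => (x \in far o E) = (u \in far o E))) uw _ => //.
  move=> a b /andP[ab kab] <-; apply/esym/far_other => //.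
  by apply: contraNneq kab => ->.
- move=> u w uw kE; have [uE|uE] := boolP (u \in far o [set u; w]); first exact: adjE.
  rewrite adj_sym; apply: adjE; rewrite ?[[set w; u]]setUC // 1?adj_sym //.
  by have := far_edge o uw; rewrite (negPf uE) => /esym/negbT; rewrite negbK.
- have lift a b : node a != nonroot o -> node b = parent o F (node a) ->
      exists u w, [/\ squash u = a, squash w = b & adj T u w].
    move=> /node_top/kept_clustersP[E [ET kE aE]] bE.
    have [u [w [uw EE uE wE]]] := edge_cases o ET; exists u, w.
    have [nu nw] := squash_far uw EE kE uE wE.
    by split=> //; apply: node_inj; rewrite ?nu ?nw ?bE aE.
  move=> a b /coverP[[at' bE]|[bt aE]]; first exact: lift.
  by have [u [w [? ? ?]]] := lift b a bt aE; exists w, u; rewrite adj_sym.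
- move=> i; apply: node_inj; rewrite [LHS]node_foot; last exact: kept_laminar.
  rewrite node_squash; apply: eq_least => _ /kept_clustersP[E [ET kE ->]].
  by rewrite beyondE // inE.
Qed.

End Squash.

Section Transport.
Import mathcomp.boot.fintype mathcomp.boot.finset.
Local Open Scope set_scope.

Variables (N : nat) (T T' : marked_tree N) (o : 'I_N) (keep : pred {set vert T}).
Variable (f : vert T -> vert T').
Hypothesis cf : contraction keep f.
Implicit Types (u w : vert T) (E : {set vert T}).

Lemma contraction_same u w : adj T u w -> ~~ keep [set u; w] -> f u = f w.
Proof.
case: cf => _ fE _ _ _ uw kE; apply/eqP; rewrite fE; apply: connect1.
by rewrite /= uw.
Qed.

Lemma contraction_fiber u w E : keep E -> f u = f w -> (u \in far o E) = (w \in far o E).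
Proof.
case: cf => _ fE _ _ _ kE /eqP; rewrite fE => uw; apply/esym.
apply: (connect_ind (P := fun x => (x \in far o E) = (u \in far o E))) uw _ => //.
move=> a b /andP[ab kab] <-; apply/esym/far_other => //.
by apply: contraNneq kab => ->.
Qed.

Lemma imset_pair u w : f @: [set u; w] = [set f u; f w].
Proof. by rewrite imsetU !imset_set1. Qed.

(** If two edges had the same image, the vertices of the kept edge [E] would be
    connected through the other edge and contracted ones, avoiding [E]. *)
Lemma contraction_inj E E' : E \in bounded_edges T -> E' \in bounded_edges T ->
  keep E -> f @: E = f @: E' -> E = E'.
Proof.
move=> ET /edgeP[u [w [uw ->]]] kE; have [a [b [ab EE aE bE]]] := edge_cases o ET.
rewrite EE !imset_pair -EE => fE; apply/eqP; apply: contraNT bE => EE'.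
have uwE : (u \in far o E) = (w \in far o E) by apply: far_other; rewrite // eq_sym.
have [[fa fb]|[fa fb]] := set2P_eq fE.
  by rewrite (contraction_fiber kE fb) -uwE -(contraction_fiber kE fa).
by rewrite (contraction_fiber kE fb) uwE -(contraction_fiber kE fa).
Qed.

Lemma contraction_far E u : E \in bounded_edges T -> keep E ->
  (f u \in far o (f @: E)) = (u \in far o E).
Proof.
move=> ET kE; case: (cf) => _ _ fadj _ ff.
suff -> : far o E = [set v | f v \in far o (f @: E)] by rewrite inE.
apply: far_char => //.
- by rewrite inE -ff root_far.
- move=> v w vw EE; rewrite !inE; apply: far_edge_neq; last by rewrite EE imset_pair.
  by apply: fadj; rewrite // -EE.
- move=> v w vw EE; rewrite !inE; have [kvw|kvw] := boolP (keep [set v; w]); last first.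
    by rewrite (contraction_same vw kvw).
  apply: far_other; first exact: fadj.
  rewrite -imset_pair; apply: contra_neq EE => fE.
  by apply: contraction_inj => //; exact: edge_mem.
Qed.

Lemma contraction_far_ends E : E \in bounded_edges T -> keep E ->
  far_ends o (f @: E) = far_ends o E.
Proof.
move=> ET kE; case: (cf) => _ _ _ _ ff.
by apply/setP => i; rewrite !inE ff contraction_far.
Qed.

Lemma contraction_edges :
  bounded_edges T' = [set f @: (E : {set vert T}) | E in [set E in bounded_edges T | keep E]].
Proof.
case: (cf) => _ _ fadj flift _.
apply/setP => E'; apply/edgeP/imsetP => [[a [b [ab ->]]]|[E]]; last first.
  rewrite inE => /andP[/edgeP[u [w [uw ->]]] kE] ->; exists (f u), (f w).
  by rewrite imset_pair; split=> //; apply: fadj.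
have [u [w [fu fw uw]]] := flift _ _ ab.
exists [set u; w]; last by rewrite imset_pair fu fw.
rewrite inE edge_mem //=; apply: contraTT ab => /(contraction_same uw).
by rewrite fu fw => ->; rewrite adj_irr.
Qed.

End Transport.

Section EdgeSums.
Import mathcomp.boot.fintype mathcomp.boot.finset.
Local Open Scope set_scope.
Variables (R : realType) (N : nat).

Definition elen (T : marked_tree N) (l : 'rV[R]_(nbounded T)) (E : {set vert T}) : R :=
  \sum_(e | edge_ends e == E) l 0 e.

Lemma elenE (T : marked_tree N) (l : 'rV[R]_(nbounded T)) e : elen l (edge_ends e) = l 0 e.
Proof. by rewrite /elen (big_pred1 e) // => e'; rewrite (inj_eq enum_val_inj). Qed.

Lemma edge_endsP (T : marked_tree N) (e : 'I_(nbounded T)) : edge_ends e \in bounded_edges T.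
Proof. exact: enum_valP. Qed.

Lemma edge_ends_surj (T : marked_tree N) E : E \in bounded_edges T ->
  exists e : 'I_(nbounded T), edge_ends e = E.
Proof. by move=> ET; exists (enum_rank_in ET E); rewrite /edge_ends enum_rankK_in. Qed.

Lemma edge_family_inj (T : marked_tree N) (o : 'I_N) :
  injective (fun e : 'I_(nbounded T) => far_ends o (edge_ends e)).
Proof.
by move=> e e' /(far_ends_inj (edge_endsP e) (edge_endsP e')); exact: enum_val_inj.
Qed.

Lemma edge_family_image (T : marked_tree N) (o : 'I_N) :
  [set far_ends o (edge_ends e) | e in [set: 'I_(nbounded T)]] = clusters T o.
Proof.
apply/setP => B; apply/imsetP/imsetP => [[e _ ->]|[E ET ->]].
  by exists (edge_ends e) => //; exact: edge_endsP.
by have [e <-] := edge_ends_surj ET; exists e.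
Qed.

Lemma sum_edges (W : lmodType R) (T : marked_tree N) (l : 'rV[R]_(nbounded T))
    (G : {set vert T} -> W) :
  \sum_e l 0 e *: G (edge_ends e) = \sum_(E in bounded_edges T) elen l E *: G E.
Proof. by rewrite [RHS]big_enum_val; apply: eq_bigr => e _; rewrite -elenE. Qed.

(** All coordinates of a curve are sums over its edges, weighted by their
    lengths; contracting edges of length zero does not change such sums. *)
Lemma sum_contraction (W : lmodType R) (T T' : marked_tree N) (o : 'I_N) keep
    (f : vert T -> vert T') (l : 'rV[R]_(nbounded T)) (l' : 'rV[R]_(nbounded T'))
    (G : {set vert T} -> W) (G' : {set vert T'} -> W) :
  contraction keep f ->
  (forall E, E \in bounded_edges T -> keep E -> elen l' (f @: E) = elen l E) ->
  (forall E, E \in bounded_edges T -> ~~ keep E -> elen l E = 0) ->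
  (forall E, E \in bounded_edges T -> keep E -> G' (f @: E) = G E) ->
  \sum_e l' 0 e *: G' (edge_ends e) = \sum_e l 0 e *: G (edge_ends e).
Proof.
move=> cf lE l0 GE; rewrite !sum_edges (contraction_edges cf) big_imset /=; last first.
  move=> E E' /setIdP[ET kE] /setIdP[E'T _].
  exact: (contraction_inj o cf ET E'T kE).
rewrite [RHS](bigID keep) /= [X in _ = _ + X]big1 ?addr0 => [|E /andP[ET kE]].
  rewrite (eq_bigl (fun E => (E \in bounded_edges T) && keep E)) => [|E]; last by rewrite in_set.
  by apply: eq_bigr => E /andP[ET kE]; rewrite lE // GE.
by rewrite l0 // scale0r.
Qed.

Definition cut (A : {set 'I_N}) : pair_space R N :=
  [ffun ij : pair_ix N => (((val ij).1 \in A) != ((val ij).2 \in A))%:R].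

Lemma dist_vecE (T : marked_tree N) (o : 'I_N) (l : 'rV[R]_(nbounded T)) :
  dist_vec l = \sum_e l 0 e *: cut (far_ends o (edge_ends e)).
Proof.
apply/ffunP => ij; rewrite sum_ffunE ffunE big_mkcond /=; apply: eq_bigr => e _.
rewrite !ffunE !inE [RHS]mulr_natr -mulrb; congr (_ *+ nat_of_bool _).
apply/idP/idP => [/asboolP/(on_pathE o)//|h].
exact/asboolP/(on_pathE o).
Qed.

End EdgeSums.

(** * Lattices and dual bases *)

Section Zspan.
Variables (R : realType) (V : vectType R).
Implicit Types (A L : set V).

Lemma zspan_sum (I : finType) A (g : I -> V) (z : I -> int) :
  (forall i, A (g i)) -> zspan A (\sum_i g i *~ z i).
Proof.
move=> Ag; exists #|I|, (fun j => g (enum_val j)), (fun j => z (enum_val j)).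
by split=> //; rewrite (reindex _ (onW_bij _ (@enum_val_bij I))).
Qed.

Lemma zspan_mem A x : A x -> zspan A x.
Proof.
move=> Ax; exists 1%N, (fun=> x), (fun=> 1); split=> //.
by rewrite big_ord1 mulr1z.
Qed.

Lemma zspan0 A : zspan A 0.
Proof.
exists 0%N, (fun=> 0), (fun=> 0); split; first by case.
by rewrite big_ord0.
Qed.

Lemma zspanD A x y : zspan A x -> zspan A y -> zspan A (x + y).
Proof.
move=> [k [g [a [Ag ->]]]] [l [h [b [Ah ->]]]].
pose gh i := match fintype.split i with inl i => g i | inr i => h i end.
pose ab i := match fintype.split i with inl i => a i | inr i => b i end.
exists (k + l)%N, gh, ab; split=> [i|]; first by rewrite /gh; case: fintype.split.
rewrite big_split_ord; congr (_ + _); apply: eq_bigr => i _.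
  by rewrite /gh /ab; case: split_ordP => j; [move/lshift_inj->|move/eqP; rewrite eq_lrshift].
by rewrite /gh /ab; case: split_ordP => j; [move/eqP; rewrite eq_rlshift|move/rshift_inj->].
Qed.

Lemma zspanMz A x z : zspan A x -> zspan A (x *~ z).
Proof.
move=> [k [g [a [Ag ->]]]]; exists k, g, (fun i => a i * z); split=> //.
by rewrite mulrz_suml; apply: eq_bigr => i _; rewrite mulrzA.
Qed.

Lemma zspanB A x y : zspan A x -> zspan A y -> zspan A (x - y).
Proof. by move=> Ax Ay; rewrite -mulrN1z; apply: zspanD => //; apply: zspanMz. Qed.

Lemma zspan_int A (c : 'Hom(V, R^o)) x : (forall y, A y -> c y \is a Num.int) ->
  zspan A x -> c x \is a Num.int.
Proof.
move=> cA [k [g [z [Ag ->]]]]; rewrite linear_sum; apply: rpred_sum => i _.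
by rewrite raddfMz /= rpredMz // cA.
Qed.

(** The dual functionals both prove the independence of the generators and
    detect integrality. *)
Lemma dual_lattice (L : set V) (I : finType) (g : I -> V) (c : I -> 'Hom(V, R^o)) :
  (forall i j, c i (g j) = (i == j)%:R) -> (forall x, x = \sum_i c i x *: g i) ->
  (forall x, L x <-> forall i, c i x \is a Num.int) -> is_lattice L.
Proof.
move=> cg xE LP; pose b := [tuple g (enum_val i) | i < #|I|].
have nb (i : 'I_#|I|) : b`_i = g (enum_val i) by rewrite -tnth_nth tnth_mktuple.
have gb i : g i \in val b.
  by apply/tnthP; exists (enum_rank i); rewrite tnth_mktuple enum_rankK.
have b_free : free b.
  apply/freeP => k k0 j; have := congr1 (c (enum_val j)) k0.
  rewrite linear_sum linear0 (bigD1 j) //= big1 => [|i ij].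
    by rewrite addr0 linearZ /= nb cg eqxx => h; rewrite -[LHS]mulr1; exact: h.
  rewrite linearZ /= nb cg (inj_eq enum_val_inj) eq_sym (negPf ij).
  exact: mulr0.
have b_span : (fullv <= <<b>>)%VS.
  apply/subvP => x _; rewrite [x]xE; apply: memv_suml => i _; apply/memvZ/memv_span.
  exact: gb.
have b_basis : basis_of fullv b.
  by rewrite basisEfree b_free subvf (leq_trans (dimvS b_span)) // dim_span.
have sb : size b == \dim {:V} by rewrite (size_basis b_basis) size_tuple.
exists (Tuple sb) => //; apply/seteqP; split=> x.
  move=> /LP cx; have [z zE] := choice (fun i => elimT (@intrP R (c i x)) (cx i)).
  rewrite [x]xE (eq_bigr (fun i => g i *~ z i)) => [|i _].
    by apply: zspan_sum => i; exact: gb.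
  by rewrite zE scaler_int.
move=> xb; apply/LP => i; apply: zspan_int xb => y yb.
have /tnthP[j ->] : y \in b by [].
by rewrite tnth_mktuple cg; case: (_ == _).
Qed.

End Zspan.

(** * Coordinates on the quotient space *)

Section QN.
Variables (R : realType) (N : nat) (o : 'I_N).
Hypothesis hN : (2 < N)%N.
Local Notation P := (pair_space R N).
Local Notation Q := (QN R N).
Implicit Types (x : P) (z : Q) (i j k l : 'I_N) (s : pair_ix N) (A : {set 'I_N}).

(** The entry at an unordered pair: at most one of the two orderings is
    increasing. *)
Definition entry_fun i j x : R^o :=
  if insub (i, j) is Some s then x s else if insub (j, i) is Some s then x s else 0.

Fact entry_is_linear i j : linear (entry_fun i j).
Proof.
move=> a x y; rewrite /entry_fun; case: insub => [s|]; first by rewrite !ffunE.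
by case: insub => [s|]; rewrite ?ffunE // scaler0 addr0.
Qed.
HB.instance Definition _ i j :=
  GRing.isLinear.Build R P R^o *:%R (entry_fun i j) (entry_is_linear i j).

Definition entry i j : 'Hom(P, R^o) := linfun (entry_fun i j).

Lemma entry_val x s : entry (val s).1 (val s).2 x = x s.
Proof. by rewrite lfunE /= /entry_fun -surjective_pairing valK. Qed.

Lemma entryC x i j : entry i j x = entry j i x.
Proof.
rewrite !lfunE /= /entry_fun; case: insubP => [s /= ij _|_]; case: insubP => [t /= ji _|_] //.
by have := ltn_trans ij ji; rewrite ltnn.
Qed.

Lemma pair_of i j : i != j -> exists s : pair_ix N, val s = (i, j) \/ val s = (j, i).
Proof.
rewrite neq_ltn => /orP[ij|ji].
  by exists (exist _ (i, j) ij : pair_ix N); left.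
by exists (exist _ (j, i) ji : pair_ix N); right.
Qed.

Lemma entry_Phi (a : 'rV[R]_N) i j : i != j -> entry i j (Phi a) = a 0 i + a 0 j.
Proof.
move=> /pair_of[s sE]; have := entry_val (Phi a) s; rewrite ffunE.
by case: sE => -> //= E; rewrite entryC E addrC.
Qed.

Lemma entry_cut A i j : i != j -> entry i j (cut R A) = ((i \in A) != (j \in A))%:R.
Proof.
move=> /pair_of[s sE]; have := entry_val (cut R A) s; rewrite ffunE.
by case: sE => -> //= E; rewrite entryC E eq_sym.
Qed.

(** For the distance vector of a tree this is the length that the paths from
    [o] to [i] and from [o] to [j] have in common. *)
Definition gromov i j : 'Hom(P, R^o) := 2^-1 *: (entry i o + entry j o - entry i j).

Lemma gromovE i j x : gromov i j x = 2^-1 * (entry i o x + entry j o x - entry i j x).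
Proof. by rewrite /gromov !lfun_simp. Qed.

Lemma half_add (y : R) : 2^-1 * (y + y) = y.
Proof. by rewrite -mulr2n -[y *+ 2]mulr_natl mulKf // pnatr_eq0. Qed.

Lemma gromov_Phi (a : 'rV[R]_N) i j : i != o -> j != o -> i != j ->
  gromov i j (Phi a) = a 0 o.
Proof.
move=> io jo ij; rewrite gromovE !entry_Phi // addrACA [a 0 i + a 0 j + _]addrC addrK.
exact: half_add.
Qed.

Lemma gromov_cut A i j : o \notin A -> i != o -> j != o -> i != j ->
  gromov i j (cut R A) = ((i \in A) && (j \in A))%:R.
Proof.
move=> oA io jo ij; rewrite gromovE !entry_cut // (negPf oA).
case: (i \in A); case: (j \in A) => /=; rewrite ?subr0 ?addr0 ?add0r ?subrr ?mulr0 //.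
exact: half_add.
Qed.

Definition lift_QN : 'Hom(Q, P) := linfun (vsval : subvs_of _ -> P).

Lemma qN_lift z : qN (lift_QN z) = z.
Proof.
rewrite lfunE; have [x <-] := quot_proj_surj z.
apply/eqP; rewrite -subr_eq0 -linearB quot_proj_eq0 [X in X - _](quot_projE _ x).
by rewrite addrC addrA addNr sub0r memvN memv_proj.
Qed.

Lemma lift_qN x : lift_QN (qN x) - x \in limg (linfun (@Phi R N)).
Proof. by rewrite -quot_proj_eq0 linearB subr_eq0; apply/eqP; exact: (qN_lift (qN x)). Qed.

(** On the image of [Phi] all Gromov products are equal, so their differences
    are well defined on the quotient. *)
Definition cross i j k l : 'Hom(Q, R^o) := ((gromov i j - gromov k l) \o lift_QN)%VF.

Lemma cross_qN i j k l x : i != o -> j != o -> i != j -> k != o -> l != o -> k != l ->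
  cross i j k l (qN x) = gromov i j x - gromov k l x.
Proof.
move=> io jo ij ko lo kl; rewrite comp_lfunE.
have [a _ aE] := memv_imgP (lift_qN x).
have -> : lift_QN (qN x) = x + Phi a.
  by apply/eqP; rewrite addrC -subr_eq aE lfunE.
by rewrite add_lfunE opp_lfunE ![gromov _ _ (_ + _)]linearD /= !gromov_Phi // opprD addrACA subrr addr0.
Qed.

(** If all Gromov products equal [c], then [x i j = (x i o - c) + (x j o - c)],
    which exhibits [x] as an element of the image of [Phi]. *)
Lemma cross_eq0 s0 z : (val s0).1 != o -> (val s0).2 != o ->
  (forall s, (val s).1 != o -> (val s).2 != o ->
     cross (val s).1 (val s).2 (val s0).1 (val s0).2 z = 0) -> z = 0.
Proof.
move=> s1 s2 h; set x := lift_QN z; set c := gromov (val s0).1 (val s0).2 x.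
have gE s : (val s).1 != o -> (val s).2 != o -> gromov (val s).1 (val s).2 x = c.
  move=> /h /[apply]; rewrite comp_lfunE add_lfunE opp_lfunE => /eqP.
  by rewrite subr_eq0 => /eqP.
pose a : 'rV[R]_N := \row_i (if i == o then c else entry i o x - c).
rewrite -(qN_lift z) -/x; apply/eqP; rewrite quot_proj_eq0.
suff -> : x = linfun (@Phi R N) a by rewrite memv_img ?memvf.
apply/ffunP => s; rewrite lfunE !ffunE !mxE.
have s12 : (val s).1 != (val s).2 by have := valP s; rewrite neq_ltn => ->.
have [s1o|s1o] := eqVneq (val s).1 o; have [s2o|s2o] := eqVneq (val s).2 o.
- by rewrite s1o s2o eqxx in s12.
- by rewrite addrC subrK -entry_val s1o entryC.
- by rewrite subrK -entry_val s2o.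
- have := gE s s1o s2o; rewrite gromovE entry_val => <-.
  by rewrite addrACA -opprD -mulrDr half_add opprB addrC subrK.
Qed.

Definition cut_class A : Q := qN (cut R A).
Local Notation v := cut_class.

Lemma cross_cut_class A i j k l : o \notin A -> i != o -> j != o -> i != j ->
  k != o -> l != o -> k != l ->
  cross i j k l (v A) = ((i \in A) && (j \in A))%:R - ((k \in A) && (l \in A))%:R.
Proof. by move=> *; rewrite cross_qN // !gromov_cut. Qed.

Lemma cut_setC A : cut R (~: A)%SET = cut R A.
Proof. by apply/ffunP => s; rewrite !ffunE !inE; do 2 case: (_ \in A). Qed.

Definition is_cluster A : bool := (A \proper nonroot o) && (1 < #|A|)%N.

Lemma ord2_cases (u : 'I_2) : u = ord0 \/ u = ord_max.
Proof. by case: u => -[|[|]] // i; [left|right]; apply: val_inj. Qed.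

Lemma vIE (I : {set 'I_N}) (hI : (1 < #|I| < N.-1)%N) : @vI R N I hI = v I.
Proof.
rewrite /vI phiN_class (dist_vecE o) /=; congr qN.
rewrite (sum_edges _ (fun E => cut R (far_ends o E))).
pose E0 : {set 'I_2} := [set ord0; ord_max]%SET.
have a01 : adj (split_tree hI) ord0 ord_max by [].
have E0T : E0 \in bounded_edges (split_tree hI) by apply: edge_mem.
have -> : bounded_edges (split_tree hI) = [set E0]%SET.
  apply/finset.setP => E; rewrite finset.in_set1; apply/idP/eqP => [/edgeP[u [w [uw ->]]]|-> //].
  case: (ord2_cases u) uw => ->; case: (ord2_cases w) => -> // _.
  by rewrite finset.setUC.
rewrite big_set1 (_ : elen _ _ = 1) ?scale1r; last first.
  by have [e <-] := edge_ends_surj E0T; rewrite elenE mxE.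
have far_side (u : 'I_2) : u != foot (split_tree hI) o -> far (T := split_tree hI) o E0 = [set u]%SET.
  move=> uo; apply: far_char => // [|a b ab _|a b ab].
  - by rewrite finset.in_set1 eq_sym.
  - rewrite !finset.in_set1; move: ab; case: (ord2_cases u) => ->.
      by case: (ord2_cases a) => ->; case: (ord2_cases b) => ->.
    by case: (ord2_cases a) => ->; case: (ord2_cases b) => ->.
  - case: (ord2_cases a) ab => ->; case: (ord2_cases b) => -> //= _.
      by rewrite eqxx.
    by rewrite finset.setUC eqxx.
have [oI|oI] := boolP (o \in I).
  rewrite -cut_setC; congr cut; apply/finset.setP => i; rewrite !finset.in_set (far_side ord_max) /= ?oI //.
  by rewrite finset.in_set1; case: (i \in I).
congr cut; apply/finset.setP => i; rewrite !finset.in_set (far_side ord0) /= ?(negPf oI) //.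
by rewrite finset.in_set1; case: (i \in I).
Qed.

Lemma card_nonroot_ord : #|nonroot o| = N.-1.
Proof. by rewrite card_nonroot card_ord. Qed.

Lemma LambdaNE : @LambdaN R N = zspan [set v A | A in is_cluster].
Proof.
congr zspan; apply/seteqP; split=> z.
  move=> [I [hI ->]]; rewrite vIE; have /andP[I1 I2] := hI.
  have [oI|oI] := boolP (o \in I); last first.
    exists I => //; apply/andP; split=> //; rewrite properEcard.
    rewrite card_nonroot_ord I2 andbT; apply/fintype.subsetP => i iI.
    by rewrite !inE; apply: contraNneq oI => <-.
  exists (~: I)%SET; last by rewrite /v cut_setC.
  have cI : (#|I| + #|~: I| = N)%N by rewrite cardsC card_ord.
  apply/andP; split; last by lia.
  rewrite properEcard card_nonroot_ord; apply/andP; split; last by lia.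
  by apply/fintype.subsetP => i; rewrite !inE; apply: contraNneq => ->.
move=> [A /andP[Ao A1] <-].
have hA : (1 < #|A| < N.-1)%N by rewrite A1 -card_nonroot_ord proper_card.
by exists A, hA; rewrite vIE.
Qed.

Lemma base_pair : exists s0 : pair_ix N, (val s0).1 != o /\ (val s0).2 != o.
Proof.
have : (1 < #|nonroot o|)%N by rewrite card_nonroot_ord; move: hN; lia.
move=> /card_gt1P[i [j [io jo ij]]]; rewrite !inE in io jo.
by have [s [] sE] := pair_of ij; exists s; rewrite sE.
Qed.

Definition pair_set s : {set 'I_N} := [set (val s).1; (val s).2]%SET.

Lemma pair_set_sub s s' :
  ((val s).1 \in pair_set s') && ((val s).2 \in pair_set s') = (s == s').
Proof.
rewrite !inE; apply/andP/eqP => [[]|->]; last by rewrite !eqxx orbT.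
have s12 := valP s; have s'12 := valP s'.
move=> /orP[/eqP a|/eqP a] /orP[/eqP b|/eqP b].
- by move: s12; rewrite a b ltnn.
- by apply: val_inj; rewrite [val s]surjective_pairing a b -surjective_pairing.
- by move: s12; rewrite a b ltnNge ltnW.
- by move: s12; rewrite a b ltnn.
Qed.

Lemma val_neq s : (val s).1 != (val s).2.
Proof. by have := valP s; rewrite neq_ltn => ->. Qed.

(** The Gromov product of [i] and [j] on the cut of a two-element set is 1 if the
    set is [{i, j}] and 0 otherwise.  Subtracting the product of a fixed pair
    makes it well defined on the quotient, and that pair has to be omitted. *)
Lemma QN_dual_basis : exists (I : finType) (A : I -> {set 'I_N}) (c : I -> 'Hom(Q, R^o)),
  [/\ forall a, is_cluster (A a), forall a b, c a (v (A b)) = (a == b)%:R,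
      forall z, z = \sum_a c a z *: v (A a)
    & forall a B, is_cluster B -> c a (v B) \is a Num.int].
Proof.
have [s0 [s01 s02]] := base_pair.
pose ok s := [&& (val s).1 != o, (val s).2 != o & s != s0].
pose I : finType := {s : pair_ix N | ok s}.
pose c s := cross (val s).1 (val s).2 (val s0).1 (val s0).2.
have oP s : (val s).1 != o -> (val s).2 != o -> o \notin pair_set s.
  by move=> s1 s2; rewrite !inE !(eq_sym o) negb_or s1.
have cv s s' : ok s' -> (val s).1 != o -> (val s).2 != o -> c s (v (pair_set s')) = (s == s')%:R.
  move=> /and3P[s'1 s'2 s'0] s1 s2.
  rewrite cross_cut_class ?val_neq ?oP // !pair_set_sub [s0 == _]eq_sym (negPf s'0).
  exact: subr0.
exists I, (fun a => pair_set (val a)), (fun a => c (val a)); split.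
- move=> [s /= /and3P[s1 s2 ss0]]; rewrite /is_cluster cards2 val_neq andbT.
  rewrite finset.properEneq; apply/andP; split; last first.
    by apply/fintype.subsetP => i; rewrite !inE => /orP[]/eqP->.
  apply: contra ss0 => /eqP sE; rewrite eq_sym -pair_set_sub sE.
  by rewrite !inE s01.
- move=> [s sok] [s' s'ok] /=; rewrite cv //; first by case/and3P: sok.
  by case/and3P: sok.
- move=> z; apply/eqP; rewrite -subr_eq0; apply/eqP.
  apply: (cross_eq0 s01 s02) => s s1 s2; rewrite -/(c s) linearB linear_sum /=.
  apply/eqP; rewrite subr_eq0; apply/eqP.
  have [->|ss0] := eqVneq s s0.
    rewrite big1 /c => [|i _]; first by rewrite /cross subrr comp_lfunE zero_lfunE.
    by rewrite /cross subrr comp_lfunE zero_lfunE.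
  have sok : ok s by rewrite /ok s1 s2.
  rewrite (bigD1 (exist _ s sok : I)) //= big1 => [|[s' s'ok] /= ss'].
    by rewrite addr0 linearZ /= cv // eqxx; exact/esym/mulr1.
  rewrite linearZ /= cv //; have -> : (s == s') = false.
    by apply: contraNF ss' => /eqP E; apply/eqP/val_inj; rewrite /= E.
  exact: mulr0.
- move=> [s /= /and3P[s1 s2 _]] B /andP[/proper_sub/fintype.subsetP Bo _].
  have oB : o \notin B by apply/negP => /Bo; rewrite !inE eqxx.
  by rewrite cross_cut_class ?val_neq //; apply: rpredB; apply: rpred_nat.
Qed.

Lemma cluster_notin A : is_cluster A -> o \notin A.
Proof. by case/andP => /proper_sub/fintype.subsetP Ao _; apply/negP => /Ao; rewrite !inE eqxx. Qed.

Lemma laminar_cluster F A : laminar o F -> A \in F -> is_cluster A.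
Proof. by move=> /laminarP[F1 F2 _] AF; rewrite /is_cluster F1 ?F2. Qed.

Lemma cut_class_LambdaN A : is_cluster A -> @LambdaN R N (v A).
Proof. by move=> cA; rewrite LambdaNE; apply: zspan_mem; exists A. Qed.

(** The length of one edge of a tree is an integral linear function on the
    quotient. *)
Lemma cluster_dual F A : laminar o F -> A \in F -> exists c : 'Hom(Q, R^o),
  {in F, forall B, c (v B) = (B == A)%:R} /\
  (forall z, @LambdaN R N z -> c z \is a Num.int).
Proof.
move=> lF AF; have [i [j [k [+ + + /andP[ij ik] dB]]]] := dual_pairs lF AF.
rewrite !inE => io jo ko; exists (cross i j i k); split=> [B BF|z].
  rewrite cross_cut_class // ?(cluster_notin (laminar_cluster lF BF)) //.
  by rewrite dB // natrD addrC addKr.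
rewrite LambdaNE; apply: zspan_int => _ [B cB <-].
rewrite cross_cut_class ?cluster_notin //.
by apply: rpredB; apply: rpred_nat.
Qed.

Lemma cross_sum F (w : {set 'I_N} -> R) i j k : laminar o F ->
  i \in nonroot o -> j \in nonroot o -> k \in nonroot o -> i != j -> i != k ->
  cross i j i k (\sum_(A in F) w A *: v A) = depth F w i j - depth F w i k.
Proof.
move=> lF; rewrite !inE => io jo ko ij ik; rewrite linear_sum.
rewrite /depth big_mkcondr [X in _ - X]big_mkcondr -sumrB; apply: eq_bigr => A AF.
rewrite linearZ /= cross_cut_class // ?(cluster_notin (laminar_cluster lF AF)) //.
rewrite scalerBr; congr (_ - _); case: (_ && _); by [exact: mulr1|exact: mulr0].
Qed.

Lemma cut_class_determines F F' (w w' : {set 'I_N} -> R) : laminar o F -> laminar o F' ->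
  {in F, forall B, 0 < w B} -> {in F', forall B, 0 < w' B} ->
  \sum_(A in F) w A *: v A = \sum_(A in F') w' A *: v A ->
  F = F' /\ {in F, w =1 w'}.
Proof.
move=> lF lF' w0 w0' E; apply: (depth_determines lF lF') => // i j k *.
by rewrite -!cross_sum // E.
Qed.

Lemma cross_ext z z' :
  (forall i j k l, i != o -> j != o -> i != j -> k != o -> l != o -> k != l ->
    cross i j k l z = cross i j k l z') -> z = z'.
Proof.
move=> h; have [s0 [s01 s02]] := base_pair; apply/eqP; rewrite -subr_eq0; apply/eqP.
apply: (cross_eq0 s01 s02) => s s1 s2.
by rewrite linearB /= h ?subrr ?val_neq.
Qed.

Lemma cut_class_nonroot : v (nonroot o) = 0.
Proof.
apply: cross_ext => i j k l io jo ij ko lo kl; rewrite linear0 cross_cut_class // ?inE ?eqxx //.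
by rewrite io jo ko lo; exact: subrr.
Qed.

Lemma cut_class_set1 i : i != o -> v [set i]%SET = 0.
Proof.
move=> io; apply: cross_ext => i' j k l io' jo ij ko lo kl.
have oi : o \notin [set i]%SET by rewrite inE eq_sym.
rewrite linear0 cross_cut_class // !inE.
have two (a b : 'I_N) : a != b -> (a == i) && (b == i) = false.
  by move=> ab; apply/negP => /andP[/eqP ai /eqP bi]; rewrite ai bi eqxx in ab.
by rewrite !two //; exact: subrr.
Qed.

(** The relation behind balancing: [merge_pairs] in terms of Gromov products. *)
Lemma cut_class_merge F A (B1 B2 B3 : {set 'I_N}) : laminar o F ->
  A \in nonroot o |: F -> children o F A = [set B1; B2; B3]%SET ->
  [&& B1 != B2, B1 != B3 & B2 != B3] ->
  v (B1 :|: B2) + v (B1 :|: B3) + v (B2 :|: B3) = v A + v B1 + v B2 + v B3.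
Proof.
move=> lF AF chE b123; have hX : (2 < #|'I_N|)%N by rewrite card_ord.
have [c1 c2 c3] : [/\ B1 \in children o F A, B2 \in children o F A & B3 \in children o F A].
  by rewrite chE !inE !eqxx ?orbT.
have oN B : B \in nonroot o |: F -> o \notin B.
  by move=> /finset.setU1P[->|/(laminar_cluster lF)/cluster_notin//]; rewrite !inE eqxx.
have oC B : B \in children o F A -> o \notin B.
  move=> cB; have [_ /proper_sub/fintype.subsetP s _] := childP lF hX cB.
  by apply: contra (oN _ AF); exact: s.
apply: cross_ext => i j k l io jo ij ko lo kl; rewrite !linearD /=.
have oU (B B' : {set 'I_N}) : o \notin B -> o \notin B' -> o \notin B :|: B'.
  by rewrite inE negb_or => -> ->.
rewrite !cross_cut_class ?oU ?(oC _ c1) ?(oC _ c2) ?(oC _ c3) ?(oN _ AF) //.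
have e a b : a != b -> ((a \in B1 :|: B2) && (b \in B1 :|: B2))%:R +
     ((a \in B1 :|: B3) && (b \in B1 :|: B3))%:R +
     ((a \in B2 :|: B3) && (b \in B2 :|: B3))%:R =
     ((a \in A) && (b \in A))%:R + ((a \in B1) && (b \in B1))%:R +
     ((a \in B2) && (b \in B2))%:R + ((a \in B3) && (b \in B3))%:R :> R.
  by move=> ab; rewrite -!natrD (merge_pairs hX lF AF chE b123 ab).
have addB (a b c d : R) : a - b + (c - d) = a + c - (b + d) by rewrite opprD addrACA.
by rewrite !addB !e.
Qed.

End QN.

(** * Simplicial cones with lineality *)

Section Lin.
Variables (R : realType) (V : vectType R).

Lemma lin_eq (s : set V) (U : {vspace V}) : s `<=` [set` U] ->
  (forall W : {vspace V}, s `<=` [set` W] -> (U <= W)%VS) -> lin s = U.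
Proof.
move=> sU minU; rewrite /lin.
set P := [set W | _]; have PU : P U by split.
have [sl minl] := xgetI 0%VS PU.
by apply/eqP; rewrite eqEsubv minl // minU.
Qed.

Lemma rational_cone_fin (L : set V) (I : finType) (g : I -> V) : (forall i, L (g i)) ->
  rational_cone L [set x | exists2 a : I -> R, (forall i, 0 <= a i) & x = \sum_i a i *: g i].
Proof.
move=> Lg; exists #|I|, (fun e => g (enum_val e)); split=> //.
apply/seteqP; split=> x [a a0 ->].
  exists (fun e => a (enum_val e)) => //.
  by rewrite (reindex _ (onW_bij _ (@enum_val_bij I))).
exists (fun i => a (enum_rank i)) => //.
rewrite [RHS](reindex _ (onW_bij _ (@enum_val_bij I))) /=.
by apply: eq_bigr => e _; rewrite enum_valK.
Qed.

End Lin.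

(** A simplicial cone plus a linear space is the image of an orthant times a
    linear space under an injective linear map. *)
Section SimplicialCone.
Variables (R : realType) (k r : nat) (V : vectType R).
Local Notation D := ('rV[R]_k * 'rV[R]_r)%type.
Variable L : 'Hom(D, V).
Hypothesis L0 : lker L = 0%VS.
Implicit Types (y : D) (Z : pred 'I_k).

Let Linj : injective L.
Proof. by apply/lker0P; rewrite L0. Qed.

Definition orthant_face Z : set D :=
  [set y : D | (forall e, 0 <= y.1 0 e) /\ (forall e, Z e -> y.1 0 e = 0)].

Definition simplicial_cone : set V := L @` [set y : D | forall e, 0 <= y.1 0 e].

Definition unit_edge (e : 'I_k) : D := (delta_mx 0 e, 0).

Lemma unit_edge_ge0 e : forall e', 0 <= (unit_edge e).1 0 e'.
Proof. by move=> e'; rewrite mxE /=; case: (_ == _). Qed.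

Lemma orthant_sum (u : 'Hom(D, R^o)) y : u (0, y.2) = 0 ->
  u y = \sum_e y.1 0 e * u (unit_edge e).
Proof.
move=> u2; have -> : y = (y.1, 0) + (0, y.2).
  by case: y {u2} => y1 y2; apply/pair_eqP; rewrite /= addr0 add0r !eqxx.
rewrite linearD /= u2 addr0.
pose inl (a : 'rV[R]_k) : D := (a, 0).
have inl_lin : linear inl.
  by move=> a x x'; apply/pair_eqP; rewrite /= scaler0 addr0 !eqxx.
pose il : {linear 'rV[R]_k -> D} := HB.pack inl (GRing.isLinear.Build R 'rV[R]_k D *:%R inl inl_lin).
rewrite addr0 -[(y.1, 0)]/(il y.1) {1}[y.1]row_sum_delta !linear_sum.
by apply: eq_bigr => e _; rewrite !linearZ.
Qed.

(** A functional that is nonnegative on the cone vanishes on the lineality space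
    and has nonnegative coefficients on the generators; the face consists of
    the points that do not involve the generators with positive coefficient. *)
Lemma faceP t : face simplicial_cone t <-> exists Z, t = L @` orthant_face Z.
Proof.
split=> [[u [u0 ->]]|[Z ->]].
  have u2 p : u (L (0, p)) = 0.
    have pos q : 0 <= u (L (0, q)).
      by apply: u0; exists (0, q) => // e; rewrite /= mxE.
    apply/eqP; rewrite eq_le pos andbT -oppr_ge0 -!linearN /=.
    have -> : - ((0, p) : D) = (0, - p) by apply/pair_eqP; rewrite /= oppr0 !eqxx.
    exact: pos.
  pose c e := u (L (unit_edge e)).
  have c0 e : 0 <= c e by apply: u0; exists (unit_edge e) => //; apply: unit_edge_ge0.
  have uE y : u (L y) = \sum_e y.1 0 e * c e.
    rewrite -comp_lfunE orthant_sum; last by rewrite comp_lfunE u2.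
    by apply: eq_bigr => e _; rewrite comp_lfunE.
  exists (fun e => c e != 0); apply/seteqP; split=> x.
    move=> [[y y0 <-]] /=; rewrite uE => /eqP.
    rewrite psumr_eq0 => [/allP h|e _]; last by rewrite mulr_ge0.
    exists y => //; split=> // e ce; have := h e (mem_index_enum _).
    by rewrite mulf_eq0 (negPf ce) orbF => /eqP.
  move=> [y [y0 yZ] <-]; split; first by exists y.
  rewrite /= uE big1 // => e _; have [->|/yZ ->] := eqVneq (c e) 0; first by rewrite mulr0.
  by rewrite mul0r.
pose f (y : D) : R^o := \sum_(e | Z e) y.1 0 e.
have f_lin : linear f.
  move=> a x x'; rewrite /f scaler_sumr -big_split /=.
  by apply: eq_bigr => e _; rewrite !mxE.
pose fl : {linear D -> R^o} := HB.pack f (GRing.isLinear.Build R D R^o *:%R f f_lin).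
exists (linfun fl \o L^-1)%VF; have LK : cancel L (L^-1)%VF.
  by apply: lker0_lfunK; rewrite L0.
have uE y : (linfun fl \o L^-1)%VF (L y) = f y by rewrite comp_lfunE LK lfunE.
split=> [x [y y0 <-]|]; first by rewrite uE; apply: sumr_ge0.
apply/seteqP; split=> x.
  move=> [y [y0 yZ] <-]; split; first by exists y.
  by rewrite /= uE /f big1.
move=> [[y y0 <-]] /=; rewrite uE => /eqP; rewrite psumr_eq0 // => /allP h.
exists y => //; split=> // e Ze; have := h e (mem_index_enum _).
by rewrite Ze => /eqP.
Qed.

Lemma relint_simplicial :
  relint simplicial_cone = L @` [set y : D | forall e, 0 < y.1 0 e].
Proof.
apply/seteqP; split=> x.
  move=> [[y y0 <-] h]; exists y => // e; rewrite lt_neqAle y0 andbT eq_sym.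
  apply/negP => /eqP ye.
  have ft : face simplicial_cone (L @` orthant_face (pred1 e)) by apply/faceP; exists (pred1 e).
  have /(h _ ft) tE : (L @` orthant_face (pred1 e)) (L y).
    by exists y => //; split=> // e' /eqP->.
  have : simplicial_cone (L (unit_edge e)).
    by exists (unit_edge e) => //; apply: unit_edge_ge0.
  rewrite -tE => -[y' [_ y'Z] /Linj yE]; have := y'Z e (eqxx e).
  by rewrite yE mxE !eqxx => /eqP; rewrite oner_eq0.
move=> [y y0 <-]; split; first by exists y => // e; apply/ltW.
move=> t /faceP[Z ->] [y' [_ y'Z] /Linj yE]; subst y'.
have Z0 e : Z e = false by apply/negP => /y'Z ye; have := y0 e; rewrite ye ltxx.
by congr (L @` _); apply/seteqP; split=> z; [case|split=> // e; rewrite Z0].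
Qed.

Lemma lin_simplicial : lin simplicial_cone = limg L.
Proof.
apply: lin_eq => [_ [y _ <-]|W sW]; first by rewrite /= memv_img ?memvf.
apply/subvP => _ /memv_imgP[y _ ->].
(* [y] is the difference of [y + |y|] and [|y|]. *)
pose b : D := (map_mx (fun a => `|a|) y.1, 0).
have -> : y = (y + b) - b by rewrite addrK.
rewrite linearB; apply: rpredB; apply: sW.
  exists (y + b) => // e; rewrite /= !mxE -lerBlDl sub0r.
  by rewrite ler_normr lexx orbT.
by exists b => // e; rewrite /= mxE.
Qed.

Lemma dim_simplicial : cone_dim simplicial_cone = (k + r)%N.
Proof.
rewrite /cone_dim lin_simplicial limg_dim_eq ?L0 ?capv0 // dimvf /dim /=.
by congr (_ + _)%N; rewrite -[RHS]mul1n; exact: dim_matrix.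
Qed.

End SimplicialCone.

(** * Continuity of linear maps *)

Section Topology.
Variables (R : realType) (N k r : nat).
Local Notation D := ('rV[R]_k * 'rV[R]_r)%type.
Local Notation Q := (QN R N).
Local Notation QW := (Q * 'rV[R]_r)%type.

Lemma lincomb_continuous (X : topologicalType) (I : finType) (a : I -> R)
    (f : I -> X -> R) :
  (forall i, continuous (f i)) -> continuous (fun x => \sum_i f i x * a i).
Proof.
move=> cf; apply: (@continuous_big R _ +%R 0 xpredT) => [|i _]; first exact: add_continuous.
by move=> x; apply: (@continuousM _ _ (f i) (fun=> a i)); [exact: cf | exact: cst_continuous].
Qed.

Lemma rV_continuous (X : topologicalType) m (f : X -> 'rV[R]_m) :
  (forall j, continuous (fun x => f x 0 j)) -> continuous f.
Proof.
move=> cf x A [P Pf sPA].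
have Px : \forall y \near x, forall ij : 'I_1 * 'I_m, P ij.1 ij.2 (f y ij.1 ij.2).
  apply: filter_forall => -[i j] /=; have -> : i = 0 := ord1 i.
  exact: cf (Pf 0 j).
by apply: filterS Px => y Py; apply: sPA => i j; exact: (Py (i, j)).
Qed.

Lemma fst_coord_continuous (X : topologicalType) e :
  continuous (fun y : 'rV[R]_k * X => y.1 0 e).
Proof.
move=> y; apply: (@continuous_comp _ _ _ fst (fun M : 'rV[R]_k => M 0 e)).
  exact: cvg_fst.
exact: coord_continuous.
Qed.

Lemma snd_coord_continuous (X : topologicalType) j :
  continuous (fun y : X * 'rV[R]_r => y.2 0 j).
Proof.
move=> y; apply: (@continuous_comp _ _ _ snd (fun M : 'rV[R]_r => M 0 j)).
  exact: cvg_snd.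
exact: coord_continuous.
Qed.

Lemma QN_coord_continuous i : continuous (fun z : Q => quotv_coord z 0 i : R).
Proof.
move=> z; apply: (@continuous_comp _ _ _ (@quotv_coord R _ _ : Q -> _) (fun M => M 0 i)).
  exact: initial_continuous.
exact: coord_continuous.
Qed.

Lemma functional_continuous_D (u : 'Hom(D, R^o)) : continuous (u : D -> R).
Proof.
pose inl (a : 'rV[R]_k) : D := (a, 0); pose inr (a : 'rV[R]_r) : D := (0, a).
have inl_lin : linear inl.
  by move=> a x x'; apply/pair_eqP; rewrite /= scaler0 addr0 !eqxx.
have inr_lin : linear inr.
  by move=> a x x'; apply/pair_eqP; rewrite /= scaler0 addr0 !eqxx.
pose il : {linear _ -> D} := HB.pack inl (GRing.isLinear.Build R _ D *:%R inl inl_lin).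
pose ir : {linear _ -> D} := HB.pack inr (GRing.isLinear.Build R _ D *:%R inr inr_lin).
have -> : (u : D -> R) = fun y =>
    (\sum_e y.1 0 e * u (il (delta_mx 0 e))) + (\sum_j y.2 0 j * u (ir (delta_mx 0 j))).
  apply/funext => y; have {1}-> : y = il y.1 + ir y.2.
    by case: y => a b; apply/pair_eqP; rewrite /= addr0 add0r !eqxx.
  rewrite linearD {1}[y.1]row_sum_delta {1}[y.2]row_sum_delta !linear_sum.
  by congr (_ + _); apply: eq_bigr => e _; rewrite !linearZ.
move=> y; apply: (@continuousD _ R).
  by apply: lincomb_continuous => e; exact: fst_coord_continuous.
by apply: lincomb_continuous => e; exact: snd_coord_continuous.
Qed.

Lemma functional_continuous_QW (u : 'Hom(QW, R^o)) : continuous (u : QW -> R).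
Proof.
pose inl (a : Q) : QW := (a, 0); pose inr (a : 'rV[R]_r) : QW := (0, a).
have inl_lin : linear inl.
  by move=> a x x'; apply/pair_eqP; rewrite /= scaler0 addr0 !eqxx.
have inr_lin : linear inr.
  by move=> a x x'; apply/pair_eqP; rewrite /= scaler0 addr0 !eqxx.
pose il : {linear _ -> QW} := HB.pack inl (GRing.isLinear.Build R _ QW *:%R inl inl_lin).
pose ir : {linear _ -> QW} := HB.pack inr (GRing.isLinear.Build R _ QW *:%R inr inr_lin).
have -> : (u : QW -> R) = fun z => (\sum_i quotv_coord z.1 0 i * u (il (vbasis {: Q})`_i)) +
    (\sum_j z.2 0 j * u (ir (delta_mx 0 j))).
  apply/funext => z; have {1}-> : z = il z.1 + ir z.2.
    by case: z => a b; apply/pair_eqP; rewrite /= addr0 add0r !eqxx.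
  rewrite linearD {1}[z.2]row_sum_delta {1}(coord_vbasis (memvf z.1)) !linear_sum.
  congr (_ + _); apply: eq_bigr => e _; rewrite !linearZ //.
  by rewrite /quotv_coord mxE.
move=> y; apply: (@continuousD _ R).
  apply: lincomb_continuous => e z.
  apply: (@continuous_comp _ _ _ fst (fun z => quotv_coord z 0 e : R)); first exact: cvg_fst.
  exact: QN_coord_continuous.
by apply: lincomb_continuous => e; exact: snd_coord_continuous.
Qed.

Lemma continuous_into_D (X : topologicalType) (f : X -> D) :
  (forall u : 'Hom(D, R^o), continuous (fun x => u (f x) : R)) -> continuous f.
Proof.
move=> cf; have f1 : continuous (fun x => (f x).1).
  apply: rV_continuous => e; pose g (y : D) : R^o := y.1 0 e.
  have g_lin : linear g by move=> a x y; rewrite /g /= !mxE.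
  pose gl : {linear D -> R^o} := HB.pack g (GRing.isLinear.Build R D R^o *:%R g g_lin).
  by have := cf (linfun gl); under eq_fun do rewrite lfunE /=.
have f2 : continuous (fun x => (f x).2).
  apply: rV_continuous => e; pose g (y : D) : R^o := y.2 0 e.
  have g_lin : linear g by move=> a x y; rewrite /g /= !mxE.
  pose gl : {linear D -> R^o} := HB.pack g (GRing.isLinear.Build R D R^o *:%R g g_lin).
  by have := cf (linfun gl); under eq_fun do rewrite lfunE /=.
have -> : f = fun x => ((f x).1, (f x).2) by apply/funext => x; case: (f x).
by move=> x; exact: (cvg_pair (f1 x) (f2 x)).
Qed.

Lemma continuous_into_QW (X : topologicalType) (f : X -> QW) :
  (forall u : 'Hom(QW, R^o), continuous (fun x => u (f x) : R)) -> continuous f.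
Proof.
move=> cf; have f1 : continuous (fun x => (f x).1 : Q).
  apply: (@continuous_comp_initial _ _ _ (@quotv_coord R _ _ : Q -> _)).
  apply: rV_continuous => i; pose g (y : QW) : R^o := coord (vbasis {: Q}) i y.1.
  have g_lin : linear g by move=> a x y; rewrite /g /= linearP.
  pose gl : {linear QW -> R^o} := HB.pack g (GRing.isLinear.Build R QW R^o *:%R g g_lin).
  have := cf (linfun gl); under eq_fun do rewrite lfunE /= /g.
  by under [X in _ -> continuous X]eq_fun do rewrite /= /quotv_coord mxE.
have f2 : continuous (fun x => (f x).2).
  apply: rV_continuous => e; pose g (y : QW) : R^o := y.2 0 e.
  have g_lin : linear g by move=> a x y; rewrite /g /= !mxE.
  pose gl : {linear QW -> R^o} := HB.pack g (GRing.isLinear.Build R QW R^o *:%R g g_lin).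
  by have := cf (linfun gl); under eq_fun do rewrite lfunE /=.
have -> : f = fun x => ((f x).1, (f x).2) by apply/funext => x; case: (f x).
by move=> x; exact: (cvg_pair (f1 x) (f2 x)).
Qed.

Lemma Hom_continuous (L : 'Hom(D, QW)) : continuous (L : D -> QW).
Proof.
apply: continuous_into_QW => u.
have -> : (fun y => u (L y) : R) = (u \o L)%VF :> (D -> R).
  by apply/funext => y; rewrite comp_lfunE.
exact: functional_continuous_D.
Qed.

(** An injective linear map between finite-dimensional spaces is closed: its
    range is cut out by linear equations and it has a linear left inverse. *)
Lemma Hom_closed_map (L : 'Hom(D, QW)) (C : set D) : lker L = 0%VS ->
  closed C -> closed (L @` C).
Proof.
move=> L0 cC; have LK : cancel L (L^-1)%VF by apply: lker0_lfunK; rewrite L0.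
have cinv : continuous ((L^-1)%VF : QW -> D).
  apply: continuous_into_D => u.
  have -> : (fun z => u ((L^-1)%VF z) : R) = (u \o L^-1)%VF :> (QW -> R).
    by apply/funext => y; rewrite comp_lfunE.
  exact: functional_continuous_QW.
pose g (z : QW) := (L \o L^-1 - \1)%VF z.
have -> : L @` C = (L^-1)%VF @^-1` C `&`
    \bigcap_(i in setT) (fun z : QW => coord (vbasis {: QW}) i (g z) : R) @^-1` [set 0].
  apply/seteqP; split=> [_ [y Cy <-]|z [Cz gz]].
    split; first by rewrite /= LK.
    by move=> i _; rewrite /= /g add_lfunE opp_lfunE comp_lfunE id_lfunE LK subrr linear0.
  exists ((L^-1)%VF z) => //; apply/eqP; rewrite -subr_eq0.
  have -> : L ((L^-1)%VF z) - z = g z.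
    by rewrite /g add_lfunE opp_lfunE comp_lfunE id_lfunE.
  rewrite (coord_vbasis (memvf (g z))) big1 // => i _.
  by have := gz i I => /= ->; rewrite scale0r.
apply: closedI; first by move/continuous_closedP: cinv; apply.
apply: closed_bigI => i _; apply: preimage_closed; last exact: closed_eq.
have -> : (fun z : QW => coord (vbasis {: QW}) i (g z) : R) =
    (linfun (coord (vbasis {: QW}) i) \o (L \o L^-1 - \1))%VF :> (QW -> R).
  by apply/funext => y; rewrite comp_lfunE lfunE.
by move=> z _; exact: functional_continuous_QW.
Qed.

End Topology.

(** * The fan of laminar families *)

Section Fan.
Variables (R : realType) (N : nat) (o : 'I_N) (r : nat).
Hypothesis hN : (2 < N)%N.
Local Notation Q := (QN R N).
Local Notation QW := (Q * 'rV[R]_r)%type.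
Local Notation v := (@cut_class R N).
Implicit Types (F : {set {set 'I_N}}) (A B : {set 'I_N}) (z : Q).

Definition cluster_cone F : set Q :=
  [set z | exists2 w : {set 'I_N} -> R,
     {in F, forall A, 0 <= w A} & z = \sum_(A in F) w A *: v A].

Lemma cluster_cone_family (I : finType) (A : I -> {set 'I_N}) (S : {set I}) z :
  injective A ->
  cluster_cone (A @: S)%SET z <->
  exists a : I -> R, [/\ forall e, 0 <= a e, forall e, e \notin S -> a e = 0
                       & z = \sum_e a e *: v (A e)].
Proof.
move=> Ainj; have sumE (a : I -> R) : (forall e, e \notin S -> a e = 0) ->
    \sum_e a e *: v (A e) = \sum_(e in S) a e *: v (A e).
  move=> a0; rewrite [RHS]big_mkcond; apply: eq_bigr => e _.
  by case: ifPn => // /a0 ->; rewrite scale0r.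
split=> [[w w0 ->]|[a [a0 aS ->]]].
  exists (fun e => if e \in S then w (A e) else 0); split=> [e|e /negPf-> //|].
    by case: ifP => // eS; apply/w0/imset_f.
  rewrite sumE => [|e /negPf-> //]; rewrite big_imset /=; last by move=> ? ? _ _ /Ainj.
  by apply: eq_bigr => e ->.
exists (fun B => \sum_(e | A e == B) a e) => [B _|]; first by apply: sumr_ge0.
rewrite sumE // big_imset /=; last by move=> ? ? _ _ /Ainj.
by apply: eq_bigr => e _; rewrite (big_pred1 e) // => e'; rewrite (inj_eq Ainj).
Qed.

(** A point determines the generators that occur in it with positive
    coefficient, and these belong to both families. *)
Lemma cluster_coneI F F' : laminar o F -> laminar o F' ->
  cluster_cone F `&` cluster_cone F' = cluster_cone (F :&: F')%SET.
Proof.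
move=> lF lF'; apply/seteqP; split=> z; last first.
  move=> [w w0 ->]; split.
    exists (fun A => if A \in F' then w A else 0) => [A AF|].
      by case: ifP => // AF'; apply: w0; rewrite inE AF.
    rewrite [LHS]big_mkcond [RHS]big_mkcond; apply: eq_bigr => A _.
    by rewrite inE; case: (A \in F); case: (A \in F'); rewrite ?scale0r.
  exists (fun A => if A \in F then w A else 0) => [A AF|].
    by case: ifP => // AF'; apply: w0; rewrite inE AF AF'.
  rewrite [LHS]big_mkcond [RHS]big_mkcond; apply: eq_bigr => A _.
  by rewrite inE; case: (A \in F); case: (A \in F'); rewrite ?scale0r.
move=> [[w w0 zE] [w' w0' zE']].
have pos (G : {set {set 'I_N}}) (u : {set 'I_N} -> R) : {in G, forall A, 0 <= u A} ->
    \sum_(A in G) u A *: v A = \sum_(A in [set A in G | 0 < u A]%SET) u A *: v A.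
  move=> u0; rewrite [LHS]big_mkcond [RHS]big_mkcond; apply: eq_bigr => A _.
  rewrite inE; have [AG /=|//] := boolP (A \in G).
  by case: ltrgt0P (u0 A AG) => // ->; rewrite scale0r.
have subl G (P : pred {set 'I_N}) : laminar o G -> laminar o [set A in G | P A]%SET.
  by apply: laminarS; apply/fintype.subsetP => A; rewrite inE => /andP[].
have [] := @cut_class_determines R N o _ _ w w' (subl F (fun A => 0 < w A) lF) (subl F' (fun A => 0 < w' A) lF').
- by move=> A; rewrite inE => /andP[].
- by move=> A; rewrite inE => /andP[].
- by rewrite -!pos // -zE.
move=> FF' _; exists (fun A => if (A \in F) && (0 < w A) then w A else 0) => [A _|].
  by case: ifP => // /andP[_ /ltW].
rewrite zE (pos F w w0) [LHS]big_mkcond [RHS]big_mkcond; apply: eq_bigr => A _.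
have := congr1 (fun G : {set {set 'I_N}} => A \in G) FF'; rewrite !inE.
case: (A \in F) => //=; case: (A \in F'); case: (0 < w A) => //=; by rewrite scale0r.
Qed.

Lemma sum_in_span F (w : {set 'I_N} -> R) :
  \sum_(A in F) w A *: v A \in (\sum_(A in F) <[v A]>)%VS.
Proof. by apply: memv_sumr => A _; rewrite memvZ // memv_line. Qed.

Lemma cluster_cone_gen F A : A \in F -> cluster_cone F (v A).
Proof.
move=> AF; exists (fun B => (B == A)%:R) => [B _|]; first by case: (_ == _).
rewrite (bigD1 A) //= eqxx scale1r big1 ?addr0 // => B /andP[_ /negPf->].
by rewrite scale0r.
Qed.

Lemma lin_cluster_cone F : lin (cluster_cone F) = (\sum_(A in F) <[v A]>)%VS.
Proof.
apply: lin_eq => [_ [w _ ->]|W sW]; first exact: sum_in_span.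
by apply/subv_sumP => A AF; rewrite -memvE; apply/sW/cluster_cone_gen.
Qed.

Lemma span_clustersP F z : z \in (\sum_(A in F) <[v A]>)%VS ->
  exists w : {set 'I_N} -> R, z = \sum_(A in F) w A *: v A.
Proof.
move=> /memv_sumP[x xv ->].
have /choice[w wE] : forall A, exists a : R, A \in F -> x A = a *: v A.
  move=> A; have [AF|AF] := boolP (A \in F); last by exists 0.
  by have /vlineP[a ->] := xv A AF; exists a.
by exists w; apply: eq_bigr => A /wE.
Qed.

Lemma dual_sum F A (c : 'Hom(Q, R^o)) (w : {set 'I_N} -> R) : A \in F ->
  {in F, forall B, c (v B) = (B == A)%:R} -> c (\sum_(B in F) w B *: v B) = w A.
Proof.
move=> AF cF; rewrite linear_sum (bigD1 A) //= big1 => [|B /andP[BF BA]].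
  by rewrite addr0 linearZ /= cF // eqxx; exact: mulr1.
by rewrite linearZ /= cF // (negPf BA); exact: mulr0.
Qed.

(** The lattice points in the span of a cone are integral combinations of its
    generators, because the dual coordinates are integral on the lattice. *)
Lemma cone_lattice_clusters F z : laminar o F ->
  z \in (\sum_(A in F) <[v A]>)%VS -> @LambdaN R N z ->
  exists m : {set 'I_N} -> int, z = \sum_(A in F) v A *~ m A.
Proof.
move=> lF /span_clustersP[w ->] zL.
have /choice[m mE] : forall A, exists m : int, A \in F -> w A = m%:~R.
  move=> A; have [AF|AF] := boolP (A \in F); last by exists 0.
  have [c [cF cL]] := cluster_dual R hN lF AF.
  have := cL _ zL; rewrite (dual_sum _ AF cF) => /intrP[m ->].
  by exists m.
by exists m; apply: eq_bigr => A AF; rewrite mE // scaler_int.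
Qed.

(** The generators of the cone already generate its lattice, so the index is that
    of a group in itself. *)
Lemma M0_weight_cluster F : laminar o F -> @M0_weight R N (cluster_cone F) = 1%N.
Proof.
move=> lF; rewrite /M0_weight; set B := zspan _; set A := cone_lattice _ _.
have AB : A = B.
  apply/seteqP; split=> z.
    move=> [zL /=]; rewrite lin_cluster_cone => /(cone_lattice_clusters lF)/(_ zL)[m ->].
    rewrite big_mkcond /= (eq_bigr (fun A : {set 'I_N} => (if A \in F then v A else 0) *~ m A)) => [|C _].
      rewrite (bigID (mem F)) /= [X in _ + X]big1 ?addr0 => [|C /negPf->]; last by rewrite mul0rz.
      elim/big_ind: _ => [||C CF]; [exact: zspan0|exact: zspanD|].
      rewrite CF; apply/zspanMz/zspan_mem; split; first exact: cluster_cone_gen.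
      have := cut_class_LambdaN R hN (laminar_cluster lF CF).
      have /andP[Co C1] := laminar_cluster lF CF.
      have hC : (1 < #|C| < N.-1)%N by rewrite C1 -(card_nonroot_ord o) proper_card.
      by exists C, hC; rewrite (vIE R o).
    by case: ifP => // _; rewrite mul0rz.
  move=> [k [g [a [Bg ->]]]]; split.
    exists k, g, a; split=> // i; by have [_] := Bg i.
  rewrite /=; apply: rpred_sum => i _; apply: rpredMz.
  have [gC _] := Bg i; move: gC => [w w0 ->]; rewrite lin_cluster_cone.
  exact: sum_in_span.
rewrite /zindex; set P := [set n | _].
have B0 : B 0 by exact: zspan0.
have P1 : P 1%N.
  exists (fun=> 0) => [_|x]; first by rewrite AB.
  rewrite AB => Bx; exists ord0; split; first by rewrite subr0.
  by move=> j _; rewrite (ord1 j).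
have [f Af fP] := xgetI 0%N P1; move: f Af fP; set n := xget _ _ => f Af fP.
have Bsub i j : B (f i - f j) by have := Af i; have := Af j; rewrite AB; move=> *; apply: zspanB.
have A0 : A 0 by rewrite AB.
have [i [_ iu]] := fP 0 A0.
have all_i j : j = i by apply/esym/iu; have := Af j; rewrite AB => Bj; rewrite sub0r -[- _]add0r; apply: zspanB.
case: n f Af fP Bsub i iu all_i => [f _ _ _ []//|[//|m] f _ _ _ i _ all_i].
by have := etrans (all_i ord0) (esym (all_i ord_max)) => /(congr1 val).
Qed.

(** Cells are modelled on orthants through this map; the shear accounts for
    measuring the position at a root vertex other than the foot of [o]. *)
Definition cell_fun k (A : 'I_k -> {set 'I_N}) (sh : 'I_k -> 'rV[R]_r)
    (y : 'rV[R]_k * 'rV[R]_r) : QW :=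
  (\sum_e y.1 0 e *: v (A e), y.2 + \sum_e y.1 0 e *: sh e).

Fact cell_fun_is_linear k (A : 'I_k -> {set 'I_N}) sh : linear (@cell_fun k A sh).
Proof.
move=> a x y; apply/pair_eqP => /=; apply/andP; split; apply/eqP.
  rewrite scaler_sumr -big_split; apply: eq_bigr => e _ /=.
  by rewrite !mxE scalerDl scalerA.
rewrite scalerDr addrACA; congr (_ + _); rewrite scaler_sumr -big_split.
by apply: eq_bigr => e _ /=; rewrite !mxE scalerDl scalerA.
Qed.
HB.instance Definition _ k (A : 'I_k -> {set 'I_N}) sh := GRing.isLinear.Build R _ QW *:%R
  (@cell_fun k A sh) (@cell_fun_is_linear k A sh).

Definition cell_map k (A : 'I_k -> {set 'I_N}) sh : 'Hom(('rV[R]_k * 'rV[R]_r)%type, QW) :=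
  linfun (@cell_fun k A sh).

Section CellMap.
Variables (k : nat) (A : 'I_k -> {set 'I_N}) (sh : 'I_k -> 'rV[R]_r).
Hypotheses (Ainj : injective A) (lA : laminar o (A @: [set: 'I_k])%SET).

Lemma cell_map_ker : lker (cell_map A sh) = 0%VS.
Proof.
apply/eqP; rewrite -subv0; apply/subvP => y; rewrite memv_ker lfunE => /eqP y0.
have y1 : y.1 = 0.
  apply/rowP => e; rewrite mxE.
  have AF : A e \in (A @: [set: 'I_k])%SET by apply: imset_f.
  have [c [cF _]] := cluster_dual R hN lA AF.
  have := congr1 (fun x : QW => c x.1) y0; rewrite /= linear0 linear_sum (bigD1 e) //=.
  rewrite linearZ /= cF // eqxx big1 => [<-|e' ee']; first by rewrite addr0; exact/esym/mulr1.
  by rewrite linearZ /= cF ?imset_f // (inj_eq Ainj) (negPf ee'); exact: mulr0.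
have y2 : y.2 = 0.
  have := congr1 snd y0; rewrite /= y1 big1 => [|e _]; first by rewrite addr0.
  by rewrite mxE scale0r.
by rewrite memv0; apply/eqP; move: y1 y2; case: (y) => a b /= -> ->.
Qed.

Lemma cell_map_face (Z : pred 'I_k) :
  cell_map A sh @` orthant_face Z =
  cluster_cone (A @: [set e | ~~ Z e])%SET `*` setT.
Proof.
apply/seteqP; split=> [_ [y [y0 yZ] <-]|[z p] [/= + _]].
  split=> //; rewrite lfunE /=; apply/cluster_cone_family => //.
  exists (fun e => y.1 0 e); split=> // e; rewrite inE negbK; exact: yZ.
move=> /(cluster_cone_family _ _ Ainj)[a [a0 aZ zE]].
exists (\row_e a e, p - \sum_e a e *: sh e).
  by split=> e /=; rewrite mxE // => Ze; apply: aZ; rewrite inE Ze.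
rewrite lfunE /= /cell_fun /=; congr pair.
  by rewrite zE; apply: eq_bigr => e _; rewrite mxE.
rewrite -[RHS](subrK (\sum_e a e *: sh e)); congr (_ + _).
by apply: eq_bigr => e _; rewrite mxE.
Qed.

Lemma cell_map_cone :
  simplicial_cone (cell_map A sh) = cluster_cone (A @: [set: 'I_k])%SET `*` setT.
Proof.
have -> : simplicial_cone (cell_map A sh) = cell_map A sh @` orthant_face pred0.
  by congr (_ @` _); apply/seteqP; split=> y; [split|case].
by rewrite cell_map_face; congr (cluster_cone _ `*` _).
Qed.

End CellMap.

Definition laminar_cone F : set QW := cluster_cone F `*` setT.

Lemma enum_cluster F : ((@enum_val _ (mem F)) @: [set: 'I_#|F|])%SET = F.
Proof.
apply/finset.setP => A; apply/imsetP/idP => [[e _ ->]|AF]; first exact: enum_valP.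
by exists (enum_rank_in AF A); rewrite ?inE // enum_rankK_in.
Qed.

Let cell F := cell_map (@enum_val _ (mem F)) (fun=> 0).

Let cellE F : laminar_cone F = simplicial_cone (cell F).
Proof. by rewrite cell_map_cone ?enum_cluster //; exact: enum_val_inj. Qed.

Let cell_ker F : laminar o F -> lker (cell F) = 0%VS.
Proof. by move=> lF; apply: cell_map_ker; [exact: enum_val_inj|rewrite enum_cluster]. Qed.

Lemma laminar_cone_dim F : laminar o F -> cone_dim (laminar_cone F) = (#|F| + r)%N.
Proof. by move=> lF; rewrite cellE dim_simplicial // cell_ker. Qed.

Lemma laminar_cone_lin F x : laminar o F ->
  x \in lin (laminar_cone F) <-> x.1 \in (\sum_(A in F) <[v A]>)%VS.
Proof.
move=> lF; rewrite cellE lin_simplicial //; split=> [/memv_imgP[y _ ->]|/span_clustersP[w xE]].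
  rewrite lfunE /=; apply: rpred_sum => e _; apply: rpredZ.
  exact: (subvP (sumv_sup (enum_val e) (enum_valP e) (subvv _))) (memv_line _).
have -> : x = cell F (\row_e w (enum_val e), x.2); last by rewrite memv_img ?memvf.
rewrite lfunE /= /cell_fun /=; case: x xE => x1 x2 /= ->; congr pair.
  by rewrite big_enum_val; apply: eq_bigr => e _; rewrite mxE.
by rewrite big1 ?addr0 // => e _; rewrite scaler0.
Qed.

Lemma laminar_cone_face F t : laminar o F ->
  face (laminar_cone F) t <-> exists2 F' : {set {set 'I_N}}, F' \subset F & t = laminar_cone F'.
Proof.
move=> lF; rewrite cellE faceP ?cell_ker //.
have einj : injective (@enum_val _ (mem F)) by exact: enum_val_inj.
split=> [[Z ->]|[F' sF ->]].
  rewrite cell_map_face //; exists (@enum_val _ (mem F) @: [set e | ~~ Z e])%SET => //.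
  by apply/fintype.subsetP => _ /imsetP[e _ ->]; exact: enum_valP.
exists (fun e => enum_val e \notin F'); rewrite cell_map_face //.
congr (cluster_cone _ `*` _); apply/finset.setP => A; apply/idP/imsetP => [AF'|[e + ->]].
  have AF := fintype.subsetP sF _ AF'.
  by exists (enum_rank_in AF A); rewrite ?inE ?negbK enum_rankK_in.
by rewrite inE negbK.
Qed.

Lemma laminar_coneI F F' : laminar o F -> laminar o F' ->
  laminar_cone F `&` laminar_cone F' = laminar_cone (F :&: F')%SET.
Proof.
move=> lF lF'; rewrite /laminar_cone -cluster_coneI //.
by apply/seteqP; split=> x /=; tauto.
Qed.

(** Compare the dimensions of the cones and of their intersection. *)
Lemma laminar_cone_inj F F' : laminar o F -> laminar o F' ->
  laminar_cone F = laminar_cone F' -> F = F'.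
Proof.
move=> lF lF' E; have I := laminar_coneI lF lF'.
have lI : laminar o (F :&: F')%SET := laminarS (finset.subsetIl F F') lF.
have := congr1 (@cone_dim R QW) I; rewrite -E classical_sets.setIid !laminar_cone_dim // => /addIn c1.
have := congr1 (@cone_dim R QW) I; rewrite E classical_sets.setIid !laminar_cone_dim // => /addIn c2.
have /eqP e1 : (F :&: F')%SET == F by rewrite eqEcard finset.subsetIl c1 leqnn.
have /eqP e2 : (F :&: F')%SET == F' by rewrite eqEcard finset.subsetIr c2 leqnn.
by rewrite -e1 e2.
Qed.

Lemma fst_laminar_cone F : fst @` laminar_cone F = cluster_cone F.
Proof. by apply/seteqP; split=> z; [case=> -[a b] [? _] <-|exists (z, 0)]. Qed.

Lemma laminar_cone_gen F A : A \in F -> laminar_cone F (v A, 0).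
Proof. by move=> AF; split=> //; exact: cluster_cone_gen. Qed.

Lemma type_cone_cluster (T : marked_tree N) : @type_cone R N T = cluster_cone (clusters T o).
Proof.
pose A (e : 'I_(nbounded T)) := far_ends o (edge_ends e).
have Ainj : injective A by exact: edge_family_inj.
rewrite -edge_family_image.
have qE (l : 'rV[R]_(nbounded T)) : qN (dist_vec l) = \sum_e l 0 e *: v (A e).
  by rewrite (dist_vecE o) /qN linear_sum; apply: eq_bigr => e _; rewrite linearZ.
apply/seteqP; split=> z.
  move=> [l l0 <-]; apply/cluster_cone_family => //; exists (fun e => l 0 e).
  by split=> // e; rewrite inE.
move=> /(cluster_cone_family _ _ Ainj)[a [a0 _ ->]].
exists (\row_e a e) => [e|]; first by rewrite mxE.
by rewrite qE; apply: eq_bigr => e _; rewrite mxE.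
Qed.

Local Notation X := (prod_fan (M0_fan R N) (real_fan R r)).

Lemma fan_conesP s : fan_cones X s <-> exists2 F, laminar o F & s = laminar_cone F.
Proof.
split=> [[_ [_ [[T _ <-] -> ->]]]|[F lF ->]].
  exists (clusters T o); first exact: clusters_laminar.
  by rewrite /laminar_cone -type_cone_cluster.
exists (cluster_cone F), setT; split=> //; exists (laminar_tree hN lF) => //.
by rewrite type_cone_cluster laminar_tree_clusters.
Qed.

Lemma fan_weight1 F : laminar o F -> fan_weight X (laminar_cone F) = 1%N.
Proof. by move=> lF; rewrite /= fst_laminar_cone M0_weight_cluster. Qed.

Lemma fan_latticeP x : fan_lattice X x <->
  @LambdaN R N x.1 /\ forall j, x.2 0 j \is a Num.int.
Proof.
split=> [[xL /= [y _ yE]]|[xL x2]]; split=> //.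
  by move=> j; rewrite -yE mxE intr_int.
have [z zE] := choice (fun j => elimT (@intrP R (x.2 0 j)) (x2 j)).
by exists (\row_j z j) => //; apply/rowP => j; rewrite !mxE zE.
Qed.

Lemma fan_latticeB x y : fan_lattice X x -> fan_lattice X y -> fan_lattice X (x - y).
Proof.
move=> /fan_latticeP[x1 x2] /fan_latticeP[y1 y2]; apply/fan_latticeP; split.
  exact: zspanB.
by move=> j; rewrite /= !mxE rpredB.
Qed.

Lemma fan_latticeMz x (m : int) : fan_lattice X x -> fan_lattice X (x *~ m).
Proof.
move=> /fan_latticeP[x1 x2]; apply/fan_latticeP.
rewrite -(scaler_int m x); split=> [|j].
  have -> : (m%:~R *: x).1 = x.1 *~ m by exact: (scaler_int m x.1).
  exact: zspanMz.
by rewrite mxE rpredM ?intr_int.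
Qed.

Lemma fan_lattice_gen A : is_cluster o A -> fan_lattice X (v A, 0).
Proof.
move=> cA; apply/fan_latticeP; split; first exact: cut_class_LambdaN cA.
by move=> j; rewrite mxE.
Qed.

Lemma sum_pair (I : finType) (V W : lmodType R) (G : I -> (V * W)%type) :
  \sum_i G i = (\sum_i (G i).1, \sum_i (G i).2).
Proof.
elim/big_rec3: _ => // i x y z _ ->.
by apply: injective_projections.
Qed.

Lemma fan_is_lattice : is_lattice (fan_lattice X).
Proof.
have [I [A [c [Acl cA zE cint]]]] := QN_dual_basis R o hN.
pose coo (j : 'I_r) (y : QW) : R^o := y.2 0 j.
have coo_lin j : linear (coo j) by move=> a x y; rewrite /coo /= !mxE.
pose cool j : {linear QW -> R^o} := HB.pack (coo j) (GRing.isLinear.Build R QW R^o *:%R (coo j) (coo_lin j)).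
pose pr (y : QW) : Q := y.1.
have pr_lin : linear pr by [].
pose prl : {linear QW -> Q} := HB.pack pr (GRing.isLinear.Build R QW Q *:%R pr pr_lin).
pose g (i : I + 'I_r) : QW := match i with inl i => (v (A i), 0) | inr j => (0, delta_mx 0 j) end.
pose cc (i : I + 'I_r) : 'Hom(QW, R^o) :=
  match i with inl i => (c i \o linfun prl)%VF | inr j => linfun (cool j) end.
have ccl i y : cc (inl i) y = c i y.1 by rewrite comp_lfunE (lfunE prl).
have ccr j y : cc (inr j) y = y.2 0 j by exact: (lfunE (cool j) y).
apply: (@dual_lattice _ _ _ _ g cc) => [i j|x|x].
- case: i => i; case: j => j; rewrite ?ccl ?ccr /=.
  + by rewrite cA.
  + by rewrite linear0.
  + by rewrite mxE.
  + by rewrite mxE eqxx.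
- rewrite big_sumType; apply: injective_projections; rewrite /= !sum_pair /=.
    rewrite [X in _ + X]big1 => [|j _]; last by rewrite scaler0.
    by rewrite addr0 [LHS]zE; apply: eq_bigr => i _; rewrite ccl.
  rewrite big1 => [|j _]; last by rewrite scaler0.
  by rewrite add0r [LHS]row_sum_delta; apply: eq_bigr => i _; rewrite ccr.
- split=> [/fan_latticeP[+ x2] [i|j]|h].
  + by rewrite ccl (LambdaNE R o hN) => x1; apply: zspan_int x1 => _ [B cB <-]; exact: cint.
  + by rewrite ccr.
  apply/fan_latticeP; split=> [|j]; last by rewrite -ccr.
  have [m mE] := choice (fun i => elimT (@intrP R (c i x.1)) (introT idP (eq_ind _ (fun t : R => t \is a Num.int) (h (inl i)) _ (ccl i x)))).
  rewrite [x.1]zE (LambdaNE R o hN) (eq_bigr (fun i => v (A i) *~ m i)) => [|i _].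
    by apply: zspan_sum => i; exists (A i).
  by rewrite mE scaler_int.
Qed.

(** Closed under faces and intersections because subfamilies of laminar
    families are laminar and a positive combination determines its family. *)
Lemma fan_is_fan : is_fan X.
Proof.
split.
- exact: fan_is_lattice.
- apply: (@sub_finite_set _ _ (laminar_cone @` setT)); last exact: finite_image.
  by move=> s /fan_conesP[F _ ->]; exists F.
- move=> s /fan_conesP[F lF ->].
  pose g (i : {set 'I_N} + ('I_r + 'I_r)) : QW := match i with
    | inl A => if A \in F then (v A, 0) else 0
    | inr (inl j) => (0, delta_mx 0 j) | inr (inr j) => (0, - delta_mx 0 j) end.
  have Lg i : fan_lattice X (g i).
    case: i => [A|[j|j]]; rewrite /g.
    + case: ifP => [AF|_]; first exact: fan_lattice_gen (laminar_cluster lF AF).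
      by apply/fan_latticeP; split=> [|j]; [exact: zspan0|rewrite mxE rpred0].
    + by apply/fan_latticeP; split=> [|i]; [exact: zspan0|rewrite mxE rpred_nat].
    + by apply/fan_latticeP; split=> [|i]; [exact: zspan0|rewrite !mxE rpredN rpred_nat].
  have -> : laminar_cone F = [set x | exists2 a : {set 'I_N} + ('I_r + 'I_r) -> R,
      (forall i, 0 <= a i) & x = \sum_i a i *: g i]; last exact: rational_cone_fin.
  have sum_g (a : {set 'I_N} + ('I_r + 'I_r) -> R) : \sum_i a i *: g i =
      (\sum_(A in F) a (inl A) *: v A, \row_j (a (inr (inl j)) - a (inr (inr j)))).
    rewrite !big_sumType; apply: injective_projections; rewrite /= !sum_pair /=.
      rewrite ![X in _ + (X + _)]big1 ?[X in _ + (_ + X)]big1 ?addr0.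
      + rewrite [RHS]big_mkcond; apply: eq_bigr => A _.
        by case: ifP => _; rewrite ?scaler0.
      + by move=> j _; rewrite scaler0.
      + by move=> j _; rewrite scaler0.
    rewrite big1 => [|A _]; last by case: ifP => _; rewrite scaler0.
    rewrite add0r -big_split /= [RHS]row_sum_delta; apply: eq_bigr => j _.
    by rewrite mxE scalerN scalerBl.
  apply/seteqP; split=> [[z p] [[w w0 /= ->] _]|x [a a0 ->]].
    (* The lineality space is generated by both signs of the unit vectors, and
       [t = (t + |t|) - |t|]. *)
    exists (fun i => match i with inl A => if A \in F then w A else 0
        | inr (inl j) => p 0 j + `|p 0 j| | inr (inr j) => `|p 0 j| end).
      case=> [A|[j|j]] //; first by case: ifP => // /w0.
      by rewrite -lerBlDl sub0r ler_normr lexx orbT.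
    rewrite sum_g; congr pair; first by apply: eq_bigr => A ->.
    by apply/rowP => j; rewrite mxE addrK.
  rewrite sum_g; split=> //; exists (fun A => a (inl A)) => //= A _; exact: a0.
- move=> s t /fan_conesP[F lF ->] /(laminar_cone_face _ lF)[F' sF ->].
  by apply/fan_conesP; exists F' => //; exact: laminarS sF lF.
- move=> s s' /fan_conesP[F lF ->] /fan_conesP[F' lF' ->]; rewrite laminar_coneI //.
  by split; apply/laminar_cone_face => //; exists (F :&: F')%SET;
    rewrite ?finset.subsetIl ?finset.subsetIr.
Qed.

Lemma laminar0 : laminar o (finset.set0 : {set {set 'I_N}}).
Proof. by apply/laminarP; split=> [A|A|A B]; rewrite inE. Qed.

Let hX : (2 < #|'I_N|)%N. Proof. by rewrite card_ord. Qed.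

Lemma fan_pure_dim : pure_dim X (r + N - 3).
Proof.
have rN : (r + N - 3 = N - 3 + r)%N by rewrite -addnBA // addnC.
split; first by exists (laminar_cone finset.set0); apply/fan_conesP; exists finset.set0 => //; exact: laminar0.
move=> s /fan_conesP[F lF ->]; rewrite laminar_cone_dim // rN; split.
  by rewrite leq_add2r; have := laminar_card lF hX; rewrite card_ord.
have [F' [sF lF' cF']] := laminar_complete hX lF; rewrite card_ord in cF'.
exists (laminar_cone F'); split; first by apply/fan_conesP; exists F'.
  by rewrite laminar_cone_dim // cF'.
by apply/laminar_cone_face => //; exists F.
Qed.

Lemma laminar_cone_lattice F x : laminar o F ->
  cone_lattice (fan_lattice X) (laminar_cone F) x <->
  fan_lattice X x /\ x.1 \in (\sum_(A in F) <[v A]>)%VS.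
Proof. by move=> lF; split=> -[xL /= /laminar_cone_lin h]; split=> //; exact: h. Qed.

(** The coordinate dual to [D] is integral, so a lattice point differs from a
    multiple of the generator by a lattice point of the smaller span. *)
Lemma laminar_normal_vector F D : laminar o F -> D \notin F -> laminar o (D |: F) ->
  normal_vector (fan_lattice X) (laminar_cone F) (laminar_cone (D |: F)) (v D, 0).
Proof.
move=> lF DF lD; have DD : D \in D |: F by rewrite finset.setU11.
have cD := laminar_cluster lD DD.
split.
- apply/laminar_cone_lattice => //; split; first exact: fan_lattice_gen.
  exact: (subvP (sumv_sup D DD (subvv _))) (memv_line _).
- move=> x /(laminar_cone_lattice _ lD)[xL x1].
  have [m xE] := cone_lattice_clusters lD x1 (proj1 (proj1 (fan_latticeP x) xL)).
  exists (m D); apply/laminar_cone_lattice => //; split.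
    by apply: fan_latticeB => //; apply/fan_latticeMz/fan_lattice_gen.
  rewrite -(scaler_int (m D) ((v D, 0) : QW)).
  have -> : (x - (m D)%:~R *: ((v D, 0) : QW)).1 = x.1 - v D *~ m D.
    by rewrite -(scaler_int (m D) (v D)).
  rewrite xE (big_setU1 _ DF) /= [X in X - _]addrC addrK.
  apply: memv_sumr => A AF; apply: rpredMz; exact: memv_line.
- exists (v D, 0), 0; split; last by rewrite addr0.
  + exact: laminar_cone_gen.
  + exact: mem0v.
Qed.

Lemma node_cut_class_lin F B : laminar o F -> B \in nonroot o |: F \/ B \in nodes o F ->
  (v B, 0) \in lin (laminar_cone F).
Proof.
move=> lF hB; apply/laminar_cone_lin => //=.
have FB : B \in F -> v B \in (\sum_(A in F) <[v A]>)%VS.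
  by move=> BF; exact: (subvP (sumv_sup B BF (subvv _))) (memv_line _).
have [/finset.setU1P[->|BF]|/finset.setUP[BF|/imsetP[i io ->]]] := hB.
- by rewrite cut_class_nonroot // mem0v.
- exact: FB.
- exact: FB.
- by rewrite !inE in io; rewrite (cut_class_set1 R hN io) mem0v.
Qed.

(** Balancing around a cone of codimension one is the relation between the
    three ways of resolving its four-valent vertex. *)
Lemma fan_balanced : balanced X (r + N - 3).
Proof.
have rN : (r + N - 3 = N - 3 + r)%N by rewrite -addnBA // addnC.
move=> t /fan_conesP[F lF ->]; rewrite laminar_cone_dim // rN -addSn => /addIn cF above.
have [|A [B1 [B2 [B3 [AF chE b123 ext]]]]] := laminar_codim1 hX lF; first by rewrite card_ord.
have extP D : D \in [set B1 :|: B2; B1 :|: B3; B2 :|: B3]%SET -> D \notin F /\ laminar o (D |: F).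
  by move/ext.
have aboveE s : above s <->
    exists2 D, D \in [set B1 :|: B2; B1 :|: B3; B2 :|: B3]%SET & s = laminar_cone (D |: F).
  split=> [[/fan_conesP[F' lF' ->]]|[D /extP[DF lD] ->]].
    rewrite laminar_cone_dim // => /addIn cF' /(laminar_cone_face _ lF')[F'' sF FF''].
    have E : F = F'' by apply: laminar_cone_inj FF'' => //; exact: laminarS sF lF'.
    subst F''.
    have /fintype.subsetPn[D DF' DF] : ~~ (F' \subset F).
      by apply/negP => /subset_leq_card; rewrite cF' -cF ltnn.
    have F'E : F' = D |: F.
      apply/esym/eqP; rewrite eqEcard finset.subUset finset.sub1set DF' sF /=.
      by rewrite cardsU1 DF cF' -cF.
    by exists D; rewrite -?F'E //; apply/ext; rewrite -F'E.
  split; first by apply/fan_conesP; exists (D |: F).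
    by rewrite laminar_cone_dim // cardsU1 DF -cF.
  by apply/laminar_cone_face => //; exists F => //; exact: finset.subsetUr.
pose U s : set QW := [set u | exists D, [/\ D \in [set B1 :|: B2; B1 :|: B3; B2 :|: B3]%SET,
  s = laminar_cone (D |: F) & u = (v D, 0)]].
have UE D : D \in [set B1 :|: B2; B1 :|: B3; B2 :|: B3]%SET ->
    xget 0 (U (laminar_cone (D |: F))) = (v D, 0).
  move=> Ds; have Uu : U (laminar_cone (D |: F)) (v D, 0) by exists D.
  have [D' [D's E ->]] := xgetI 0 Uu.
  have [[DF lD] [D'F lD']] := (extP _ Ds, extP _ D's).
  have := finset.setU11 D F; rewrite (laminar_cone_inj lD lD' E) => /finset.setU1P[->//|].
  by rewrite (negPf DF).
exists (fun s => xget 0 (U s)).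
  move=> s /aboveE[D Ds ->]; rewrite UE //; have [DF lD] := extP _ Ds.
  exact: laminar_normal_vector.
have [c1 c2 c3] : [/\ B1 \in children o F A, B2 \in children o F A & B3 \in children o F A].
  by rewrite chE !inE !eqxx ?orbT.
have /and3P[b12 b13 b23] := b123.
have neqU (B C C' : {set 'I_N}) : B \in children o F A -> C \in children o F A ->
    C' \in children o F A -> B != C -> C != C' -> B :|: C != B :|: C'.
  move=> cB cC cC' BC CC'; have [CN _ _] := childP lF hX cC.
  have [x xC] := node_neq0 lF CN; apply/eqP => /finset.setP/(_ x).
  rewrite !inE xC orbT => /esym/orP[xB|xC'].
    by rewrite (children_disjoint lF hX cB cC xB xC) eqxx in BC.
  by rewrite (children_disjoint lF hX cC cC' xC xC') eqxx in CC'.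
have [d12 d13 d23] : [/\ B1 :|: B2 != B1 :|: B3, B1 :|: B2 != B2 :|: B3 & B1 :|: B3 != B2 :|: B3].
  split; first exact: neqU.
    by rewrite finset.setUC; apply: neqU => //; rewrite eq_sym.
  by rewrite finset.setUC [X in _ != X]finset.setUC; apply: neqU => //; rewrite eq_sym.
have [D1s D2s D3s] : [/\ B1 :|: B2 \in [set B1 :|: B2; B1 :|: B3; B2 :|: B3]%SET,
    B1 :|: B3 \in [set B1 :|: B2; B1 :|: B3; B2 :|: B3]%SET
  & B2 :|: B3 \in [set B1 :|: B2; B1 :|: B3; B2 :|: B3]%SET].
  by rewrite !inE !eqxx !orbT.
pose cone_of D := laminar_cone (D |: F).
have neq_cone D D' : D \in [set B1 :|: B2; B1 :|: B3; B2 :|: B3]%SET ->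
    D' \in [set B1 :|: B2; B1 :|: B3; B2 :|: B3]%SET -> D != D' -> cone_of D != cone_of D'.
  move=> /extP[DF lD] /extP[D'F lD']; apply: contra_neq => /(laminar_cone_inj lD lD').
  by move=> E; have := finset.setU11 D F; rewrite E => /finset.setU1P[//|]; rewrite (negPf DF).
have E : above = [set` [:: cone_of (B1 :|: B2); cone_of (B1 :|: B3); cone_of (B2 :|: B3)]].
  apply/seteqP; split=> s.
    by move=> /aboveE[D + ->]; rewrite !inE -orbA => /or3P[] /eqP->; rewrite /= !inE eqxx ?orbT.
  rewrite /= !inE => /or3P[] /eqP->; apply/aboveE.
  - by exists (B1 :|: B2).
  - by exists (B1 :|: B3).
  - by exists (B2 :|: B3).
have w1 D : D \in [set B1 :|: B2; B1 :|: B3; B2 :|: B3]%SET -> fan_weight X (cone_of D) = 1%N.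
  by move=> /extP[_ lD]; exact: fan_weight1.
have n12 := neq_cone _ _ D1s D2s d12; have n13 := neq_cone _ _ D1s D3s d13.
have n23 := neq_cone _ _ D2s D3s d23.
rewrite E -fsbig_seq; last by rewrite /= !in_cons !in_nil !orbF negb_or n12 n13 n23.
rewrite !big_cons big_nil !w1 // !mulr1n !UE // Monoid.mulm1 /= addrA.
have -> : (v (B1 :|: B2), 0) + (v (B1 :|: B3), 0) + (v (B2 :|: B3), 0) =
    (v A, 0) + (v B1, 0) + (v B2, 0) + (v B3, 0) :> QW.
  by apply: injective_projections; rewrite /= ?addr0 // (cut_class_merge R hN lF AF chE b123).
have cN B : B \in children o F A -> B \in nodes o F by move=> cB; have [] := childP lF hX cB.
by do !apply: rpredD; apply: node_cut_class_lin => //; auto.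
Qed.

Lemma fan_tropical : is_tropical_fan X (r + N - 3).
Proof.
split; [exact: fan_is_fan|exact: fan_pure_dim| |exact: fan_balanced].
by move=> s /fan_conesP[F lF ->] _; rewrite fan_weight1.
Qed.

End Fan.

(** * Directions and positions *)

Section Directions.
Variables (R : realType) (r n d : nat) (Delta : d.-tuple 'rV[int]_r).
Local Notation N := (n + d)%N.
Variable o : 'I_N.
Hypothesis hsum : \sum_k tnth Delta k = 0.
Implicit Types (T : marked_tree N) (A : {set 'I_N}).

Lemma end_dir_sum : \sum_(i : 'I_N) end_dir Delta i = 0.
Proof.
rewrite big_split_ord /= [X in X + _]big1 => [|i _]; last first.
  by rewrite /end_dir; case: split_ordP => j // /eqP; rewrite eq_lrshift.
rewrite add0r -[RHS]hsum; apply: eq_bigr => k _.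
rewrite /end_dir; case: split_ordP => j; first by move/eqP; rewrite eq_rlshift.
by move/rshift_inj->.
Qed.

Definition cluster_dir A : 'rV[int]_r := \sum_(i in A) end_dir Delta i.

Lemma cluster_dirC A : \sum_(i | i \notin A) end_dir Delta i = - cluster_dir A.
Proof.
apply/eqP; rewrite -addr_eq0 addrC /cluster_dir.
by have := end_dir_sum; rewrite (bigID (mem A)) /= => ->.
Qed.

(** The balancing condition forces the direction of an edge to be the sum of
    the directions of the ends on the side it points to. *)
Definition out_dir T (u w : vert T) : 'rV[int]_r :=
  if w \in far o [set u; w]%SET then cluster_dir (far_ends o [set u; w]%SET)
  else - cluster_dir (far_ends o [set u; w]%SET).

Lemma out_dir_opp T (u w : vert T) : adj T u w -> out_dir w u = - out_dir u w.
Proof.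
move=> uw; rewrite /out_dir [X in u \in far o X]finset.setUC [X in far_ends o X]finset.setUC.
by rewrite (far_edge o uw); case: (w \in _); rewrite ?opprK.
Qed.

Lemma out_dirE T (u w : vert T) : adj T u w ->
  out_dir u w = \sum_i end_dir Delta i *+
    ((foot T i \in far o [set u; w]%SET) == (w \in far o [set u; w]%SET)).
Proof.
move=> uw; rewrite /out_dir; case: ifP => wE; rewrite ?(negbTE _) -?cluster_dirC;
  rewrite /cluster_dir big_mkcond; apply: eq_bigr => i _; rewrite inE;
  by case: (_ \in _); rewrite ?mulr0n ?mulr1n.
Qed.

(** Each end that is not attached to [u] contributes to exactly one of the edges
    at [u], so the total is the sum over all ends. *)
Lemma out_dir_balanced T (u : vert T) :
  \sum_(w | adj T u w) out_dir u w + \sum_(i | foot T i == u) end_dir Delta i = 0.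
Proof.
rewrite (eq_bigr _ (fun w uw => out_dirE uw)) exchange_big /= [X in _ + X]big_mkcond /=.
rewrite -big_split /= -[RHS]end_dir_sum; apply: eq_bigr => i _.
rewrite -[X in _ + X]mulrb sumrMnr -mulrnDr unique_direction.
exact: mulr1n.
Qed.

Definition lab_tree T : lab_type n Delta :=
  @LabType r n d Delta T (@out_dir T) (@out_dir_opp T) (@out_dir_balanced T).

(** In the sum of the balancing conditions over the vertices beyond the edge, the
    edges between such vertices cancel. *)
Lemma lab_dir (T : lab_type n Delta) (u w : vert T) : adj T u w ->
  lt_dir (l := T) u w = out_dir u w.
Proof.
wlog wE : u w / w \in far o [set u; w]%SET => [W uw|uw].
  have [/W/(_ uw)//|wE] := boolP (w \in far o [set u; w]%SET).
  have uE : u \in far o [set w; u]%SET by rewrite finset.setUC far_edge.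
  have wu : adj T w u by rewrite adj_sym.
  by rewrite -[LHS]opprK -lt_dir_opp // (W _ _ uE wu) -out_dir_opp.
set E := [set u; w]%SET in wE *; have uE : u \notin far o E by rewrite far_edge ?negbK.
have : \sum_(v in far o E) (\sum_(x | adj T v x) lt_dir (l := T) v x +
    \sum_(i | foot T i == v) end_dir Delta i) = 0.
  by apply: big1 => v _; exact: lt_balanced.
rewrite big_split /= => H.
have ends : \sum_(v in far o E) \sum_(i | foot T i == v) end_dir Delta i =
    cluster_dir (far_ends o E).
  rewrite /cluster_dir (partition_big (foot T) (mem (far o E))) /=; last by move=> i; rewrite inE.
  apply: eq_bigr => v vE; apply: eq_bigl => i; rewrite inE.
  by case: eqP => [->|]; rewrite ?andbF // vE.
have inner : \sum_(v in far o E) \sum_(x | adj T v x && (x \in far o E)) lt_dir (l := T) v x = 0.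
  set S := LHS; have SN : S = - S.
    rewrite {1}/S /S -sumrN [LHS](eq_bigr (fun v => \sum_(x in far o E) if adj T v x then lt_dir (l := T) v x else 0)); last first.
      by move=> v _; rewrite -big_mkcondr; apply: eq_bigl => x; rewrite andbC.
    rewrite exchange_big /=; apply: eq_bigr => v _; rewrite -big_mkcondr -sumrN.
    apply: eq_big => [x|x /andP[_ xv]]; first by rewrite andbC adj_sym.
    by rewrite lt_dir_opp // adj_sym.
  apply/rowP => j; rewrite mxE; have := congr1 (fun A : 'rV[int]_r => A 0 j) SN.
  rewrite mxE => e; have : S 0 j *+ 2 == 0 by rewrite mulr2n {1}e addNr.
  by rewrite mulrn_eq0 => /eqP.
have outer : \sum_(v in far o E) \sum_(x | adj T v x && (x \notin far o E)) lt_dir (l := T) v x = lt_dir (l := T) w u.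
  have cross v x : v \in far o E -> adj T v x -> x \notin far o E -> v = w /\ x = u.
    move=> vE vx xE; have [|vxE] := eqVneq [set v; x]%SET E.
      by move=> /set2P_eq[[vu _]|//]; rewrite vu (negPf uE) in vE.
    by rewrite (far_other o vx vxE) (negPf xE) in vE.
  rewrite (bigD1 w) //= [X in _ + X]big1 => [|v /andP[vE vw]]; last first.
    by rewrite big1 // => x /andP[vx xE]; have [vw'] := cross v x vE vx xE; rewrite vw' eqxx in vw.
  rewrite addr0 (big_pred1 u) // => x /=; apply/andP/eqP => [[wx xE]|->].
    by have [] := cross w x wE wx xE.
  by rewrite adj_sym.
have split v : \sum_(x | adj T v x) lt_dir (l := T) v x =
    \sum_(x | adj T v x && (x \in far o E)) lt_dir (l := T) v x +
    \sum_(x | adj T v x && (x \notin far o E)) lt_dir (l := T) v x by exact: bigID.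
rewrite ends (eq_bigr _ (fun v _ => split v)) big_split /= inner outer add0r in H.
rewrite /out_dir wE -/E; apply/eqP; rewrite -subr_eq0 -[lt_dir (l := T) u w]opprK -lt_dir_opp //.
by rewrite -opprD H oppr0.
Qed.

(** The change of position on the way from the foot of [o] to [v] that is due to
    the edge [E], per unit of its length. *)
Definition edge_shift T (v : vert T) (E : {set vert T}) : 'rV[R]_r :=
  if v \in far o E then int_vect R (cluster_dir (far_ends o E)) else 0.

Definition displacement T (l : 'rV[R]_(nbounded T)) (v : vert T) : 'rV[R]_r :=
  \sum_e l 0 e *: edge_shift v (edge_ends e).

Lemma int_vectN (z : 'rV[int]_r) : int_vect R (- z) = - int_vect R z.
Proof. by apply/rowP => j; rewrite !mxE rmorphN. Qed.

Lemma displacement_root T (l : 'rV[R]_(nbounded T)) : displacement l (foot T o) = 0.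
Proof. by apply: big1 => e _; rewrite /edge_shift (negPf (root_far _ _)) scaler0. Qed.

Lemma displacement_step T (l : 'rV[R]_(nbounded T)) a b : adj T a b ->
  displacement l b = displacement l a + edge_len l a b *: int_vect R (out_dir a b).
Proof.
move=> ab; rewrite /displacement !(sum_edges _ (edge_shift _)).
have ET := edge_mem ab; set E := [set a; b]%SET in ET.
rewrite (bigD1 E) //= [X in _ = X + _](bigD1 E) //= addrAC -scalerDr; congr (_ *: _ + _).
  rewrite /edge_shift /out_dir -/E (far_edge o ab) -/E.
  by case: (b \in far o E); rewrite ?add0r // int_vectN subrr.
apply: eq_bigr => D /andP[DT DE]; rewrite /edge_shift (@far_other _ _ o D a b) //.
by rewrite eq_sym.
Qed.

Lemma lc_posE (C : lab_curve R n Delta) (u : vert C) :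
  lc_pos u = lc_pos (foot C o) + displacement (lc_len C) u.
Proof.
move: u; apply: (@tree_ind _ _ o).
  by rewrite displacement_root addr0.
by move=> a b ab aE; rewrite (lc_pos_edge ab) aE (displacement_step _ ab) addrA lab_dir.
Qed.

Fact tree_curve_edge T (l : 'rV[R]_(nbounded T)) (p : 'rV[R]_r) (u w : vert (lab_tree T)) :
  adj (lab_tree T) u w -> p + displacement l w =
    p + displacement l u + edge_len l u w *: int_vect R (lt_dir (l := lab_tree T) u w).
Proof. by move=> uw; rewrite -addrA -displacement_step. Qed.

(** Every abstract curve carries a map with given ends, unique up to the image
    of one point. *)
Definition tree_curve T (l : 'rV[R]_(nbounded T)) (l0 : forall e, 0 < l 0 e)
    (p : 'rV[R]_r) : lab_curve R n Delta :=
  @LabCurve R r n d Delta (lab_tree T) l l0 (fun v => p + displacement l v)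
    (@tree_curve_edge T l p).

End Directions.

(** * The coordinates of parametrised curves *)

Section Cells.
Variables (R : realType) (r n d : nat) (Delta : d.-tuple 'rV[int]_r).
Hypotheses (hn : (0 < n)%N) (hN : (3 <= n + d)%N) (hsum : \sum_k tnth Delta k = 0).
Local Notation N := (n + d)%N.
Local Notation o := (lshift d (Ordinal hn) : 'I_N).
Local Notation M := (Mlab R n Delta).
Local Notation QW := (QN R N * 'rV[R]_r)%type.
Local Notation v := (@cut_class R N).

Definition nonzero (T : marked_tree N) (l : 'rV[R]_(nbounded T)) : pred {set vert T} :=
  fun E => elen l E != 0.

Section Contract.
Variables (T : lab_type n Delta) (W : vert T).
Implicit Types (y : 'rV[R]_(nbounded T) * 'rV[R]_r) (C : lab_curve R n Delta).

Lemma contracts_contraction y C : contracts_to W y C -> exists f : vert T -> vert C,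
  [/\ contraction (nonzero y.1) f,
      forall E, E \in bounded_edges T -> nonzero y.1 E ->
        elen (lc_len C) (f @: E)%SET = elen y.1 E
    & lc_pos (f W) = y.2].
Proof.
move=> [f [[fsurj fE] fadj flift ff fW]]; exists f; split=> //.
  split=> // [u w|u w uw /fadj-/(_ uw)[]//].
  rewrite fE; apply: eq_connect => a b /=; congr (_ && _).
  by rewrite /nonzero negbK.
by move=> E /edgeP[u [w [uw ->]]] /fadj-/(_ uw)[_ + _]; rewrite imset_pair.
Qed.

(** The affine map describing the closed cell of [T] with root vertex [W]. *)
Definition cell_lin : 'Hom(('rV[R]_(nbounded T) * 'rV[R]_r)%type, QW) :=
  cell_map (fun e => far_ends o (edge_ends e))
    (fun e => - edge_shift R Delta o W (edge_ends e)).

Lemma cell_linE y : cell_lin y =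
  (qN (dist_vec y.1), y.2 - displacement Delta o y.1 W).
Proof.
rewrite lfunE /= /cell_fun /displacement -sumrN; congr (_, _ + _).
  by rewrite (dist_vecE o) /qN linear_sum; apply: eq_bigr => e _; rewrite linearZ.
by apply: eq_bigr => e _; rewrite scalerN.
Qed.

Definition coords (x : M) : QW := (phiN (psi x), ev (Ordinal hn) x).

Lemma coords_class C :
  coords (lab_class C) = (qN (dist_vec (lc_len C)), lc_pos (foot C o)).
Proof. by rewrite /coords psi_class phiN_class ev_class. Qed.

(** The limit curve need not be in normal form here: distances and positions are
    sums over edges, which contraction preserves. *)
Lemma coords_contracts y C : contracts_to W y C -> coords (lab_class C) = cell_lin y.
Proof.
move=> /contracts_contraction[f [cf fl fW]]; rewrite coords_class cell_linE.
have l0 E : E \in bounded_edges T -> ~~ nonzero y.1 E -> elen y.1 E = 0.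
  by move=> _; rewrite negbK => /eqP.
congr pair.
  congr qN; rewrite !(dist_vecE o).
  apply: (sum_contraction (G := fun E => cut R (far_ends o E))
    (G' := fun E => cut R (far_ends o E)) o cf fl l0) => E ET kE.
  by rewrite (contraction_far_ends o cf ET kE).
rewrite -fW (lc_posE o (f W)).
suff -> : displacement Delta o (lc_len C) (f W) = displacement Delta o y.1 W by rewrite addrK.
apply: (sum_contraction (G := edge_shift R Delta o W)
  (G' := edge_shift R Delta o (f W)) o cf fl l0) => E ET kE.
by rewrite /edge_shift (contraction_far o cf) // (contraction_far_ends o cf ET kE).
Qed.

End Contract.

(** The normal form of a curve: its clusters, their lengths, and the image of
    [o]. *)
Section Canonical.
Variables (F : {set {set 'I_N}}) (lF : laminar o F) (w : {set 'I_N} -> R).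
Hypothesis w0 : {in F, forall A, 0 < w A}.
Local Notation TF := (laminar_tree hN lF).

Lemma family_edge (e : 'I_(nbounded TF)) : far_ends o (edge_ends e) \in F.
Proof.
have : far_ends o (edge_ends e) \in clusters TF o by rewrite imset_f ?edge_endsP.
by rewrite laminar_tree_clusters.
Qed.

Definition family_len : 'rV[R]_(nbounded TF) := \row_e w (far_ends o (edge_ends e)).

Fact family_len_gt0 e : 0 < family_len 0 e.
Proof. by rewrite mxE w0 // family_edge. Qed.

Definition family_curve (p : 'rV[R]_r) : lab_curve R n Delta :=
  tree_curve o hsum family_len_gt0 p.

Lemma elen_family E : E \in bounded_edges TF -> elen family_len E = w (far_ends o E).
Proof. by move=> ET; have [e <-] := edge_ends_surj ET; rewrite elenE mxE. Qed.

Lemma coords_family p :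
  coords (lab_class (family_curve p)) = (\sum_(A in F) w A *: v A, p).
Proof.
rewrite coords_class /= displacement_root addr0; congr pair.
rewrite (dist_vecE o) (sum_edges _ (fun E => cut R (far_ends o E))) /qN linear_sum.
transitivity (\sum_(A in clusters TF o) w A *: v A); last by rewrite laminar_tree_clusters.
rewrite big_imset; last exact: far_ends_inj.
by apply: eq_bigr => E ET; rewrite linearZ elen_family.
Qed.

End Canonical.

(** The boundary of a closed cell is attained by contracting the edges of length
    zero, which yields a curve in normal form. *)
Lemma contracts_family (T : lab_type n Delta) (W : vert T)
    (y : 'rV[R]_(nbounded T) * 'rV[R]_r) : closed_cell_dom y ->
  exists F (lF : laminar o F) w (w0 : {in F, forall A, 0 < w A}) p,
    contracts_to W y (family_curve lF w0 p).
Proof.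
move=> y0; pose keep := nonzero y.1; pose F := kept_clusters o keep.
pose w (A : {set 'I_N}) : R := \sum_(e | far_ends o (edge_ends e) == A) y.1 0 e.
have wE E : E \in bounded_edges T -> w (far_ends o E) = elen y.1 E.
  move=> ET; apply: eq_bigl => e; apply/eqP/eqP => [|->//].
  exact: far_ends_inj (edge_endsP e) ET.
have w0 : {in F, forall A, 0 < w A}.
  move=> _ /kept_clustersP[E [ET kE ->]]; rewrite wE // lt_neqAle eq_sym.
  by apply/andP; split=> //; apply: sumr_ge0.
pose f := squash o keep hN; have cf : contraction keep f by exact: squash_contraction.
have lF : laminar o F := kept_laminar o keep.
pose p := y.2 - displacement Delta o (family_len (kept_laminar o keep) w) (f W).
exists F, (kept_laminar o keep), w, w0, p.
have [fsurj fE fadj flift ff] := cf.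
exists f; split=> //; last by rewrite /= /p subrK.
  split=> // a b; rewrite fE; apply: eq_connect => c c' /=; congr (_ && _).
  by rewrite /keep /nonzero negbK.
move=> a b ab ab0; have ET := edge_mem ab; have adjf := fadj _ _ ab ab0; split=> //.
  rewrite -[RHS]/(elen y.1 [set a; b]%SET) -[LHS]/(elen _ [set f a; f b]%SET).
  rewrite elen_family; last exact: edge_mem.
  by rewrite -imset_pair (contraction_far_ends o cf) // wE.
rewrite (lab_dir o ab) -[LHS]/(out_dir Delta o (f a) (f b)) /out_dir.
by rewrite -imset_pair (contraction_far_ends o cf) // (contraction_far o cf).
Qed.

(** With positive lengths no two vertices are identified. *)
Lemma contracts_iso (C C' : lab_curve R n Delta) (W : vert C) :
  contracts_to W (lc_len C, lc_pos W) C' -> lab_class C = lab_class C'.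
Proof.
move=> [f [[fsurj fE] fadj flift ff fW]].
have elen0 u w : adj C u w -> edge_len (lc_len C) u w != 0.
  move=> /edge_mem/edge_ends_surj[e eE]; rewrite -[edge_len _ _ _]/(elen (lc_len C) [set u; w]%SET).
  by rewrite -eE elenE gt_eqF // lc_len_gt0.
have finj : injective f.
  move=> u w /eqP; rewrite fE => /(connect_ind (P := fun x => u = x)); apply=> // a b.
  by move=> /andP[/elen0/negPf ab]; rewrite /= ab.
have [g gK] := choice fsurj.
apply/lab_classP; exists f; split.
  split=> [|u w|i|u w uw].
  - by exists g => // u; apply: finj; rewrite gK.
  - apply/idP/idP => [/flift[u' [w' [/finj-> /finj->]]]//|uw].
    by have [] := fadj u w uw (elen0 _ _ uw).
  - exact: ff.
  - by have [] := fadj u w uw (elen0 _ _ uw).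
move=> u; apply: (connect_ind (P := fun u => lc_pos (f u) = lc_pos u)) (adj_connected W u) _ => //.
move=> a b ab aE; have [ab' lE dE] := fadj a b ab (elen0 _ _ ab).
by rewrite (lc_pos_edge ab') (lc_pos_edge ab) aE lE dE.
Qed.

Lemma family_classP (x : M) : exists F (lF : laminar o F) w (w0 : {in F, forall A, 0 < w A}) p,
  x = lab_class (family_curve lF w0 p).
Proof.
rewrite -[x]reprK -/(lab_class _); set C := repr x; pose W := foot C o.
have y0 : closed_cell_dom (T := C) (lc_len C, lc_pos W) by move=> e; apply/ltW/lc_len_gt0.
have [F [lF [w [w0 [p cW]]]]] := contracts_family W y0.
by exists F, lF, w, w0, p; apply: contracts_iso cW.
Qed.

(** The family and the lengths are recovered from the point of the quotient, and
    the remaining data of a normal form is the image of [o]. *)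
Lemma coords_inj : injective coords.
Proof.
move=> x x'; have [F [lF [w [w0 [p ->]]]]] := family_classP x.
have [F' [lF' [w' [w0' [p' ->]]]]] := family_classP x'.
rewrite !coords_family => -[E pE]; subst p'.
have [FF' ww'] := cut_class_determines lF lF' w0 w0' E; subst F'.
have lE : lF = lF' by exact: bool_irrelevance.
subst lF'; apply/lab_classP; exists id.
have lenE : family_len lF w = family_len lF w'.
  by apply/rowP => e; rewrite !mxE; apply: ww'; exact: family_edge.
split; last by move=> u; rewrite /= lenE.
split=> //; first by exists id.
by move=> u u' _; rewrite /= lenE.
Qed.

Section CellImage.
Variables (T : lab_type n Delta) (W : vert T).
Local Notation D := ('rV[R]_(nbounded T) * 'rV[R]_r)%type.

Lemma cell_lin_ker : lker (cell_lin W) = 0%VS.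
Proof.
apply: (@cell_map_ker _ _ o); [exact: hN|exact: edge_family_inj|].
by rewrite edge_family_image clusters_laminar.
Qed.

Lemma cell_image_coords (S : set D) : S `<=` (@closed_cell_dom R r n d Delta T) ->
  coords @` cell_image W S = cell_lin W @` S.
Proof.
move=> S0; apply/seteqP; split=> z.
  by move=> [_ [y [C [Sy yC ->]]] <-]; exists y => //; rewrite (coords_contracts yC).
move=> [y Sy <-]; have [F [lF [w [w0 [p yC]]]]] := contracts_family W (S0 _ Sy).
exists (lab_class (family_curve lF w0 p)); last exact: coords_contracts.
by exists y, (family_curve lF w0 p).
Qed.

Lemma closed_cell_coords : coords @` closed_cell W = simplicial_cone (cell_lin W).
Proof. exact: cell_image_coords. Qed.

Lemma closed_cell_cone : coords @` closed_cell W = laminar_cone (clusters T o).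
Proof.
rewrite closed_cell_coords cell_map_cone; last exact: edge_family_inj.
by rewrite edge_family_image.
Qed.

Lemma open_cell_relint :
  coords @` open_cell W = relint (coords @` closed_cell W).
Proof.
rewrite closed_cell_coords relint_simplicial; last exact: cell_lin_ker.
by apply: cell_image_coords => y y0 e; apply/ltW/y0.
Qed.

End CellImage.

Local Notation X := (prod_fan (M0_fan R N) (real_fan R r)).

Lemma cone_is_cell s : fan_cones X s ->
  exists (T : lab_type n Delta) (W : vert T), s = coords @` closed_cell W.
Proof.
move=> /(@fan_conesP R N o r hN)[F lF ->].
pose T := lab_tree o hsum (laminar_tree hN lF); exists T, (foot T o).
by rewrite closed_cell_cone /= laminar_tree_clusters.
Qed.

Lemma coords_range : range coords = range (@phiN R N) `*` setT.
Proof.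
apply/seteqP; split=> [_ [x _ <-]|[z p] [[m _ /= <-] _]]; first by split=> //; exists (psi x).
exists (lab_class (tree_curve o hsum (@curve_len_gt0 _ _ (repr m)) p)) => //.
by rewrite coords_class /= displacement_root addr0.
Qed.

Lemma coords_support : range coords = fan_support X.
Proof.
apply/seteqP; split=> z.
  move=> [x _ <-]; have [F [lF [w [w0 [p ->]]]]] := family_classP x.
  exists (laminar_cone F); first by apply/(@fan_conesP R N o r hN); exists F.
  rewrite coords_family; split=> //; exists w => // A AF; exact/ltW/w0.
by move=> [s /cone_is_cell[T [W ->]]] [x _ <-]; exists x.
Qed.

Lemma coords_continuous (O : set QW) : open O -> open (coords @^-1` O).
Proof.
move=> oO; rewrite Mlab_openE => T W; exists (cell_lin W @^-1` O).
  by move: (@Hom_continuous R N _ _ (cell_lin W)) => /continuousP; apply.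
by move=> y C _ yC; rewrite /= (coords_contracts yC).
Qed.

(** Finitely many closed cells cover the space, and each of them is mapped by
    a closed map, so the image of a closed set is closed. *)
Lemma coords_open (U : set M) : open U -> exists2 O, open O & U = coords @^-1` O.
Proof.
rewrite Mlab_openE => oU; exists (~` (coords @` (~` U))); last first.
  apply/seteqP; split=> x /=.
    by move=> Ux [x' nU /coords_inj xx']; apply: nU; rewrite xx'.
  by move=> nI; apply: contrapT => nU; apply: nI; exists x.
rewrite openC.
have -> : coords @` (~` U) =
    \bigcup_(s in fan_cones X) ((coords @` (~` U)) `&` s).
  apply/seteqP; split=> z; last by move=> [s _ []].
  move=> [x nU <-]; have : fan_support X (coords x).
    by rewrite -coords_support; exists x.
  by move=> [s Xs sx]; exists s => //; split=> //; exists x.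
apply: closed_bigcup; first by have [] := @fan_is_fan R N o r hN.
move=> s /cone_is_cell[T [W ->]]; have [G oG GU] := oU T W.
have -> : (coords @` (~` U)) `&` (coords @` closed_cell W) =
    cell_lin W @` (@closed_cell_dom R r n d Delta T `&` ~` G).
  apply/seteqP; split=> z.
    move=> [[x nU <-] [_ [y [C [y0 yC ->]]] /coords_inj xE]]; exists y.
      split=> // Gy; apply: nU; rewrite -xE; exact/(GU _ _ y0 yC).
    by rewrite -(coords_contracts yC) xE.
  move=> [y [y0 nG] <-]; have [F [lF [w [w0 [p yC]]]]] := contracts_family W y0.
  split; exists (lab_class (family_curve lF w0 p)); try exact: coords_contracts.
    by move=> /(GU _ _ y0 yC).
  by exists y, (family_curve lF w0 p).
apply: Hom_closed_map; first exact: cell_lin_ker.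
apply: closedI; last by apply: open_closedC.
rewrite [X in closed X](_ : _ = \bigcap_(e in [set: 'I_(nbounded T)])
    (fun y : 'rV[R]_(nbounded T) * 'rV[R]_r => y.1 0 e) @^-1` [set t | 0 <= t]); last first.
  by apply/seteqP; split=> y h e; [move=> _; exact: h|exact: h].
apply: closed_bigI => e _; apply: preimage_closed; last exact: closed_ge.
by move=> y _; exact: fst_coord_continuous.
Qed.

End Cells.

Theorem proposition4p7 (R : realType) (r n d : nat)
    (Delta : d.-tuple 'rV[int]_r) (hn : (0 < n)%N) (hN : (3 <= n + d)%N)
    (hDelta : forall k, tnth Delta k != 0)
    (hsum : \sum_k tnth Delta k = 0) :
  let F := fun x : Mlab R n Delta =>
    ((phiN (psi x), ev (Ordinal hn) x) : QN R (n + d) * 'rV[R]_r) in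
  let X := prod_fan (M0_fan R (n + d)) (real_fan R r) in
  [/\ embedding F,
      range F = range (@phiN R (n + d)) `*` setT /\ range F = fan_support X,
      forall (T : lab_type n Delta) (W : vert T),
        [/\ fan_cones X (F @` closed_cell W),
            F @` open_cell W = relint (F @` closed_cell W)
          & exists2 L : 'Hom(('rV[R]_(nbounded T) * 'rV[R]_r)%type,
                             (QN R (n + d) * 'rV[R]_r)%type),
              lker L = 0%VS &
              forall y C, closed_cell_dom y -> contracts_to W y C ->
                F (lab_class C) = L y],
      forall s, fan_cones X s ->
        exists (T : lab_type n Delta) (W : vert T), s = F @` closed_cell W
    & is_tropical_fan X (r + (n + d) - 3)].
Proof.
move=> F X; have FE : F = coords hn by [].
split.
- rewrite FE; split; first exact: coords_inj.
  by move=> U; split=> [oU|[G oG ->]]; [exact: coords_open|exact: coords_continuous].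
- by rewrite FE; split; [exact: coords_range|exact: coords_support].
- move=> T W; rewrite FE; split.
  + rewrite (closed_cell_cone R hn hN hsum W); apply/(@fan_conesP R _ (lshift d (Ordinal hn)) r hN).
    by exists (clusters T (lshift d (Ordinal hn))) => //; exact: clusters_laminar.
  + exact: open_cell_relint.
  + exists (cell_lin R hn W); first exact: cell_lin_ker.
    by move=> y C _; exact: coords_contracts.
- by move=> s; rewrite FE; exact: cone_is_cell.
- exact: (@fan_tropical R _ (lshift d (Ordinal hn)) r hN).
Qed.
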